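(* Let $\mathbb{K}=\mathbb{R}$ or $\mathbb{C}$, let $n\in\mathbb{N}$ with $n\geq 2$, and consider a completely integrable system of partial differential equations in $n$ independent variables $x=(x^1,\dots,x^n)\in\mathbb{K}^n$ and one dependent variable $y\in\mathbb{K}$ of the form $$y_{x^{j_1}x^{j_2}}(x)=F^{j_1,j_2}\bigl(x,y(x),y_{x^1}(x),\dots,y_{x^n}(x)\bigr),\qquad j_1,j_2=1,\dots,n,$$ where $F^{j_1,j_2}=F^{j_2,j_1}$ and the $F^{j_1,j_2}$ are (local) $\mathbb{K}$-analytic functions. Then this system is equivalent, under a local change of coordinates $(x,y)\mapsto(X,Y)=(X(x,y),Y(x,y))$, to the system $Y_{X^{j_1}X^{j_2}}=0$, $j_1,j_2=1,\dots,n$, if and only if there exist (arbitrary) $\mathbb{K}$-analytic functions $G_{j_1,j_2}$, $H_{j_1,j_2}^{k_1}$, $L_{j_1}^{k_1}$ and $M^{k_1}$ of the variables $(x,y)$, for $1\leq j_1,j_2,k_1\leq n$, satisfying the two symmetry conditions $G_{j_1,j_2}=G_{j_2,j_1}$ and $H_{j_1,j_2}^{k_1}=H_{j_2,j_1}^{k_1}$, such that the system is of the specific cubic polynomial form $$y_{x^{j_1}x^{j_2}}=G_{j_1,j_2}+\sum_{k_1=1}^n y_{x^{k_1}}\left(H_{j_1,j_2}^{k_1}+\frac12\,y_{x^{j_1}}\,L_{j_2}^{k_1}+\frac12\,y_{x^{j_2}}\,L_{j_1}^{k_1}+y_{x^{j_1}}\,y_{x^{j_2}}\,M^{k_1}\right),$$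 for $j_1,j_2=1,\dots,n$.
   Context: All functions are assumed to be $\mathbb{K}$-analytic, and all considerations are local. Indices on $y$ denote partial derivatives: $y_{x^j}=\partial y/\partial x^j$, $y_{x^{j_1}x^{j_2}}=\partial^2 y/\partial x^{j_1}\partial x^{j_2}$. In the functions $F^{j_1,j_2}(x,y,y_{x^1},\dots,y_{x^n})$ the quantities $x,y,y_{x^1},\dots,y_{x^n}$ are regarded as independent (first-order jet) variables. Complete integrability of the system means that $$D_{x^{j_3}}\bigl(F^{j_1,j_2}\bigr)=D_{x^{j_2}}\bigl(F^{j_1,j_3}\bigr)\qquad\text{for all } j_1,j_2,j_3=1,\dots,n,$$ identically in $(x,y,y_{x^1},\dots,y_{x^n})$, where $$D_{x^j}:=\frac{\partial}{\partial x^j}+y_{x^j}\frac{\partial}{\partial y}+\sum_{l=1}^n F^{j,l}\frac{\partial}{\partial y_{x^l}}$$ are the total differentiation operators associated with the system. A local change of coordinates is a local $\mathbb{K}$-analytic diffeomorphism $(x,y)\mapsto(X,Y)=(X^1(x,y),\dots,X^n(x,y),Y(x,y))$ of $\mathbb{K}^{n+1}$ (a point transformation). The system is equivalent to $Y_{X^{j_1}X^{j_2}}=0$ under such a transformation if the transformation, prolonged to the second-order jet space, transforms the system into $Y_{X^{j_1}X^{j_2}}=0$, $j_1,j_2=1,\dots,n$, where $Y$ is viewed as the dependent variable and $X^1,\dots,X^n$ as the independent variables. *)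

(* Defs.v *)
From HB Require Import structures.
From mathcomp Require Import all_boot all_order all_algebra.
From mathcomp Require Import all_classical all_reals all_analysis.
From mathcomp.real_closed Require Export complex.

Set Implicit Arguments.
Unset Strict Implicit.
Unset Printing Implicit Defensive.

Import Order.TTheory GRing.Theory Num.Theory.
Import numFieldNormedType.Exports.

Local Open Scope classical_set_scope.
Local Open Scope ring_scope.

(* f is the sum, on an open polydisc centered at a, of a multivariate power
   series that converges absolutely; c alpha is the coefficient of the monomial
   of multi-exponent alpha, and the N-th partial sum runs over the
   multi-exponents all of whose entries are < N. *)
Definition analytic_at (K : numFieldType) (m : nat) (f : 'rV[K]_m -> K)
    (a : 'rV[K]_m) : Prop :=
  exists (c : ('I_m -> nat) -> K) (r C : K),
    [/\ 0 < r,
        forall N : nat,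
          \sum_(alpha : {ffun 'I_m -> 'I_N})
             `|c (fun i => alpha i : nat)| * \prod_(i < m) r ^+ alpha i <= C
      & forall h : 'rV[K]_m, (forall i, `|h 0 i| < r) ->
          (fun N : nat => \sum_(alpha : {ffun 'I_m -> 'I_N})
             c (fun i => alpha i : nat) * \prod_(i < m) h 0 i ^+ alpha i)
            @ \oo --> f (a + h)].


Section Jets.
Variables (K : numFieldType) (n : nat).

(* Points z = (x, y) and first-order jets w = (x, y, p), where p 0 j stands for
   y_{x^j}. *)
Local Notation J0 := ('rV[K]_n * K)%type.
Local Notation J1 := ('rV[K]_n * K * 'rV[K]_n)%type.

Definition row_of_J0 (z : J0) : 'rV[K]_(n + 1) := row_mx z.1 (z.2)%:M.
Definition J0_of_row (v : 'rV[K]_(n + 1)) : J0 := (lsubmx v, rsubmx v 0 0).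
Definition row_of_J1 (w : J1) : 'rV[K]_(n + 1 + n) :=
  row_mx (row_of_J0 w.1) w.2.
Definition J1_of_row (v : 'rV[K]_(n + 1 + n)) : J1 :=
  (J0_of_row (lsubmx v), rsubmx v).

Definition analytic_J0 (f : J0 -> K) (z : J0) : Prop :=
  analytic_at (f \o J0_of_row) (row_of_J0 z).
Definition analytic_J1 (f : J1 -> K) (w : J1) : Prop :=
  analytic_at (f \o J1_of_row) (row_of_J1 w).

Definition analytic_map_J0 (phi : J0 -> J0) (z : J0) : Prop :=
  (forall j : 'I_n, analytic_J0 (fun z' => (phi z').1 0 j) z) /\
  analytic_J0 (fun z' => (phi z').2) z.

Definition local_analytic_diffeo (phi : J0 -> J0) (z0 : J0) : Prop :=
  analytic_map_J0 phi z0 /\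
  exists psi : J0 -> J0,
    [/\ analytic_map_J0 psi (phi z0),
        \forall z \near z0, psi (phi z) = z
      & \forall z \near phi z0, phi (psi z) = z].

(* Total derivatives.  D0 f i w is the total derivative in x^i of a function f
   of (x, y); it depends on y_{x^i}.  D1 f r i w is the total derivative in x^i
   of a function f of (x, y, p) at the second-order jet (w, r), where r i l
   stands for y_{x^i x^l}. *)
Definition D0 (f : J0 -> K) (i : 'I_n) (w : J1) : K :=
  'D_(delta_mx 0 i, 0) f w.1 + w.2 0 i * 'D_(0, 1) f w.1.

Definition D1 (f : J1 -> K) (r : 'M[K]_n) (i : 'I_n) (w : J1) : K :=
  'D_(delta_mx 0 i, 0, 0) f w + w.2 0 i * 'D_(0, 1, 0) f w
  + \sum_(l < n) r i l * 'D_(0, 0, delta_mx 0 l) f w.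

Definition rhs (F : 'I_n -> 'I_n -> J1 -> K) (w : J1) : 'M[K]_n :=
  \matrix_(j1 < n, j2 < n) F j1 j2 w.

Definition completely_integrable (F : 'I_n -> 'I_n -> J1 -> K)
    (w0 : J1) : Prop :=
  \forall w \near w0, forall j1 j2 j3 : 'I_n,
    D1 (F j1 j2) (rhs F w) j3 w = D1 (F j1 j3) (rhs F w) j2 w.

(* Prolongation of phi = (X, Y).  The new jet coordinates Y_{X^k} and
   Y_{X^k X^j} are the solutions of the linear systems
     D_i Y = sum_k D_i X^k * Y_{X^k},
     D_i (Y_{X^j}) = sum_k D_i X^k * Y_{X^k X^j},
   where D_i is the total derivative in x^i.  They make sense at the jets where
   the matrix (D_i X^k) is invertible. *)
Definition total_jacobian (phi : J0 -> J0) (w : J1) : 'M[K]_n :=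
  \matrix_(i < n, k < n) D0 (fun z => (phi z).1 0 k) i w.

Definition prolong1 (phi : J0 -> J0) (w : J1) : 'cV[K]_n :=
  invmx (total_jacobian phi w) *m \col_(i < n) D0 (fun z => (phi z).2) i w.

Definition prolong2 (phi : J0 -> J0) (w : J1) (r : 'M[K]_n) : 'M[K]_n :=
  invmx (total_jacobian phi w) *m
  \matrix_(i < n, j < n) D1 (fun w' => prolong1 phi w' j 0) r i w.

(* The prolonged phi is defined on the second-order jets (w, r), r symmetric,
   with w near w0, and there it maps the locus {y_{x^i x^j} = F^{i,j}} of the
   system exactly onto the part of {Y_{X^k X^j} = 0} it reaches. *)
Definition transforms_to_flat (phi : J0 -> J0) (F : 'I_n -> 'I_n -> J1 -> K)
    (w0 : J1) : Prop :=
  \forall w \near w0,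
    total_jacobian phi w \in unitmx /\
    forall r : 'M[K]_n, r^T = r -> (prolong2 phi w r = 0 <-> r = rhs F w).

Definition equivalent_to_flat (F : 'I_n -> 'I_n -> J1 -> K) (w0 : J1) : Prop :=
  exists phi : J0 -> J0,
    local_analytic_diffeo phi w0.1 /\ transforms_to_flat phi F w0.

End Jets.

(* Main.v *)
Require Import Defs.
From HB Require Import structures.
From mathcomp Require Import all_boot all_order all_algebra.
From mathcomp Require Import all_classical all_reals all_analysis.
From mathcomp.real_closed Require Import complex.
From mathcomp Require mpoly.
Import -(notations) mpoly.
From mathcomp Require Import ring lra.
Set Implicit Arguments.
Unset Strict Implicit.
Unset Printing Implicit Defensive.
Import Order.TTheory GRing.Theory Num.Theory.
Import numFieldNormedType.Exports.
Local Open Scope classical_set_scope.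
Local Open Scope ring_scope.

(** The idea is to read a second-order system geometrically. On the space of
    [z = (x, y)], of dimension [n + 1], the graph of a solution through a jet
    [w = (x, y, p)] is tangent to the hyperplane spanned by the vectors
    [e_i = d_i + p_i d_y], whose conormal is [xi = (p, -1)]. A symmetric connection
    [Gam] gives the graph a second fundamental form, and the totally geodesic graphs
    are the solutions of [y_ij = sum_c xi_c Gam^c(e_i, e_j)]. Since [e_i] and [xi]
    are affine in [p], this is a cubic system, and every system of the stated cubic
    form arises in this way ([hess_connection]). The connection matters only up to
    projective changes [Gam_ab^c + delta_a^c u_b + delta_b^c u_a]
    ([hess_projective]). The theorem thus compares the systems of totally geodesic
    hypersurfaces of connections with the system of hyperplanes.

    The flat system, written in the source coordinates of a point transformation
    [Phi], is the system of the connection [(d Phi)^-1 d d Phi]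
    ([prolong2_eq0_connection]); hence a system equivalent to the flat one is cubic
    ([flat_is_cubic]).

    Conversely, normalise the connection [Pi] of a cubic system to be trace free.
    Comparing the derivative of [y_ij] in [x^k] with that of [y_ik] in [x^j], the
    terms quadratic in the second derivatives cancel and what remains is
    [xi R(e_i, e_k, e_j)], where [R] is the curvature of [Pi]
    ([D1_hess_curvature]). Complete integrability therefore says that this vanishes
    for the hyperplanes close to the given one, and, being polynomial in the
    hyperplane, for all of them ([hyperplane_curvature_eq0]). Such a curvature is
    determined by its Schouten tensor,
    [R^c_{b,da} = delta^c_a rho_db - delta^c_d rho_ab] ([curvature_schouten]), which
    is the vanishing of the projective Weyl tensor. Here [n + 1 >= 3] is used; it
    is used again to deduce from the second Bianchi identity that the Cotton tensor
    vanishes too ([cotton_eq0]). These are exactly the compatibility conditions of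
    the linear system [d_a d_b u = Pi_ab^c d_c u + rho_ab u], which then has a
    solution for every choice of [u] and [du] at the base point
    ([tractor_solution]). Quotients of solutions by a common solution are
    coordinates in which the geodesic hypersurfaces are hyperplanes
    ([projective_coordinates], [integrable_cubic_flat]).

    Two existence theorems for analytic functions carry the construction: for
    linear total differential equations ([linear_frobenius]) and for local inverses
    ([local_inverse]). An analytic germ is handled as a limit of polynomials that is
    Cauchy for the norm [sum_m |c_m| r^|m|], for which products, substitutions,
    derivatives and integration along rays are all bounded; both existence theorems
    are then fixed-point iterations in this norm. The norm takes its values in the
    real numbers whether [K] is real or complex, which lets one argument serve both
    cases. *)

(** * Real-valued absolute values *)

(** The norm of [K] as a real number. Up to [emb] it is the norm of [K], and
    completeness is what the real and the complex numbers add to it. *)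
Record realnorm (R : realType) (K : numFieldType) := RealNorm {
  emb : {rmorphism R -> K};
  nrm : K -> R;
  normE : forall x, `|x| = emb (nrm x);
  le_emb : {mono emb : x y / x <= y};
  nrm_complete : forall u : nat -> K,
    (forall e, 0 < e -> exists N, forall i j, (N <= i)%N -> (N <= j)%N ->
       nrm (u i - u j) < e) ->
    exists l, forall e, 0 < e -> exists N, forall i, (N <= i)%N ->
      nrm (u i - l) < e }.

Arguments normE {R K} r x : rename.
Arguments le_emb {R K} r : rename.
Arguments nrm_complete {R K} r : rename.

Lemma cauchy_real_limit (R : realType) (u : nat -> R) :
  (forall e, 0 < e -> exists N, forall i j, (N <= i)%N -> (N <= j)%N ->
       `|u i - u j| < e) ->
  exists l, forall e, 0 < e -> exists N, forall i, (N <= i)%N ->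
      `|u i - l| < e.
Proof.
move=> uC; have : cvgn u.
  apply/cauchy_cvgP/cauchy_ballP => e e0.
  have [N HN] := uC _ e0.
  pose A := u @` [set i | (N <= i)%N].
  have uA : \forall i \near \oo, A (u i) by exists N => // i /= Ni; exists i.
  exists (A, A) => //= -[_ _] /= [[i Ni <-] [j Nj <-]].
  exact: HN.
move=> /cvgrPdist_lt ul; exists (limn u) => e /ul[N _ HN].
by exists N => i Ni; rewrite distrC; apply: HN.
Qed.

Lemma realnorm_exists (R : realType) (K : numFieldType) :
  K = (R : numFieldType) \/ K = (R[i] : numFieldType) ->
  inhabited (realnorm R K).
Proof.
case=> ->; constructor.
  exact: (@RealNorm R R (idfun : {rmorphism R -> R}) (fun x => `|x|) (fun=> erefl)
    (fun _ _ => erefl) (@cauchy_real_limit R)).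
have nE (x : R[i]) : `|x| = ((Normc.normc x)%:C)%C by [].
apply: (@RealNorm R R[i] (real_complex R : {rmorphism R -> R[i]})
    (@Normc.normc R) nE).
  by move=> x y; rewrite lecR.
have nR (z : R[i]) : `|complex.Re z| <= Normc.normc z.
  case: z => a b /=; rewrite -sqrtr_sqr ler_sqrt ?addr_ge0 ?sqr_ge0 //.
  by rewrite lerDl sqr_ge0.
have nI (z : R[i]) : `|complex.Im z| <= Normc.normc z.
  case: z => a b /=; rewrite -sqrtr_sqr ler_sqrt ?addr_ge0 ?sqr_ge0 //.
  by rewrite lerDr sqr_ge0.
have nle (z : R[i]) :
    Normc.normc z <= `|complex.Re z| + `|complex.Im z|.
  case: z => a b /=.
  have -> : `|a| + `|b| = Num.sqrt ((`|a| + `|b|) ^+ 2).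
    by rewrite sqrtr_sqr [RHS]ger0_norm.
  rewrite ler_sqrt ?sqr_ge0 // sqrrD !real_normK ?num_real //.
  by rewrite [leRHS]addrAC lerDl mulrn_wge0 // mulr_ge0.
move=> u uC.
have [|a Ha] := @cauchy_real_limit R (fun i => complex.Re (u i)).
  move=> e /uC[N HN]; exists N => i j Ni Nj.
  apply: le_lt_trans (HN i j Ni Nj); rewrite -raddfB; exact: nR.
have [|b Hb] := @cauchy_real_limit R (fun i => complex.Im (u i)).
  move=> e /uC[N HN]; exists N => i j Ni Nj.
  apply: le_lt_trans (HN i j Ni Nj); rewrite -raddfB; exact: nI.
exists (a +i* b)%C => e e0; have e2 : 0 < e / 2 by rewrite divr_gt0.
have [Na HNa] := Ha _ e2; have [Nb HNb] := Hb _ e2.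
exists (maxn Na Nb) => i; rewrite geq_max => /andP[ia ib].
apply: (le_lt_trans (nle _)); rewrite !raddfB /=.
rewrite [e]splitr; apply: ltrD; [exact: HNa|exact: HNb].
Qed.

Section RealNorm.
Variables (R : realType) (K : numFieldType) (V : realnorm R K).
Local Notation abs := (nrm V).

Lemma emb_inj : injective (emb V).
Proof. by move=> x y exy; apply/le_anti; rewrite -!(le_emb V) exy lexx. Qed.

Lemma lt_emb : {mono emb V : x y / x < y}.
Proof. exact: leW_mono (le_emb V). Qed.

Lemma nrm_ge0 x : 0 <= abs x.
Proof. by rewrite -(le_emb V) rmorph0 -(normE V). Qed.

Lemma nrm0 : abs 0 = 0.
Proof. by apply: emb_inj; rewrite -(normE V) normr0 rmorph0. Qed.

Lemma nrm1 : abs 1 = 1.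
Proof. by apply: emb_inj; rewrite -(normE V) normr1 rmorph1. Qed.

Lemma nrmN x : abs (- x) = abs x.
Proof. by apply: emb_inj; rewrite -!(normE V) normrN. Qed.

Lemma nrmB x y : abs (x - y) = abs (y - x).
Proof. by rewrite -nrmN opprB. Qed.

Lemma nrmM x y : abs (x * y) = abs x * abs y.
Proof. by apply: emb_inj; rewrite rmorphM -!(normE V) normrM. Qed.

Lemma nrmX x k : abs (x ^+ k) = abs x ^+ k.
Proof. by apply: emb_inj; rewrite rmorphXn -!(normE V) normrX. Qed.

Lemma nrmV x : abs x^-1 = (abs x)^-1.
Proof. by apply: emb_inj; rewrite fmorphV -!(normE V) normfV. Qed.

Lemma nrm_nat k : abs k%:R = k%:R.
Proof. by apply: emb_inj; rewrite rmorph_nat -!(normE V) normr_nat. Qed.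

Lemma nrmD x y : abs (x + y) <= abs x + abs y.
Proof. by rewrite -(le_emb V) rmorphD -!(normE V) ler_normD. Qed.

Lemma nrm_eq0 x : (abs x == 0) = (x == 0).
Proof. by rewrite -(inj_eq emb_inj) -(normE V) rmorph0 normr_eq0. Qed.

Lemma nrm_gt0 x : (0 < abs x) = (x != 0).
Proof. by rewrite lt_neqAle eq_sym nrm_eq0 nrm_ge0 andbT. Qed.

Lemma le_nrm x y : (`|x| <= `|y|) = (abs x <= abs y).
Proof. by rewrite !(normE V) le_emb. Qed.

Lemma nrm_le x y : (`|x| <= y) -> abs x <= abs y.
Proof. by move=> xy; rewrite -le_nrm (ger0_norm (le_trans _ xy)). Qed.

Lemma lt_nrm x y : 0 < y -> (`|x| < y) = (abs x < abs y).
Proof. by move=> y0; rewrite -{1}(gtr0_norm y0) !(normE V) lt_emb. Qed.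

Lemma nrm_emb x : abs (emb V x) = `|x|.
Proof.
have norm_emb y : 0 <= y -> abs (emb V y) = y.
  move=> y0; apply: emb_inj.
  by rewrite -(normE V) ger0_norm // -(rmorph0 (emb V)) le_emb.
have [x0|/ltW x0] := leP 0 x; first by rewrite norm_emb // ger0_norm.
by rewrite ler0_norm // -nrmN -rmorphN norm_emb // oppr_ge0.
Qed.

Lemma emb_gt0 x : (0 < emb V x) = (0 < x).
Proof. by rewrite -(rmorph0 (emb V)) lt_emb. Qed.

Lemma lt_norm_emb x e : (`|x| < emb V e) = (abs x < e).
Proof. by rewrite (normE V) lt_emb. Qed.

Lemma gt0_emb y : 0 < y -> exists2 e, 0 < e & y = emb V e.
Proof.
move=> y0; exists (abs y); last by rewrite -(normE V) gtr0_norm.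
by rewrite nrm_gt0 gt_eqF.
Qed.

Lemma nrm_sum I (s : seq I) (P : pred I) (F : I -> K) :
  abs (\sum_(i <- s | P i) F i) <= \sum_(i <- s | P i) abs (F i).
Proof.
elim/big_rec2: _ => [|i y x _ le_yx]; first by rewrite nrm0.
by apply: le_trans (nrmD _ _) _; rewrite lerD2l.
Qed.

Lemma nrm_prod I (s : seq I) (P : pred I) (F : I -> K) :
  abs (\prod_(i <- s | P i) F i) = \prod_(i <- s | P i) abs (F i).
Proof. by elim/big_rec2: _ => [|i y x _ <-]; [exact: nrm1 | exact: nrmM]. Qed.

Lemma cvg_nrmP (u : nat -> K) l : u @ \oo --> l <->
  (forall e, 0 < e -> exists N, forall k, (N <= k)%N -> abs (u k - l) < e).
Proof.
split=> [/cvgrPdist_lt ul e e0|H].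
  have [|N _ HN] := ul (emb V e); first by rewrite emb_gt0.
  by exists N => k Nk; rewrite nrmB -lt_norm_emb; apply: HN.
apply/cvgrPdist_lt => _ /gt0_emb[e e0 ->]; have [N HN] := H _ e0.
by exists N => // k Nk; rewrite lt_norm_emb nrmB; apply: HN.
Qed.

End RealNorm.

(** * The weighted l1 norm on polynomials *)

Section PolyNorm.
Variables (R : realType) (K : numFieldType) (V : realnorm R K).
Local Notation abs := (nrm V).

Section OneRing.
Variable n : nat.
Local Notation mp := (mpoly n K).
Local Notation "p @_ m" := (mcoeff m p) (at level 3, m at level 2).

Definition mnorm (r : R) (p : mp) : R :=
  \sum_(m <- msupp p) abs (p@_m) * r ^+ mdeg m.

Lemma mnormwE r p w : (msize p <= w)%N ->
  mnorm r p = \sum_(m : bmultinom n w) abs (p@_m) * r ^+ mdeg m.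
Proof.
move=> le_pw; pose I : subFinType _ := bmultinom n w.
rewrite /mnorm (ssrcomplements.big_mksub I) ?msupp_uniq //=; first last.
  by move=> x /msize_mdeg_lt /leq_trans; apply.
rewrite big_rmcond //= => j /memN_msupp_eq0 ->.
by rewrite nrm0 mul0r.
Qed.

Lemma mnorm_ge0 r p : 0 <= r -> 0 <= mnorm r p.
Proof. by move=> r0; apply: sumr_ge0 => m _; rewrite mulr_ge0 ?nrm_ge0 ?exprn_ge0. Qed.

Lemma mnorm0 r : mnorm r 0 = 0.
Proof. by rewrite (@mnormwE _ _ 0) ?mmeasure0 // big1 // => m _; rewrite mcoeff0 nrm0 mul0r. Qed.

Lemma mnormN r p : mnorm r (- p) = mnorm r p.
Proof.
rewrite !(@mnormwE _ _ (msize p)) ?msizeN //.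
by apply: eq_bigr => m _; rewrite mcoeffN nrmN.
Qed.

Lemma mnormD r p q : 0 <= r -> mnorm r (p + q) <= mnorm r p + mnorm r q.
Proof.
move=> r0; pose w := maxn (msize p) (msize q).
rewrite !(@mnormwE _ _ w) ?leq_maxl ?leq_maxr ?msizeD_le // -big_split /=.
apply: ler_sum => m _; rewrite -mulrDl ler_wpM2r ?exprn_ge0 // mcoeffD.
exact: nrmD.
Qed.

Lemma mnormB r p q : 0 <= r -> mnorm r (p - q) <= mnorm r p + mnorm r q.
Proof. by move=> r0; rewrite -[mnorm r q]mnormN; apply: mnormD. Qed.

Lemma mnormBC r p q : mnorm r (p - q) = mnorm r (q - p).
Proof. by rewrite -mnormN opprB. Qed.

Lemma mnormZ r c p : mnorm r (c *: p) = abs c * mnorm r p.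
Proof.
rewrite !(@mnormwE _ _ (msize p)) ?msizeZ_le // mulr_sumr.
by apply: eq_bigr => m _; rewrite mcoeffZ nrmM mulrA.
Qed.

Lemma mnormX r m : mnorm r (mpolyX K m) = r ^+ mdeg m.
Proof. by rewrite /mnorm msuppX big_seq1 mcoeffX eqxx nrm1 mul1r. Qed.

Lemma mnormC r c : mnorm r (mpolyC n c) = abs c.
Proof. by rewrite -[mpolyC n c]alg_mpolyC -mpolyX0 mnormZ mnormX mdeg0 mulr1. Qed.

Lemma mnorm1 r : mnorm r 1 = 1.
Proof. by rewrite -mpolyX0 mnormX mdeg0. Qed.

Lemma mnorm_sum r I (s : seq I) (P : pred I) (F : I -> mp) : 0 <= r ->
  mnorm r (\sum_(i <- s | P i) F i) <= \sum_(i <- s | P i) mnorm r (F i).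
Proof.
move=> r0; elim/big_rec2: _ => [|i y x _ le_yx]; first by rewrite mnorm0.
by apply: le_trans (mnormD _ _ r0) _; rewrite lerD2l.
Qed.

Lemma coeff_mnorm r p m : 0 <= r -> abs (p@_m) * r ^+ mdeg m <= mnorm r p.
Proof.
move=> r0; have [m_p|/memN_msupp_eq0 ->] := boolP (m \in msupp p); last first.
  by rewrite nrm0 mul0r mnorm_ge0.
rewrite /mnorm (big_rem m) //= lerDl sumr_ge0 // => j _.
by rewrite mulr_ge0 ?nrm_ge0 ?exprn_ge0.
Qed.

(** A sum over distinct monomials is a part of the norm, the monomials outside
    the support contributing nothing; this lets arbitrary finite families of
    exponents be compared with [mnorm]. *)
Lemma mnorm_sub (s : seq (multinom n)) r p : 0 <= r -> uniq s ->
  \sum_(m <- s) abs (p@_m) * r ^+ mdeg m <= mnorm r p.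
Proof.
move=> r0 us; pose F m := abs (p@_m) * r ^+ mdeg m.
have F0 m : 0 <= F m by rewrite mulr_ge0 ?nrm_ge0 ?exprn_ge0.
have FE m : F m = \sum_(m' <- msupp p) (m' == m)%:R * F m'.
  have [mp|mp] := boolP (m \in msupp p).
    rewrite (bigD1_seq m) ?msupp_uniq //= eqxx mul1r big1 ?addr0 // => m' /negbTE ->.
    by rewrite mul0r.
  rewrite {1}/F (memN_msupp_eq0 mp) nrm0 mul0r big_seq big1 // => m' mp'.
  by have [e|_] := eqVneq m' m; rewrite ?mul0r //; rewrite -e mp' in mp.
under eq_bigr => m _ do rewrite -/(F m) FE.
rewrite exchange_big /=; apply: ler_sum => m _.
rewrite -mulr_suml -/(F m) -[leRHS]mul1r ler_wpM2r //.
have [ms|ms] := boolP (m \in s).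
  rewrite (bigD1_seq m) //= eqxx big1 ?addr0 // => m' /negbTE.
  by rewrite eq_sym => ->.
rewrite big_seq big1 // => m' ms'.
by have [e|//] := eqVneq m m'; rewrite e ms' in ms.
Qed.

Lemma mnorm_mono r s p : 0 <= s -> s <= r -> mnorm s p <= mnorm r p.
Proof.
move=> s0 sr; apply: ler_sum => m _.
by rewrite ler_wpM2l ?nrm_ge0 // lerXn2r // nnegrE // (le_trans s0).
Qed.

Lemma nrm_meval r p h : (forall i, abs (h i) <= r) -> abs (meval h p) <= mnorm r p.
Proof.
move=> hr; rewrite mevalE; apply: le_trans (nrm_sum _ _ _ _) _.
apply: ler_sum => m _; rewrite nrmM ler_wpM2l ?nrm_ge0 //.
rewrite nrm_prod mdegE.
rewrite -prodrXr; apply: ler_prod => i _.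
by rewrite nrmX exprn_ge0 ?nrm_ge0 //= lerXn2r // nnegrE ?nrm_ge0 // (le_trans _ (hr i)) ?nrm_ge0.
Qed.

End OneRing.

(** A linear operator is bounded as soon as it is so on monomials: the norm of
    [p] is the sum of the norms of its terms. *)
Lemma mnorm_lin n n' (T : mpoly n K -> mpoly n' K) r s c p :
    T p = \sum_(m <- msupp p) mcoeff m p *: T (mpolyX K m) -> 0 <= s ->
    (forall m, mnorm s (T (mpolyX K m)) <= c * r ^+ mdeg m) ->
  mnorm s (T p) <= c * mnorm r p.
Proof.
move=> -> s0 HT.
apply: le_trans (mnorm_sum _ _ _ s0) _; rewrite mulr_sumr.
apply: ler_sum => m _.
by rewrite /= mnormZ mulrCA ler_wpM2l ?nrm_ge0 ?HT.
Qed.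

Lemma mulmpE n (q p : mpoly n K) :
  q * p = \sum_(m <- msupp p) mcoeff m p *: (q * mpolyX K m).
Proof.
rewrite {1}[p]mpolyE mulr_sumr; apply: eq_bigr => m _.
by rewrite scalerAr.
Qed.

Lemma mnormM n r (p q : mpoly n K) : 0 <= r ->
  mnorm r (p * q) <= mnorm r p * mnorm r q.
Proof.
move=> r0; apply: (mnorm_lin (mulmpE p q)) => // m.
rewrite mulrC [leRHS]mulrC; apply: (mnorm_lin (mulmpE (mpolyX K m) p)) => // m'.
by rewrite /= -mpolyXD mnormX mdegD exprD.
Qed.

End PolyNorm.

(** * Substitution, evaluation and differentiation of polynomials *)

Lemma mnm_ind n (P : multinom n -> Prop) :
  P (@mnm0 n) -> (forall i m, P m -> P (mnm_add (mnm1 i) m)) -> forall m, P m.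
Proof.
move=> P0 PS m; move: {-1}(mdeg m) (erefl (mdeg m)) => k.
elim: k m => [|k IH] m mk.
  by move/eqP: mk; rewrite mdeg_eq0 => /eqP ->.
have [i mi] : exists i, m i != 0%N.
  apply/existsP; apply: contraPT mk; rewrite negb_exists => /forallP m0.
  rewrite mdegE big1 // => i _; by have := m0 i; rewrite negbK => /eqP.
have mE : m = mnm_add (mnm1 i) (mnm_sub m (mnm1 i)).
  by rewrite addmC submK // lep1mP.
rewrite mE; apply/PS/IH; apply/eqP.
by rewrite -eqSS -mk {2}mE mdegD mdeg1.
Qed.

Section Seminorm.
Variables (R : realType) (S : comNzRingType) (nu : S -> R).
Hypotheses (nu_ge0 : forall x, 0 <= nu x) (nu1 : nu 1 <= 1).
Hypotheses (nuD : forall x y, nu (x + y) <= nu x + nu y).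
Hypotheses (nuM : forall x y, nu (x * y) <= nu x * nu y).
Hypothesis nuB0 : nu 0 = 0.

Lemma mmap1D n (a : 'I_n -> S) m m' :
  mmap1 a (mnm_add m m') = mmap1 a m * mmap1 a m'.
Proof.
rewrite /mmap1 -big_split; apply: eq_bigr => i _.
by rewrite mnmDE exprD.
Qed.

(** Stated for a submultiplicative seminorm in order to serve both for the
    absolute value, when polynomials are evaluated, and for [mnorm], when they
    are composed. *)
Lemma seminorm_mmap1 n (a : 'I_n -> S) r m : (forall i, nu (a i) <= r) ->
  nu (mmap1 a m) <= r ^+ mdeg m.
Proof.
move=> ar; elim/mnm_ind: m => [|i m IH]; first by rewrite mmap11 mdeg0.
rewrite mmap1D mmap1U mdegD mdeg1 exprS; apply: le_trans (nuM _ _) _.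
by apply: ler_pM.
Qed.

(** Halving the radius absorbs the degree of the monomial, so that the
    Lipschitz constant is the same for all monomials. *)
Lemma seminorm_mmap1_lip n (a b : 'I_n -> S) (r d : R) m : 0 < r -> 0 <= d ->
    (forall i, nu (a i) <= r / 2) -> (forall i, nu (b i) <= r / 2) ->
    (forall i, nu (a i - b i) <= d) ->
  nu (mmap1 a m - mmap1 b m) <= 2 * d / r * r ^+ mdeg m.
Proof.
move=> r0 d0 ar br abd; have r_neq0 : r != 0 by rewrite gt_eqF.
elim/mnm_ind: m => [|i m IH].
  by rewrite !mmap11 subrr nuB0 mdeg0 expr0 mulr1 divr_ge0 ?mulr_ge0 // ltW.
rewrite !mmap1D !mmap1U mdegD mdeg1 add1n (exprS r (mdeg m)).
have -> : a i * mmap1 a m - b i * mmap1 b m =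
  (a i - b i) * mmap1 a m + b i * (mmap1 a m - mmap1 b m) by ring.
apply: le_trans (nuD _ _) _.
have am : nu (mmap1 a m) <= r ^+ mdeg m.
  by apply: seminorm_mmap1 => j; apply: (le_trans (ar j)); lra.
apply: (@le_trans _ _ (d * r ^+ mdeg m + r / 2 * (2 * d / r * r ^+ mdeg m))).
  by apply: lerD; apply: le_trans (nuM _ _) _; apply: ler_pM.
by rewrite le_eqVlt; apply/orP; left; apply/eqP; field.
Qed.

End Seminorm.

Section PolyEstimates.
Variables (R : realType) (K : numFieldType) (V : realnorm R K).
Local Notation abs := (nrm V).
Local Notation mnorm := (mnorm V).

Lemma nrm_lin n (T : mpoly n K -> K) r c p :
    T p = \sum_(m <- msupp p) mcoeff m p * T (mpolyX K m) ->
    (forall m, abs (T (mpolyX K m)) <= c * r ^+ mdeg m) ->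
  abs (T p) <= c * mnorm r p.
Proof.
move=> -> HT; apply: le_trans (nrm_sum _ _ _ _) _; rewrite mulr_sumr.
by apply: ler_sum => m _; rewrite nrmM mulrCA ler_wpM2l ?nrm_ge0.
Qed.

Definition compmp n n' (q : 'I_n -> mpoly n' K) (p : mpoly n K) : mpoly n' K :=
  mmap (@mpolyC n' K) q p.

Lemma compmpX n n' (q : 'I_n -> mpoly n' K) m :
  compmp q (mpolyX K m) = mmap1 q m.
Proof. by rewrite /compmp mmapX. Qed.

Lemma compmpE n n' (q : 'I_n -> mpoly n' K) p :
  compmp q p = \sum_(m <- msupp p) mcoeff m p *: compmp q (mpolyX K m).
Proof. by apply: eq_bigr => m _; rewrite compmpX mul_mpolyC. Qed.

Lemma compmpB n n' (q : 'I_n -> mpoly n' K) p1 p2 :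
  compmp q (p1 - p2) = compmp q p1 - compmp q p2.
Proof. by rewrite /compmp raddfB. Qed.

Lemma meval_compmp n n' (q : 'I_n -> mpoly n' K) p h :
  meval h (compmp q p) = meval (fun i => meval h (q i)) p.
Proof.
rewrite [in RHS]mevalE compmpE raddf_sum; apply: eq_bigr => m _ /=.
rewrite mevalZ compmpX /mmap1 rmorph_prod; congr (_ * _).
by apply: eq_bigr => i _; rewrite rmorphXn.
Qed.

Lemma mnorm_comp n n' (q : 'I_n -> mpoly n' K) p r s : 0 <= s ->
    (forall i, mnorm s (q i) <= r) ->
  mnorm s (compmp q p) <= mnorm r p.
Proof.
move=> s0 qr; rewrite -[leRHS]mul1r.
apply: (mnorm_lin (compmpE q p)) => // m; rewrite compmpX mul1r.
apply: (@seminorm_mmap1 R _ (mnorm s)) => //.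
- by move=> x; apply: mnorm_ge0.
- by rewrite mnorm1.
- by move=> x y; apply: mnormM.
Qed.

Lemma mnorm_comp_lip n n' (q q' : 'I_n -> mpoly n' K) p (r s d : R) :
    0 < r -> 0 <= s -> 0 <= d ->
    (forall i, mnorm s (q i) <= r / 2) -> (forall i, mnorm s (q' i) <= r / 2) ->
    (forall i, mnorm s (q i - q' i) <= d) ->
  mnorm s (compmp q p - compmp q' p) <= 2 * d / r * mnorm r p.
Proof.
move=> r0 s0 d0 qr qr' qd.
apply: (@mnorm_lin _ _ V _ _ (fun p => compmp q p - compmp q' p)) => //.
  rewrite [compmp q p]compmpE [compmp q' p]compmpE -sumrB.
  by apply: eq_bigr => m _; rewrite scalerBr.
move=> m; rewrite !compmpX; apply: (@seminorm_mmap1_lip R _ (mnorm s)) => //.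
- by move=> x; apply: mnorm_ge0.
- by rewrite mnorm1.
- by move=> x y; apply: mnormD.
- by move=> x y; apply: mnormM.
- exact: mnorm0.
Qed.

Lemma meval_mmap1 n (h : 'I_n -> K) m : meval h (mpolyX K m) = mmap1 h m.
Proof. by rewrite mevalX. Qed.

Lemma mmap1_lip n (a b : 'I_n -> K) m (r d : R) : 0 < r -> 0 <= d ->
    (forall i, abs (a i) <= r / 2) -> (forall i, abs (b i) <= r / 2) ->
    (forall i, abs (a i - b i) <= d) ->
  abs (mmap1 a m - mmap1 b m) <= 2 * d / r * r ^+ mdeg m.
Proof.
move=> r0 d0 ar br abd; apply: (@seminorm_mmap1_lip R _ abs) => //.
- exact: nrm_ge0.
- by rewrite nrm1.
- exact: nrmD.
- by move=> x y; rewrite nrmM.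
- exact: nrm0.
Qed.

Lemma meval_lip n (a b : 'I_n -> K) p (r d : R) : 0 < r -> 0 <= d ->
    (forall i, abs (a i) <= r / 2) -> (forall i, abs (b i) <= r / 2) ->
    (forall i, abs (a i - b i) <= d) ->
  abs (meval a p - meval b p) <= 2 * d / r * mnorm r p.
Proof.
move=> r0 d0 ar br abd.
apply: (@nrm_lin _ (fun p : mpoly n K => meval a p - meval b p)).
  rewrite !mevalE -sumrB; apply: eq_bigr => m _.
  by rewrite !mevalX mulrBr.
by move=> m; rewrite !meval_mmap1; apply: mmap1_lip.
Qed.

Lemma mderivE n i (p : mpoly n K) :
  mderiv i p = \sum_(m <- msupp p) mcoeff m p *: mderiv i (mpolyX K m).
Proof.
rewrite {1}[p]mpolyE raddf_sum; apply: eq_bigr => m _.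
by rewrite /= mderivZ.
Qed.

Lemma mderivXU n (i j : 'I_n) m :
  mderiv i (mpolyX K (mnm_add (mnm1 j) m)) =
  (j == i)%:R *: mpolyX K m + mpolyX K (mnm1 j) * mderiv i (mpolyX K m).
Proof.
rewrite mpolyXD mderivM mderivX mnm1E; congr (_ + _).
have [<-|] := eqVneq j i; last by rewrite !scale0r mul0r.
have -> : mnm_sub (mnm1 j) (mnm1 j) = mnm0 by apply/mnmP => k; rewrite mnmBE subnn mnm0E.
by rewrite mpolyX0 !scale1r mul1r.
Qed.

(** The second-order remainder is bounded by [mnorm r p] alone, so that it
    survives the passage to the limit of a sequence of polynomials;
    differentiability of analytic functions follows. *)
Lemma meval_taylor n (h x : 'I_n -> K) p (r d : R) : 0 < r -> 0 <= d ->
    (forall i, abs (h i) <= r / 2) -> (forall i, abs (h i + x i) <= r / 2) ->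
    (forall i, abs (x i) <= d) ->
  abs (meval (fun i => h i + x i) p - meval h p
       - \sum_i x i * meval h (mderiv i p)) <= 4 * d ^+ 2 / r ^+ 2 * mnorm r p.
Proof.
move=> r0 d0 hr hxr xd; have r_neq0 : r != 0 by rewrite gt_eqF.
pose T p := meval (fun i => h i + x i) p - meval h p
       - \sum_i x i * meval h (mderiv i p).
apply: (@nrm_lin _ T).
  rewrite [LHS]/T.
  have -> : \sum_i x i * meval h (mderiv i p) =
      \sum_(m <- msupp p) mcoeff m p *
         \sum_i x i * meval h (mderiv i (mpolyX K m)).
    under [RHS]eq_bigr => m _ do rewrite mulr_sumr.
    rewrite exchange_big; apply: eq_bigr => i _ /=.
    rewrite mderivE raddf_sum mulr_sumr; apply: eq_bigr => m _ /=.
    by rewrite mevalZ mulrCA.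
  rewrite !(mevalE _ p) -!sumrB; apply: eq_bigr => m _ /=.
  by rewrite /T !mevalX !mulrBr.
move=> m; elim/mnm_ind: m => [|j m IH].
  rewrite /T mpolyX0 !meval1 subrr sub0r big1 ?oppr0 ?nrm0; last first.
    by move=> i _; rewrite -mpolyC1 mderivC meval0 mulr0.
  by rewrite mdeg0 expr0 mulr1 divr_ge0 ?mulr_ge0 ?exprn_ge0 // ltW.
have -> : T (mpolyX K (mnm_add (mnm1 j) m)) = h j * T (mpolyX K m)
    + x j * (mmap1 (fun i => h i + x i) m - mmap1 h m).
  rewrite /T; under eq_bigr => i _ do
    rewrite mderivXU mevalD mevalZ mevalM mevalXU mulrDr (mulrCA (x i) (h j)).
  rewrite big_split /= -mulr_sumr (bigD1 j) //= eqxx mul1r big1 => [|i ij].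
    by rewrite mpolyXD !mevalM !mevalXU !meval_mmap1; ring.
  by rewrite eq_sym (negbTE ij) mul0r mulr0.
apply: le_trans (nrmD _ _ _) _; rewrite !nrmM mdegD mdeg1 add1n (exprS r (mdeg m)).
have lip : abs (mmap1 (fun i => h i + x i) m - mmap1 h m) <= 2 * d / r * r ^+ mdeg m.
  by apply: mmap1_lip => // i; rewrite addrC addKr.
apply: (@le_trans _ _ (r / 2 * (4 * d ^+ 2 / r ^+ 2 * r ^+ mdeg m)
   + d * (2 * d / r * r ^+ mdeg m))).
  by apply: lerD; apply: ler_pM; rewrite ?nrm_ge0.
by rewrite le_eqVlt; apply/orP; left; apply/eqP; field.
Qed.

(** Halving the radius pays for the factor [mdeg m] that the derivative brings
    out, as in Cauchy's estimate. *)
Lemma mnorm_deriv n i (p : mpoly n K) r : 0 < r ->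
  mnorm (r / 2) (mderiv i p) <= 2 / r * mnorm r p.
Proof.
move=> r0; have r_neq0 : r != 0 by rewrite gt_eqF.
have r20 : 0 <= r / 2 by rewrite divr_ge0 // ltW.
apply: (mnorm_lin (mderivE i p)) => // m.
elim/mnm_ind: m => [|j m IH].
  rewrite mpolyX0 -mpolyC1 mderivC mnorm0 mdeg0 expr0 mulr1 divr_ge0 //.
  by rewrite ltW.
rewrite mderivXU; apply: le_trans (mnormD _ _ _ r20) _.
rewrite mnormZ mdegD mdeg1 add1n (exprS r (mdeg m)).
have := mnormM V (mpolyX K (mnm1 j)) (mderiv i (mpolyX K m)) r20.
rewrite !mnormX mdeg1 expr1 => H.
have le1 : abs (j == i)%:R * (r / 2) ^+ mdeg m <= r ^+ mdeg m.
  rewrite -[leRHS]mul1r; apply: ler_pM; rewrite ?nrm_ge0 ?exprn_ge0 //.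
    by rewrite nrm_nat; case: (j == i).
  by apply: lerXn2r; rewrite ?nnegrE ?ltW //; lra.
have le2 : r / 2 * mnorm (r / 2) (mderiv i (mpolyX K m))
   <= r / 2 * (2 / r * r ^+ mdeg m) by apply: ler_wpM2l.
apply: (le_trans (lerD le1 (le_trans H le2))).
by rewrite le_eqVlt; apply/orP; left; apply/eqP; field.
Qed.

Definition mscale n (w : multinom n -> K) (p : mpoly n K) : mpoly n K :=
  \sum_(m <- msupp p) mcoeff m p *: (w m *: mpolyX K m).

Lemma mcoeff_mscale n w (p : mpoly n K) m :
  mcoeff m (mscale w p) = w m * mcoeff m p.
Proof.
rewrite /mscale raddf_sum /=.
under eq_bigr => m' _ do rewrite !mcoeffZ mcoeffX.
have [mp|mp] := boolP (m \in msupp p).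
  rewrite (bigD1_seq m) ?msupp_uniq //= eqxx mulr1 big1 => [|m' /negbTE ->].
    by rewrite addr0 mulrC.
  by rewrite !mulr0.
rewrite (memN_msupp_eq0 mp) mulr0 big_seq big1 // => m' mp'.
have [e|_] := eqVneq m' m; last by rewrite !mulr0.
by rewrite -e mp' in mp.
Qed.

Lemma mscaleB n w (p q : mpoly n K) : mscale w (p - q) = mscale w p - mscale w q.
Proof. by apply/mpolyP => m; rewrite mcoeffB !mcoeff_mscale mcoeffB mulrBr. Qed.

Lemma mnorm_mscale n w (p : mpoly n K) (r s c : R) : 0 <= s ->
    (forall m, abs (w m) * s ^+ mdeg m <= c * r ^+ mdeg m) ->
  mnorm s (mscale w p) <= c * mnorm r p.
Proof.
move=> s0 wc.
have mscaleX m : mscale w (mpolyX K m) = w m *: mpolyX K m.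
  by rewrite /mscale msuppX big_seq1 mcoeffX eqxx scale1r.
apply: (@mnorm_lin _ _ V _ _ (mscale w)) => // [|m].
  by apply: eq_bigr => m _; rewrite mscaleX.
by rewrite mscaleX mnormZ mnormX.
Qed.

Definition hipart n d (p : mpoly n K) : mpoly n K :=
  mscale (fun m => (d <= mdeg m)%N%:R) p.

(** Shrinking the radius makes the higher-order part small; this is how small
    polydiscs turn the iterations below into contractions. *)
Lemma mnorm_hipart n d (p : mpoly n K) (r s : R) : 0 < s -> s <= r ->
  mnorm s (hipart d p) <= (s / r) ^+ d * mnorm r p.
Proof.
move=> s0 sr; have r0 : 0 < r := lt_le_trans s0 sr.
have sr0 : 0 <= s / r by rewrite divr_ge0 // ltW.
apply: mnorm_mscale => [|m]; first exact: ltW.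
rewrite nrm_nat; case: leqP => [dm|_]; last first.
  by rewrite mul0r mulr_ge0 ?exprn_ge0 // ltW.
have -> : s ^+ mdeg m = (s / r) ^+ mdeg m * r ^+ mdeg m.
  by rewrite -exprMn divfK // gt_eqF.
rewrite mul1r ler_wpM2r ?exprn_ge0 ?(ltW r0) //.
by rewrite ler_wiXn2l // ler_pdivrMr // mul1r.
Qed.

Lemma hipart1 n (p : mpoly n K) : hipart 1 p = p - mpolyC n (mcoeff (@mnm0 n) p).
Proof.
apply/mpolyP => m; rewrite mcoeff_mscale mcoeffB mcoeffC lt0n mdeg_eq0.
have [->|_] := eqVneq m mnm0; first by rewrite mul0r mulr1 subrr.
by rewrite mul1r mulr0 subr0.
Qed.

Lemma hipart2 n (p : mpoly n K) : hipart 2 p = p - mpolyC n (mcoeff (@mnm0 n) p)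
  - \sum_i mcoeff (mnm1 i) p *: mpolyX K (mnm1 i).
Proof.
apply/mpolyP => m; rewrite mcoeff_mscale !mcoeffB mcoeffC raddf_sum /=.
under eq_bigr => i _ do rewrite mcoeffZ mcoeffX.
have [m2|] := leqP 2 (mdeg m).
  have /negbTE -> : m != mnm0 by rewrite -mdeg_eq0; case: (mdeg m) m2.
  rewrite big1 ?mul1r ?mulr0 ?subr0 // => i _.
  have [im|_] := eqVneq (mnm1 i) m; last by rewrite mulr0.
  by rewrite -im mdeg1 in m2.
rewrite ltnS leq_eqVlt ltnS leqn0 mul0r => /orP[/mdeg1P[i /eqP ->]|].
  rewrite mnm1_eq0 mulr0 subr0 (bigD1 i) //= eqxx mulr1 big1 ?addr0 ?subrr //.
  by move=> j ji; rewrite eq_mnm1 (negbTE ji) mulr0.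
rewrite mdeg_eq0 => /eqP ->; rewrite eqxx mulr1 subrr sub0r big1 ?oppr0 // => i _.
by rewrite mnm1_eq0 mulr0.
Qed.

(** [rayint p] is the average of [p] along the rays from the origin, that is
    the integral of [p (t h)] over [t] in [0, 1]. *)
Definition rayint n (p : mpoly n K) : mpoly n K :=
  mscale (fun m => (mdeg m).+1%:R^-1) p.

Lemma mnorm_rayint n (p : mpoly n K) r : 0 <= r -> mnorm r (rayint p) <= mnorm r p.
Proof.
move=> r0; rewrite -[leRHS]mul1r; apply: mnorm_mscale => // m.
rewrite ler_wpM2r ?exprn_ge0 // nrmV nrm_nat.
by rewrite invf_le1 ?ltr0n // ler1n.
Qed.

(** The radial derivative, which multiplies a monomial by its degree. *)
Definition euler n (p : mpoly n K) : mpoly n K :=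
  \sum_i mpolyX K (mnm1 i) * mderiv i p.

Lemma eulerX n m : euler (mpolyX K m) = (mdeg m)%:R *: mpolyX K m :> mpoly n K.
Proof.
rewrite /euler mdegE natr_sum scaler_suml; apply: eq_bigr => i _.
rewrite mderivX -scalerAr -mpolyXD.
have [->|mi] := eqVneq (m i) 0%N; first by rewrite !scale0r.
by rewrite addmC submK // lep1mP.
Qed.

Lemma mcoeff_euler n (p : mpoly n K) m :
  mcoeff m (euler p) = (mdeg m)%:R * mcoeff m p.
Proof.
have -> : euler p = \sum_(m <- msupp p) mcoeff m p *: euler (mpolyX K m).
  rewrite /euler; under eq_bigr => i _ do rewrite mderivE mulr_sumr.
  rewrite exchange_big; apply: eq_bigr => m' _ /=.
  by rewrite scaler_sumr; apply: eq_bigr => i _; rewrite scalerAr.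
rewrite [in RHS](congr1 (mcoeff m) (mpolyE p)) !raddf_sum mulr_sumr.
rewrite -natr_sum -/(mdeg m); apply: eq_bigr => m' _ /=.
rewrite eulerX !mcoeffZ mcoeffX.
have [->|] := eqVneq m' m; first by rewrite mulrCA.
by rewrite !mulr0.
Qed.

Lemma rayint_euler n (p : mpoly n K) : rayint (euler p + p) = p.
Proof.
apply/mpolyP => m; rewrite mcoeff_mscale mcoeffD mcoeff_euler.
rewrite -[X in _ + X]mul1r -mulrDl natr1 mulKf // pnatr_eq0 //.
Qed.

End PolyEstimates.

(** * Double sequences that become small *)

Section Small2.
Variable R : realType.
Implicit Types d : nat -> nat -> R.

(** Convergence to zero as both indices tend to infinity. The distances between
    terms of a sequence are of this form, and so are the error terms of an
    iteration. *)
Definition small2 d := forall e, 0 < e ->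
  exists N, forall k l, (N <= k)%N -> (N <= l)%N -> d k l < e.

Lemma small2_le d d' : (forall k l, d k l <= d' k l) -> small2 d' -> small2 d.
Proof.
move=> dd' sd' e /sd'[N HN]; exists N => k l Nk Nl.
exact: le_lt_trans (dd' _ _) (HN _ _ Nk Nl).
Qed.

Lemma small2D d d' : small2 d -> small2 d' -> small2 (fun k l => d k l + d' k l).
Proof.
move=> sd sd' e e0; have e2 : 0 < e / 2 by rewrite divr_gt0.
have [N HN] := sd _ e2; have [N' HN'] := sd' _ e2.
exists (maxn N N') => k l; rewrite !geq_max => /andP[? ?] /andP[? ?].
by rewrite [e]splitr ltrD ?HN ?HN'.
Qed.

Lemma small20 : small2 (fun _ _ => 0).
Proof. by move=> e e0; exists 0%N. Qed.

Lemma small2Z c d : 0 <= c -> small2 d -> small2 (fun k l => c * d k l).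
Proof.
move=> c0 sd e e0.
have c1 : 0 < c + 1 by rewrite ltr_wpDl.
have [N HN] := sd (e / (c + 1)) (divr_gt0 e0 c1).
exists N => k l Nk Nl; have [d0|d0] := leP (d k l) 0.
  by apply: le_lt_trans e0; rewrite mulr_ge0_le0.
apply: (@le_lt_trans _ _ ((c + 1) * d k l)); first by rewrite ler_wpM2r ?lerDl // ltW.
by rewrite mulrC -ltr_pdivlMr // HN.
Qed.

Lemma small2_sum (I : finType) (d : I -> nat -> nat -> R) :
  (forall i, small2 (d i)) -> small2 (fun k l => \sum_i d i k l).
Proof.
move=> sd; have : forall s : seq I, small2 (fun k l => \sum_(i <- s) d i k l).
  elim=> [|i s IH]; first by apply: small2_le small20 => k l; rewrite big_nil.
  by apply: small2_le (small2D (sd i) IH) => k l; rewrite big_cons.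
by apply.
Qed.

Lemma exp2_small (C e : R) : 0 < e -> exists j, C / 2 ^+ j < e.
Proof.
move=> e0; exists (Num.bound (`|C| / e)).
rewrite ltr_pdivrMr ?exprn_gt0 // mulrC -ltr_pdivrMr //.
apply: (@le_lt_trans _ _ (`|C| / e)); first by rewrite ler_wpM2r ?invr_ge0 ?ler_norm // ltW.
apply: (lt_trans (archi_boundP _)); first by rewrite divr_ge0 // ltW.
by rewrite -natrX ltr_nat ltn_expl.
Qed.

(** Any term is reached from earlier ones by halvings, and the errors add up to a
    geometric series. *)
Lemma small2_contract d C :
    (forall k l, d k l <= C) ->
    (forall e, 0 < e -> exists N, forall k l, (N <= k)%N -> (N <= l)%N ->
       d k.+1 l.+1 <= d k l / 2 + e) ->
  small2 d.
Proof.
move=> dC step e e0; have e4 : 0 < e / 4 by rewrite divr_gt0.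
have [N HN] := step _ e4.
have bnd j k l : (N + j <= k)%N -> (N + j <= l)%N -> d k l <= C / 2 ^+ j + e / 2.
  elim: j k l => [|j IH] k l.
    by move=> _ _; rewrite expr0 divr1; apply: (le_trans (dC k l)); lra.
  case: k => [|k]; first by rewrite addnS.
  case: l => [|l]; first by rewrite addnS.
  rewrite addnS !ltnS => Nk Nl.
  have := HN k l (leq_trans (leq_addr _ _) Nk) (leq_trans (leq_addr _ _) Nl).
  have := IH k l Nk Nl; rewrite exprS invfM; set x := _^-1 => H1 H2.
  by apply: (le_trans H2); lra.
have [j Hj] : exists j, C / 2 ^+ j < e / 2 by apply: exp2_small; lra.
exists (N + j)%N => k l Nk Nl; apply: (le_lt_trans (bnd j k l Nk Nl)); lra.
Qed.

End Small2.

(** * Power series as limits of polynomials *)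

Section Approx.
Variables (R : realType) (K : numFieldType) (V : realnorm R K).
Local Notation abs := (nrm V).
Local Notation mnorm := (mnorm V).

Lemma cvg_nrm_le (u : nat -> K) l C N : u @ \oo --> l ->
  (forall k, (N <= k)%N -> abs (u k) <= C) -> abs l <= C.
Proof.
move=> /(cvg_nrmP V) ul uC; apply/ler_addgt0Pr => e e0.
have [M HM] := ul _ e0; pose k := maxn M N.
have -> : l = u k - (u k - l) by rewrite subKr.
apply: le_trans (nrmD _ _ _) _; rewrite nrmN lerD ?uC ?leq_maxr // ltW //.
by rewrite HM // leq_maxl.
Qed.

Lemma cvgn_sum (I : finType) (u : I -> nat -> K) (l : I -> K) :
  (forall i, u i @ \oo --> l i) ->
  (fun k => \sum_i u i k) @ \oo --> \sum_i l i.
Proof.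
move=> ul; elim: (index_enum I) => [|i s IH].
  rewrite big_nil (_ : (fun k => _) = fun=> 0); first exact: cvg_cst.
  by apply/funext => k; rewrite big_nil.
rewrite big_cons (_ : (fun k => _) = u i \+ (fun k => \sum_(j <- s) u j k)).
  exact: cvgD.
by apply/funext => k; rewrite big_cons.
Qed.

Section Fix_n.
Variable n : nat.
Local Notation mp := (mpoly n K).
Implicit Types (p q : nat -> mp) (g : 'rV[K]_n -> K) (r s : R).

(** Cauchy sequences for [mnorm r], that is, power series that converge in this
    norm. *)
Definition cau r p := small2 (fun k l => mnorm r (p k - p l)).

Lemma cau_bound r p : 0 <= r -> cau r p ->
  exists2 C : R, 0 < C & forall k, mnorm r (p k) <= C.
Proof.
move=> r0 pC; have [N HN] := pC 1 ltr01.
have S0 : 0 <= \sum_(i < N) mnorm r (p i) by apply: sumr_ge0 => i _; apply: mnorm_ge0.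
have pN0 : 0 <= mnorm r (p N) by apply: mnorm_ge0.
exists (1 + mnorm r (p N) + \sum_(i < N) mnorm r (p i)); first by lra.
move=> k; have [kN|Nk] := ltnP k N.
  have : mnorm r (p k) <= \sum_(i < N) mnorm r (p i).
    rewrite (bigD1 (Ordinal kN)) //= lerDl.
    by apply: sumr_ge0 => i _; apply: mnorm_ge0.
  lra.
have := mnormD V (p k - p N) (p N) r0; rewrite subrK.
have := HN _ _ Nk (leqnn N); lra.
Qed.

Lemma cau_cvg r p h : cau r p -> (forall i, abs (h i) <= r) ->
  cvgn (fun k => meval h (p k)).
Proof.
move=> pC hr; have [|l Hl] := nrm_complete V (fun k => meval h (p k)).
  move=> e /pC[N HN]; exists N => k l Nk Nl.
  by rewrite -mevalB; apply: le_lt_trans (HN _ _ Nk Nl); apply: nrm_meval.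
by apply/cvg_ex; exists l; apply/(cvg_nrmP V).
Qed.

Lemma cau_le s r p q c : 0 <= c ->
  (forall k l, mnorm s (q k - q l) <= c * mnorm r (p k - p l)) -> cau r p -> cau s q.
Proof. by move=> c0 H pC; apply: small2_le H _; apply: small2Z. Qed.

Lemma cau_shrink s r p : 0 <= s -> s <= r -> cau r p -> cau s p.
Proof.
move=> s0 sr; apply: (@cau_le _ _ _ _ 1) => // k l.
by rewrite mul1r; apply: mnorm_mono.
Qed.

Lemma cauD r p q : 0 <= r -> cau r p -> cau r q -> cau r (fun k => p k + q k).
Proof.
move=> r0 pC qC; apply: small2_le (small2D pC qC) => k l.
by rewrite opprD addrACA mnormD.
Qed.

Lemma cauN r p : cau r p -> cau r (fun k => - p k).
Proof.
apply: small2_le => k l; rewrite -opprD mnormN //.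
Qed.

Lemma cau_cst r (a : mp) : cau r (fun=> a).
Proof. by apply: small2_le (@small20 R) => k l; rewrite subrr mnorm0. Qed.

Lemma cauM r p q : 0 <= r -> cau r p -> cau r q -> cau r (fun k => p k * q k).
Proof.
move=> r0 pC qC; have [C C0 HC] := cau_bound r0 pC.
have [D D0 HD] := cau_bound r0 qC.
apply: small2_le (small2D (small2Z (ltW C0) qC) (small2Z (ltW D0) pC)) => k l.
have -> : p k * q k - p l * q l = p k * (q k - q l) + q l * (p k - p l) by ring.
apply: le_trans (mnormD _ _ _ r0) _.
by apply: lerD; apply: le_trans (mnormM _ _ _ r0) _; apply: ler_wpM2r; rewrite ?mnorm_ge0.
Qed.

Lemma cau_sum r (I : finType) (p : I -> nat -> mp) : 0 <= r ->
  (forall i, cau r (p i)) -> cau r (fun k => \sum_i p i k).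
Proof.
move=> r0 pC; apply: small2_le (small2_sum pC) => k l.
by rewrite -sumrB; apply: mnorm_sum.
Qed.

Lemma cau_deriv r p i : 0 < r -> cau r p -> cau (r / 2) (fun k => mderiv i (p k)).
Proof.
move=> r0; apply: (@cau_le _ _ _ _ (2 / r)); first by rewrite divr_ge0 // ltW.
by move=> k l; rewrite -mderivB; apply: mnorm_deriv.
Qed.

(** The sequence [p] represents [g] on the open polydisc of radius [r] around
    the origin, with convergence in the weighted l1 norm. *)
Definition approx r p g := [/\ 0 < r, cau r p &
  forall h : 'rV[K]_n, (forall i, abs (h 0 i) < r) ->
    (fun k => meval (h 0) (p k)) @ \oo --> g h].

Lemma approx_shrink s r p g : 0 < s -> s <= r -> approx r p g -> approx s p g.
Proof.
move=> s0 sr [r0 pC pg]; split=> //; first exact: (cau_shrink (ltW s0) sr pC).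
by move=> h hs; apply: pg => i; apply: lt_le_trans (hs i) sr.
Qed.

Lemma approx_lim r p : 0 < r -> cau r p ->
  approx r p (fun h : 'rV[K]_n => limn (fun k => meval (h 0) (p k))).
Proof.
by move=> r0 pC; split=> // h hr; apply: cau_cvg pC _ => i; rewrite ltW.
Qed.

Lemma approx_eq r p g g' : (forall h : 'rV[K]_n, (forall i, abs (h 0 i) < r) -> g h = g' h) ->
  approx r p g -> approx r p g'.
Proof. by move=> gg' [r0 pC pg]; split=> // h hr; rewrite -gg' //; apply: pg. Qed.

Lemma approxD r p q g g' : approx r p g -> approx r q g' ->
  approx r (fun k => p k + q k) (fun h => g h + g' h).
Proof.
move=> [r0 pC pg] [_ qC qg]; split=> //; first by apply: cauD => //; rewrite ltW.
move=> h hr; rewrite (_ : (fun k => _) =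
   (fun k => meval (h 0) (p k)) \+ (fun k => meval (h 0) (q k))).
  by apply: cvgD; [apply: pg|apply: qg].
by apply/funext => k; rewrite mevalD.
Qed.

Lemma approxM r p q g g' : approx r p g -> approx r q g' ->
  approx r (fun k => p k * q k) (fun h => g h * g' h).
Proof.
move=> [r0 pC pg] [_ qC qg]; split=> //; first by apply: cauM => //; rewrite ltW.
move=> h hr; rewrite (_ : (fun k => _) =
   (fun k => meval (h 0) (p k)) \* (fun k => meval (h 0) (q k))).
  by apply: cvgM; [apply: pg|apply: qg].
by apply/funext => k; rewrite mevalM.
Qed.

Lemma approxC r c : 0 < r -> approx r (fun=> mpolyC n c) (fun=> c).
Proof.
move=> r0; split=> //; first exact: cau_cst.
by move=> h _; rewrite (_ : (fun k => _) = fun=> c) ?mevalC//; exact: cvg_cst.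
Qed.

Lemma approxX r i : 0 < r -> approx r (fun=> mpolyX K (mnm1 i)) (fun h : 'rV[K]_n => h 0 i).
Proof.
move=> r0; split=> //; first exact: cau_cst.
by move=> h _; rewrite mevalXU; exact: cvg_cst.
Qed.

(** The Lipschitz constant of a polynomial depends only on its norm, which is
    bounded along the sequence. *)
Lemma approx_lip r p g : approx r p g -> exists2 C : R, 0 < C &
  forall (h h' : 'rV[K]_n) (d : R), (forall i, abs (h 0 i) <= r / 2) ->
   (forall i, abs (h' 0 i) <= r / 2) -> 0 <= d ->
   (forall i, abs (h 0 i - h' 0 i) <= d) -> abs (g h - g h') <= C * d.
Proof.
move=> [r0 pC pg]; have [C C0 HC] := cau_bound (ltW r0) pC.
exists (2 / r * C); first by rewrite mulr_gt0 // divr_gt0.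
move=> h h' d hr hr' d0 hd.
have r2 : r / 2 < r by lra.
apply: (@cvg_nrm_le (fun k => meval (h 0) (p k) - meval (h' 0) (p k)) _ _ 0%N).
  by apply: cvgB; apply: pg => i; apply: le_lt_trans r2.
move=> k _ /=.
apply: (le_trans (meval_lip (p k) r0 d0 hr hr' hd)).
have -> : 2 / r * C * d = 2 * d / r * C by ring.
by apply: ler_wpM2l => //; rewrite divr_ge0 ?mulr_ge0 // ltW.
Qed.

(** The limit of [meval_taylor]. *)
Lemma approx_taylor r p g : approx r p g -> exists2 C : R, 0 < C &
  forall (h x : 'rV[K]_n) (d : R) (g' : 'I_n -> K), (forall i, abs (h 0 i) <= r / 2) ->
   (forall i, abs ((h + x) 0 i) <= r / 2) -> 0 <= d ->
   (forall i, abs (x 0 i) <= d) ->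
   (forall i, (fun k => meval (h 0) (mderiv i (p k))) @ \oo --> g' i) ->
   abs (g (h + x) - g h - \sum_i x 0 i * g' i) <= C * d ^+ 2.
Proof.
move=> [r0 pC pg]; have [C C0 HC] := cau_bound (ltW r0) pC.
exists (4 / r ^+ 2 * C); first by rewrite mulr_gt0 // divr_gt0 // exprn_gt0.
move=> h x d g' hr hxr d0 xd pg'; have r2 : r / 2 < r by lra.
have ev k : meval (fun i => h 0 i + x 0 i) (p k) = meval ((h + x) 0) (p k).
  by apply: meval_eq => i; rewrite mxE.
have -> : 4 / r ^+ 2 * C * d ^+ 2 = 4 * d ^+ 2 / r ^+ 2 * C by ring.
apply: (@cvg_nrm_le (fun k => meval ((h + x) 0) (p k) - meval (h 0) (p k)
  - \sum_i x 0 i * meval (h 0) (mderiv i (p k))) _ _ 0%N).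
  apply: cvgB; first by apply: cvgB; apply: pg => i; apply: le_lt_trans r2.
  by apply: cvgn_sum => i; apply: cvgMl_tmp; exact: pg'.
move=> k _; rewrite -ev.
have hxr' i : abs (h 0 i + x 0 i) <= r / 2 by have := hxr i; rewrite mxE.
apply: (le_trans (meval_taylor (p k) r0 d0 hr hxr' xd)).
by apply: ler_wpM2l => //; rewrite divr_ge0 ?mulr_ge0 ?exprn_ge0 // ltW.
Qed.

End Fix_n.
End Approx.

(** * Analytic germs *)

Section Analytic.
Variables (R : realType) (K : numFieldType) (V : realnorm R K).
Local Notation abs := (nrm V).
Local Notation mnorm := (mnorm V).
Local Notation approx := (approx V).

Definition ana n (f : 'rV[K]_n -> K) (a : 'rV[K]_n) :=
  exists r p, approx r p (fun h => f (a + h)).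

Section Boxes.
Variable n : nat.

(** The exponents of [analytic_at] are functions; these are the corresponding
    monomials. *)
Definition mnm_of (a : 'I_n -> nat) : multinom n := Multinom [tuple a i | i < n].

Lemma mnm_ofE a i : mnm_of a i = a i.
Proof. by rewrite multinomE tnth_mktuple. Qed.

Lemma mdeg_mnm_of a : mdeg (mnm_of a) = (\sum_(i < n) a i)%N.
Proof. by rewrite mdegE; apply: eq_bigr => i _; rewrite mnm_ofE. Qed.

Local Notation box N := {ffun 'I_n -> 'I_N}.
Local Notation ofbox alpha := (mnm_of (fun i => alpha i : nat)).

Lemma mnm_of_inj N : injective (fun alpha : box N => ofbox alpha).
Proof.
move=> a b /mnmP ab; apply/ffunP => i; apply/val_inj.
by have := ab i; rewrite !mnm_ofE.
Qed.

Lemma box_widen (W : nmodType) M N (G : ('I_n -> nat) -> W) : (M <= N)%N ->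
  \sum_(alpha : box N | [forall i, alpha i < M]%N) G (fun i => alpha i : nat) =
  \sum_(alpha : box M) G (fun i => alpha i : nat).
Proof.
move=> MN; pose h (a : box M) : box N := [ffun i => widen_ord MN (a i)].
have h_inj : injective h.
  move=> a b /ffunP ab; apply/ffunP => i; apply/val_inj.
  by have /(congr1 val) := ab i; rewrite !ffunE.
transitivity (\sum_(alpha in h @: [set: box M]) G (fun i => alpha i : nat)).
  apply: eq_bigl => a; apply/forallP/imsetP => [aM|[b _ ->] i]; last by rewrite ffunE /=.
  exists [ffun i => Ordinal (aM i)]; first by rewrite inE.
  by apply/ffunP => i; rewrite !ffunE; apply/val_inj.
rewrite big_imset /=; last by move=> a b _ _; apply: h_inj.
apply: eq_big => [a|a _]; first by rewrite in_setT.
by congr G; apply/funext => i; rewrite ffunE.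
Qed.

Lemma box_mnorm N r (p : mpoly n K) : 0 <= r ->
  \sum_(alpha : box N) abs (mcoeff (ofbox alpha) p) * r ^+ mdeg (ofbox alpha)
  <= mnorm r p.
Proof.
move=> r0; pose s := map (fun alpha : box N => ofbox alpha) (index_enum (box N)).
have := @mnorm_sub _ _ V n s r p r0; rewrite big_map; apply.
by rewrite map_inj_uniq ?index_enum_uniq //; apply: mnm_of_inj.
Qed.

Lemma box_meval N (p : mpoly n K) h : (msize p <= N)%N ->
  meval h p = \sum_(alpha : box N) mcoeff (ofbox alpha) p * \prod_i h i ^+ alpha i.
Proof.
move=> pN; rewrite mevalE; apply/esym.
pose F m := mcoeff m p * \prod_i h i ^+ m i.
have FE m : F m = \sum_(m' <- msupp p) (m' == m)%:R * F m'.
  have [mp|mp] := boolP (m \in msupp p).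
    rewrite (bigD1_seq m) ?msupp_uniq //= eqxx mul1r big1 ?addr0 // => m' /negbTE ->.
    by rewrite mul0r.
  rewrite {1}/F (memN_msupp_eq0 mp) mul0r big_seq big1 // => m' mp'.
  by have [e|_] := eqVneq m' m; rewrite ?mul0r //; rewrite -e mp' in mp.
transitivity (\sum_(alpha : box N) F (ofbox alpha)).
  by apply: eq_bigr => a _; congr (_ * _); apply: eq_bigr => i _; rewrite mnm_ofE.
under eq_bigr => a _ do rewrite FE.
rewrite exchange_big /= big_seq [RHS]big_seq; apply: eq_bigr => m mp.
rewrite -mulr_suml -/(F m) -[RHS]mul1r; congr (_ * _).
have mN i : (m i < N)%N.
  apply: leq_trans pN; apply: leq_ltn_trans (msize_mdeg_lt mp).
  by rewrite mdegE (bigD1 i) //= leq_addr.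
pose a : box N := [ffun i => Ordinal (mN i)].
have ma : m = ofbox a by apply/mnmP => i; rewrite mnm_ofE ffunE.
rewrite (bigD1 a) //= -ma eqxx big1 ?addr0 // => b ba.
by rewrite ma (inj_eq (@mnm_of_inj N)) eq_sym (negbTE ba).
Qed.

End Boxes.

(** The partial sums over boxes form a Cauchy sequence because their norms are
    those of a bounded increasing sequence of reals. *)
Lemma analytic_ana n (f : 'rV[K]_n -> K) a : analytic_at f a -> ana f a.
Proof.
move=> [c [r [C [r0 cC cf]]]].
pose box N := {ffun 'I_n -> 'I_N}.
pose mon N (al : box N) := mnm_of (fun i => al i : nat).
pose p N : mpoly n K := \sum_(al : box N) c (fun i => al i : nat) *: mpolyX K (mon N al).
pose s := abs r.
have s0 : 0 < s by rewrite nrm_gt0 gt_eqF.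
pose G (al : 'I_n -> nat) := abs (c al) * s ^+ mdeg (mnm_of al).
pose S N := \sum_(al : box N) G (fun i => al i : nat).
have G0 al : 0 <= G al by rewrite mulr_ge0 ?nrm_ge0 ?exprn_ge0 // ltW.
have dS M N : (M <= N)%N ->
    S N - S M = \sum_(al : box N | ~~ [forall i, al i < M]%N) G (fun i => al i : nat).
  move=> MN; rewrite /S -(box_widen G MN).
  by rewrite [X in X - _](bigID (fun al : box N => [forall i, al i < M]%N)) /= addrAC subrr add0r.
have dp M N : (M <= N)%N -> mnorm s (p N - p M) <= S N - S M.
  move=> MN; rewrite dS // /p.
  rewrite -(box_widen (fun al => c al *: mpolyX K (mnm_of al)) MN).
  rewrite [X in X - _](bigID (fun al : box N => [forall i, al i < M]%N)) /= addrAC subrr add0r.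
  apply: le_trans (mnorm_sum _ _ _ _ (ltW s0)) _; apply: ler_sum => al _.
  by rewrite mnormZ mnormX.
have ndS : nondecreasing_seq S.
  by move=> M N MN; rewrite -subr_ge0 dS // sumr_ge0.
have SE N : emb V (S N) =
    \sum_(al : box N) `|c (fun i => al i : nat)| * \prod_(i < n) r ^+ al i.
  rewrite rmorph_sum; apply: eq_bigr => al _; rewrite rmorphM -normE; congr (_ * _).
  rewrite rmorphXn /s -normE gtr0_norm // mdeg_mnm_of expr_sum //.
have SC N : S N <= abs C.
  have S_ge0 : 0 <= S N by apply: sumr_ge0.
  rewrite -[S N]ger0_norm // -(nrm_emb V); apply: nrm_le.
  by rewrite (normE V) nrm_emb ger0_norm // SE.
have cS : cvgn S.
  by apply: nondecreasing_is_cvgn => //; exists (abs C) => _ [N _ <-].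
have cauS : forall e, 0 < e -> exists N, forall i j, (N <= i)%N -> (N <= j)%N ->
    `|S i - S j| < e.
  move=> e e0; have e2 : 0 < e / 2 by rewrite divr_gt0.
  move/cvgrPdist_lt : cS => /(_ _ e2)[N _ HN]; exists N => i j Ni Nj.
  have := HN _ Ni; have := HN _ Nj; rewrite /= => H1 H2.
  rewrite -[S i](subrK (limn S)) -addrA; apply: le_lt_trans (ler_normD _ _) _.
  by rewrite [e]splitr distrC ltrD.
exists s, p; split=> //.
  move=> e /cauS[N HN]; exists N => k l Nk Nl.
  have [kl|/ltnW kl] := leqP k l.
    rewrite mnormBC; apply: (le_lt_trans (dp _ _ kl)).
    by apply: le_lt_trans (ler_norm _) _; apply: HN.
  apply: (le_lt_trans (dp _ _ kl)).
  by apply: le_lt_trans (ler_norm _) _; apply: HN.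
move=> h hs; have := cf h _; rewrite (_ : (fun N => _) = (fun N => meval (h 0) (p N))).
  by apply=> i; rewrite (lt_nrm V) // hs.
apply/funext => N; rewrite /p raddf_sum; apply: eq_bigr => al _ /=.
rewrite mevalZ mevalX; congr (_ * _); apply: eq_bigr => i _.
by rewrite mnm_ofE.
Qed.

(** The coefficients of the power series are the limits of those of the
    polynomials; finite parts of the series inherit the bounds. *)
Lemma ana_analytic n (f : 'rV[K]_n -> K) a : ana f a -> analytic_at f a.
Proof.
move=> [r [p [r0 pC pf]]].
have cp m : cvgn (fun k => mcoeff m (p k)).
  have [|l Hl] := nrm_complete V (fun k => mcoeff m (p k)).
    move=> e e0; have rm : 0 < r ^+ mdeg m by rewrite exprn_gt0.
    have [N HN] := pC _ (mulr_gt0 e0 rm); exists N => k l Nk Nl.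
    rewrite -mcoeffB -(ltr_pM2r rm).
    exact: le_lt_trans (coeff_mnorm V _ _ (ltW r0)) (HN _ _ Nk Nl).
  by apply/cvg_ex; exists l; apply/(cvg_nrmP V).
pose c al := limn (fun k => mcoeff (mnm_of al) (p k)).
have [C C0 HC] := cau_bound (ltW r0) pC.
pose box N := {ffun 'I_n -> 'I_N}.
pose mon N (al : box N) := mnm_of (fun i => al i : nat).
(* passing to the limit in finite sums of coefficients *)
have lim_box N q D M : (forall k, (M <= k)%N -> mnorm r (p k - q) <= D) ->
    \sum_(al : box N) abs (c (fun i => al i : nat) - mcoeff (mon N al) q)
       * r ^+ mdeg (mon N al) <= D.
  move=> HD; rewrite -[leRHS]ger0_norm; last first.
    by apply: le_trans (HD M (leqnn M)); apply: mnorm_ge0; apply: ltW.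
  rewrite -(nrm_emb V); set X := \sum_(al : box N) _.
  have X0 : 0 <= X.
    by apply: sumr_ge0 => al _; rewrite mulr_ge0 ?nrm_ge0 ?exprn_ge0 // ltW.
  apply: le_trans (_ : X <= D) _; last by rewrite nrm_emb ler_norm.
  pose u (k : nat) := \sum_(al : box N)
     `|mcoeff (mon N al) (p k) - mcoeff (mon N al) q| * emb V r ^+ mdeg (mon N al).
  have uX : u @ \oo --> emb V X.
    rewrite rmorph_sum; apply: cvgn_sum => al; rewrite rmorphM rmorphXn -normE.
    apply: cvgMr_tmp; apply: cvg_norm; apply: cvgB; last exact: cvg_cst.
    exact: cp.
  rewrite -[X]ger0_norm // -(nrm_emb V); apply: (cvg_nrm_le (N := M) uX) => k Mk.
  apply: le_trans (HD k Mk).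
  have -> : u k = emb V (\sum_(al : box N)
      abs (mcoeff (mon N al) (p k - q)) * r ^+ mdeg (mon N al)).
    rewrite rmorph_sum; apply: eq_bigr => al _.
    by rewrite rmorphM rmorphXn -normE mcoeffB.
  rewrite nrm_emb ger0_norm; first by apply: box_mnorm; apply: ltW.
  by apply: sumr_ge0 => al _; rewrite mulr_ge0 ?nrm_ge0 ?exprn_ge0 // ltW.
exists c, (emb V r), (emb V C); split; first by rewrite emb_gt0.
  move=> N; rewrite (_ : \sum_(al : box N) _ = emb V (\sum_(al : box N)
    abs (c (fun i => al i : nat) - mcoeff (mon N al) 0) * r ^+ mdeg (mon N al))).
    by rewrite le_emb; apply: (lim_box _ _ _ 0%N) => k _; rewrite subr0.
  rewrite rmorph_sum; apply: eq_bigr => al _.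
  by rewrite rmorphM mcoeff0 subr0 -normE rmorphXn mdeg_mnm_of expr_sum.
move=> h hr; apply/(cvg_nrmP V) => e e0.
have e3 : 0 < e / 3 by rewrite divr_gt0.
have hr' i : abs (h 0 i) < r by rewrite -lt_norm_emb.
have [N1 HN1] := pC _ e3.
have [N2 HN2] := (cvg_nrmP V _ _).1 (pf h hr') _ e3.
pose k := maxn N1 N2; exists (msize (p k)) => N Nk.
pose mono (al : box N) := \prod_i h 0 i ^+ al i.
have -> : \sum_(al : box N) c (fun i => al i : nat) * mono al - f (a + h) =
    \sum_(al : box N) (c (fun i => al i : nat) - mcoeff (mon N al) (p k)) * mono al
    + (meval (h 0) (p k) - f (a + h)).
  rewrite (box_meval _ Nk) addrA -big_split /=; congr (_ - _).
  by apply: eq_bigr => al _; rewrite -mulrDl subrK.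
apply: le_lt_trans (nrmD _ _ _) _.
have H2 : abs (meval (h 0) (p k) - f (a + h)) < e / 3 by apply: HN2; rewrite leq_maxr.
suff H1 : abs (\sum_(al : box N) (c (fun i => al i : nat) -
    mcoeff (mon N al) (p k)) * mono al) <= e / 3 by lra.
apply: le_trans (nrm_sum _ _ _ _) _.
have := lim_box N (p k) (e / 3) N1; move/(_ _)/(le_trans _); apply; last first.
  by move=> l N1l; apply/ltW/HN1 => //; rewrite leq_maxl.
apply: ler_sum => al _; rewrite nrmM ler_wpM2l ?nrm_ge0 //.
rewrite nrm_prod mdeg_mnm_of expr_sum; apply: ler_prod => i _.
rewrite nrm_ge0 nrmX /= lerXn2r ?nnegrE ?nrm_ge0 //; first exact: ltW.
by apply: ltW.
Qed.

(** * Calculus of analytic germs *)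

Lemma meval_origin n (p : mpoly n K) : meval ((0 : 'rV[K]_n) 0) p = mcoeff mnm0 p.
Proof.
have X0 m : m != mnm0 -> \prod_i ((0 : 'rV[K]_n) 0 i) ^+ m i = 0.
  rewrite -mdeg_eq0 mdegE sum_nat_eq0 negb_forall => /existsP[i /= mi].
  by rewrite (bigD1 i) //= mxE expr0n (negbTE mi) mul0r.
rewrite mevalE; have [m0|m0] := boolP (mnm0 \in msupp p).
  rewrite (bigD1_seq mnm0) ?msupp_uniq //= [X in _ * X]big1 => [|i _]; last first.
    by rewrite mnm0E expr0.
  by rewrite mulr1 big1 ?addr0 // => m /X0 ->; rewrite mulr0.
rewrite (memN_msupp_eq0 m0) big_seq big1 // => m mp.
by rewrite X0 ?mulr0 //; apply: contraNneq m0 => <-.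
Qed.

Lemma nbhs_rowP n (a : 'rV[K]_n) (P : set 'rV[K]_n) :
  (\forall z \near a, P z) <->
  exists2 r : R, 0 < r & forall h : 'rV[K]_n, (forall i, abs (h 0 i) < r) -> P (a + h).
Proof.
split=> [/nbhs_ballP[_ /= /gt0_emb -/(_ _ V)[r r0 ->] HP]|[r r0 HP]].
  exists r => // h hr; apply: HP; split=> [|i j]; first by rewrite emb_gt0.
  by rewrite ord1 mxE /ball /= opprD addNKr normrN lt_norm_emb.
apply/nbhs_ballP; exists (emb V r); first by rewrite /= emb_gt0.
move=> z [_ az]; rewrite -[z](subrK a) addrC; apply: HP => i.
by have := az 0 i; rewrite /ball /= distrC !mxE lt_norm_emb.
Qed.

(** A quadratic error bound gives a directional derivative; the bound does not
    depend on whether the parameter is real or complex. *)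
Lemma is_derive_bound n (f : 'rV[K]_n -> K) (a v : 'rV[K]_n) D C (r0 : R) : 0 < r0 ->
    (forall t, abs t < r0 -> abs (f (t *: v + a) - f a - t * D) <= C * abs t ^+ 2) ->
  is_derive a v f D.
Proof.
move=> r00 H.
have cv : (fun h => h^-1 *: (f (h *: v + a) - f a)) @ 0^' --> D.
  apply/cvgrPdist_lt => _ /gt0_emb -/(_ _ V)[e e0 ->].
  have C1 : 0 < `|C| + 1 by rewrite ltr_wpDl.
  pose d := Num.min r0 (e / (`|C| + 1)).
  have d0 : 0 < d by rewrite lt_min r00 divr_gt0.
  exists (emb V d); first by rewrite /= emb_gt0.
  move=> t /=; rewrite sub0r normrN lt_norm_emb => td t0; rewrite lt_norm_emb.
  have {td} [tr te] : abs t < r0 /\ abs t < e / (`|C| + 1).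
    by move: td; rewrite lt_min => /andP[].
  have -> : D - t^-1 *: (f (t *: v + a) - f a) =
      - (t^-1 * (f (t *: v + a) - f a - t * D)).
    by rewrite /GRing.scale /= [in RHS]mulrBr mulKf // opprB.
  rewrite nrmN nrmM nrmV mulrC ltr_pdivrMr ?nrm_gt0 //.
  apply: (le_lt_trans (H _ tr)); rewrite expr2 mulrA ltr_pM2r ?nrm_gt0 //.
  move: te; rewrite ltr_pdivlMr // mulrC; apply: le_lt_trans.
  by rewrite ler_wpM2r ?nrm_ge0 // (le_trans (ler_norm _)) // lerDl.
by apply: DeriveDef; [apply/cvg_ex; exists D|apply: cvg_lim].
Qed.

Definition pd n (i : 'I_n) (f : 'rV[K]_n -> K) (z : 'rV[K]_n) : K :=
  'D_(delta_mx 0 i) f z.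

Section Derivatives.
Variables (n : nat) (f : 'rV[K]_n -> K) (a : 'rV[K]_n) (r : R) (p : nat -> mpoly n K).
Hypothesis fp : approx r p (fun h => f (a + h)).

Lemma approx_is_derive (h v : 'rV[K]_n) : (forall i, abs (h 0 i) < r / 2) ->
  is_derive (a + h) v f
    (\sum_i v 0 i * limn (fun k => meval (h 0) (mderiv i (p k)))).
Proof.
move=> hr; have [r0 pC _] := fp; have [C C0 HC] := approx_taylor fp.
pose M := 1 + \sum_i abs (v 0 i).
have vM i : abs (v 0 i) <= M.
  rewrite /M (bigD1 i) //= addrCA lerDl addr_ge0 // sumr_ge0 // => j _.
  exact: nrm_ge0.
have M0 : 0 < M by rewrite ltr_wpDr // sumr_ge0 // => j _; exact: nrm_ge0.
have [s s0 hs] : exists2 s : R, 0 < s & forall i, abs (h 0 i) + s <= r / 2.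
  pose s := \big[Num.min/r / 2]_i (r / 2 - abs (h 0 i)).
  exists s => [|i]; last by rewrite -lerBrDl; apply: bigmin_le_cond.
  by apply/lt_bigmin; [rewrite divr_gt0|move=> i _; rewrite subr_gt0].
apply: (@is_derive_bound _ _ _ _ _ (C * M ^+ 2) (s / M)); first by rewrite divr_gt0.
move=> t ts; have tv i : abs ((t *: v) 0 i) <= abs t * M.
  by rewrite mxE nrmM ler_wpM2l ?nrm_ge0.
have tMs : abs t * M <= s by rewrite -ler_pdivlMr // ltW.
have := HC h (t *: v) (abs t * M)
  (fun i => limn (fun k => meval (h 0) (mderiv i (p k)))).
have -> : a + (h + t *: v) = t *: v + (a + h) by rewrite addrA addrC.
have -> : C * (abs t * M) ^+ 2 = C * M ^+ 2 * abs t ^+ 2 by ring.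
have -> : t * (\sum_i v 0 i * limn (fun k => meval (h 0) (mderiv i (p k)))) =
  \sum_i (t *: v) 0 i * limn (fun k => meval (h 0) (mderiv i (p k))).
  by rewrite mulr_sumr; apply: eq_bigr => i _; rewrite mxE mulrA.
apply=> //.
- by move=> i; rewrite ltW.
- move=> i; rewrite mxE; apply: le_trans (nrmD _ _ _) _.
  by apply: le_trans (hs i); rewrite lerD2l (le_trans (tv i)).
- by rewrite mulr_ge0 ?nrm_ge0 // ltW.
- move=> i; apply: cau_cvg (cau_deriv i r0 pC) _ => j; exact: ltW.
Qed.

Lemma approx_pdE (h : 'rV[K]_n) i : (forall i, abs (h 0 i) < r / 2) ->
  pd i f (a + h) = limn (fun k => meval (h 0) (mderiv i (p k))).
Proof.
move=> hr; rewrite /pd; have [_ ->] := approx_is_derive (delta_mx 0 i) hr.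
rewrite (bigD1 i) //= mxE !eqxx mul1r big1 ?addr0 // => j /negbTE ji.
by rewrite mxE ji andbF mul0r.
Qed.

Lemma approx_pd i : approx (r / 2) (fun k => mderiv i (p k)) (fun h => pd i f (a + h)).
Proof.
have [r0 pC _] := fp; split; first by rewrite divr_gt0.
  exact: cau_deriv.
move=> h hr; rewrite approx_pdE //; apply: cau_cvg (cau_deriv i r0 pC) _ => j.
exact: ltW.
Qed.

Lemma approx_is_derive_pd (h v : 'rV[K]_n) : (forall i, abs (h 0 i) < r / 2) ->
  is_derive (a + h) v f (\sum_i v 0 i * pd i f (a + h)).
Proof.
move=> hr; have := approx_is_derive v hr.
by under eq_bigr => i _ do rewrite -approx_pdE //.
Qed.

(** Substituting [b + X] does not increase the norm when the radius is halved. *)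
Lemma approx_recenter (b : 'rV[K]_n) : (forall i, abs (b 0 i) < r / 2) ->
  approx (r / 2) (fun k => compmp (fun i => mpolyC n (b 0 i) + mpolyX K (mnm1 i)) (p k))
    (fun h => f (a + b + h)).
Proof.
move=> br; have [r0 pC pf] := fp; have r20 : 0 < r / 2 by rewrite divr_gt0.
split=> //.
  apply: cau_le pC => [|k l]; first exact: ler01.
  rewrite -compmpB mul1r; apply: mnorm_comp => [|i]; first exact: ltW.
  apply: le_trans (mnormD _ _ _ (ltW r20)) _.
  rewrite mnormC mnormX mdeg1 expr1 [leRHS]splitr lerD2r; exact: ltW.
move=> h hr; rewrite -addrA; set u := (X in X @ _).
have -> : u = (fun k => meval ((b + h) 0) (p k)).
  apply/funext => k; rewrite /u meval_compmp; apply: meval_eq => i.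
  by rewrite mevalD mevalC mevalXU mxE.
apply: pf => i; rewrite mxE; apply: le_lt_trans (nrmD _ _ _) _.
by rewrite [ltRHS]splitr ltrD.
Qed.

End Derivatives.

Section AnaCalculus.
Variable n : nat.
Implicit Types (f g : 'rV[K]_n -> K) (a z : 'rV[K]_n).

Lemma ana_near f a : ana f a -> \forall z \near a, ana f z.
Proof.
move=> [r [p fp]]; apply/nbhs_rowP; exists (r / 2); first by case: fp => r0 _ _; rewrite divr_gt0.
move=> b br; exists (r / 2), (fun k => compmp (fun i => mpolyC n (b 0 i) + mpolyX K (mnm1 i)) (p k)).
exact: (approx_recenter fp br).
Qed.

Lemma ana_is_derive f a v : ana f a -> is_derive a v f (\sum_i v 0 i * pd i f a).
Proof.
move=> [r [p fp]]; have := @approx_is_derive_pd _ _ _ _ _ fp 0 v; rewrite addr0.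
by apply=> i; rewrite mxE nrm0; case: fp => r0 _ _; rewrite divr_gt0.
Qed.

Lemma ana_derivable f a v : ana f a -> derivable f a v.
Proof. by move=> /(ana_is_derive v)[]. Qed.

Lemma ana_pd i f a : ana f a -> ana (pd i f) a.
Proof. by move=> [r [p fp]]; exists (r / 2), (fun k => mderiv i (p k)); apply: approx_pd. Qed.

Lemma ana_schwarz i j f a : ana f a -> pd i (pd j f) a = pd j (pd i f) a.
Proof.
move=> [r [p fp]]; have r0 : 0 < r by case: fp.
have h0 k : abs ((0 : 'rV[K]_n) 0 k) < r / 2 / 2 by rewrite mxE nrm0 !divr_gt0.
have := approx_pdE (approx_pd fp j) i h0; have := approx_pdE (approx_pd fp i) j h0.
rewrite addr0 => -> ->; congr (limn _); apply/funext => k.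
by rewrite mderiv_comm.
Qed.

Lemma ana_continuous f a : ana f a -> {for a, continuous f}.
Proof.
move=> [r [p fp]]; have r0 : 0 < r by case: fp.
have [C C0 HC] := approx_lip fp.
have F : Filter (nbhs a) by exact: nbhs_filter.
apply/(@cvgrPdist_lt _ _ _ (nbhs a)) => _ /gt0_emb -/(_ _ V)[e e0 ->].
apply/nbhs_rowP; pose d := Num.min (r / 2) (e / (2 * C)).
have d0 : 0 < d by rewrite lt_min !divr_gt0 // mulr_gt0.
exists d => // h hd; rewrite lt_norm_emb nrmB -{2}[a]addr0.
apply: (@le_lt_trans _ _ (C * d)).
  apply: HC => [i|i||i]; last by rewrite mxE subr0 ltW.
  - by apply: (le_trans (ltW (hd i))); rewrite ge_min lexx.
  - by rewrite mxE nrm0 divr_ge0 // ltW.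
  - exact: ltW.
have : d <= e / (2 * C) by rewrite ge_min lexx orbT.
rewrite ler_pdivlMr ?mulr_gt0 // => H; rewrite -(ltr_pM2l (ltr0n R 2)) //.
rewrite mulrA mulrC; apply: (le_lt_trans H); lra.
Qed.

Lemma ana_eq f g a : (\forall z \near a, f z = g z) -> ana f a -> ana g a.
Proof.
move=> /nbhs_rowP[s s0 fg] [r [p fp]]; have r0 : 0 < r by case: fp.
exists (Num.min r s), p; have fp' : approx (Num.min r s) p (fun h => f (a + h)).
  by apply: approx_shrink fp; rewrite ?lt_min ?r0 // ge_min lexx.
apply: approx_eq fp' => h hr; apply: fg => i.
by apply: lt_le_trans (hr i) _; rewrite ge_min lexx orbT.
Qed.

Lemma ana_cst c a : ana (fun=> c) a.
Proof. by exists 1, (fun=> mpolyC n c); apply: approxC. Qed.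

Lemma ana_op2 (op : K -> K -> K) f g a :
  (forall r p q u v, approx r p u -> approx r q v ->
    exists t, approx (n := n) r t (fun h => op (u h) (v h))) ->
  ana f a -> ana g a -> ana (fun z => op (f z) (g z)) a.
Proof.
move=> H [r [p fp]] [s [q gq]]; have r0 : 0 < r by case: fp.
have s0 : 0 < s by case: gq.
have fp' : approx (Num.min r s) p (fun h => f (a + h)).
  by apply: approx_shrink fp; rewrite ?lt_min ?r0 // ge_min lexx.
have gq' : approx (Num.min r s) q (fun h => g (a + h)).
  by apply: approx_shrink gq; rewrite ?lt_min ?r0 // ge_min lexx orbT.
by have [t Ht] := H _ _ _ _ _ fp' gq'; exists (Num.min r s), t.
Qed.

Lemma anaD f g a : ana f a -> ana g a -> ana (fun z => f z + g z) a.
Proof.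
by apply: (@ana_op2 +%R) => r p q u v up vq; eexists; apply: approxD up vq.
Qed.

Lemma anaM f g a : ana f a -> ana g a -> ana (fun z => f z * g z) a.
Proof.
by apply: (@ana_op2 *%R) => r p q u v up vq; eexists; apply: approxM up vq.
Qed.

Lemma anaZ c f a : ana f a -> ana (fun z => c * f z) a.
Proof. by apply: anaM; apply: ana_cst. Qed.

Lemma anaN f a : ana f a -> ana (fun z => - f z) a.
Proof. by move/(@anaZ (-1)); under eq_fun do rewrite mulN1r. Qed.

Lemma anaB f g a : ana f a -> ana g a -> ana (fun z => f z - g z) a.
Proof. by move=> fa ga; apply: anaD => //; apply: anaN. Qed.

Lemma ana_sum (I : Type) (s : seq I) (P : pred I) (F : I -> 'rV[K]_n -> K) a :
  (forall i, P i -> ana (F i) a) -> ana (fun z => \sum_(i <- s | P i) F i z) a.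
Proof.
move=> Fa; elim: s => [|i s IH].
  by under eq_fun do rewrite big_nil; apply: ana_cst.
have [Pi|nPi] := boolP (P i); last by under eq_fun do rewrite big_cons (negbTE nPi).
by under eq_fun do rewrite big_cons Pi; apply: anaD => //; apply: Fa.
Qed.

Lemma ana_coord i a : ana (fun z => z 0 i) a.
Proof.
exists 1, (fun=> mpolyC n (a 0 i) + mpolyX K (mnm1 i)).
apply: approx_eq (approxD (approxC V n (a 0 i) ltr01) (approxX V i ltr01)) => h _.
by rewrite mxE.
Qed.

(** The germ [1 / (1 - u)], with [u] small, is the fixed point of
    [y = 1 + u y]. *)
Lemma ana_geom (u : 'rV[K]_n -> K) a : ana u a -> u a = 0 ->
  exists2 y, ana y a & \forall z \near a, y z * (1 - u z) = 1.
Proof.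
move=> [r [p up]] ua0; have [r0 pC pu] := up.
pose q k := hipart 1 (p k).
have [C C0 HC] := cau_bound (ltW r0) pC.
have [s [s0 sr sC]] : exists s, [/\ 0 < s, s <= r & s / r * C <= 1 / 2].
  exists (Num.min r (r / (2 * C))); rewrite lt_min ge_min lexx r0 divr_gt0 ?mulr_gt0 //.
  split=> //; have : Num.min r (r / (2 * C)) <= r / (2 * C) by rewrite ge_min lexx orbT.
  set s := Num.min _ _ => sr.
  rewrite mulrAC ler_pdivrMr // -ler_pdivlMr //; apply: (le_trans sr).
  by rewrite le_eqVlt; apply/orP; left; apply/eqP; field; rewrite !gt_eqF.
have qs k : mnorm s (q k) <= 1 / 2.
  apply: (le_trans (mnorm_hipart V 1 (p k) s0 sr)); rewrite expr1.
  by apply: le_trans sC; rewrite ler_wpM2l // divr_ge0 // ltW.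
have qC : cau V s q.
  apply: cau_le pC; first exact: (ler01 : 0 <= 1 :> R).
  move=> k l; rewrite /q -mscaleB; apply: le_trans (mnorm_hipart V 1 _ s0 sr) _.
  by rewrite expr1 ler_wpM2r ?mnorm_ge0 ?ler_pdivrMr ?mul1r // ltW.
have qu : approx s q (fun h => u (a + h)).
  split=> // h hs; rewrite /q; set w := (X in X @ _).
  have -> : w = (fun k => meval (h 0) (p k)) \- (fun k => meval ((0 : 'rV[K]_n) 0) (p k)).
    by apply/funext => k; rewrite /w hipart1 mevalB mevalC /= meval_origin.
  have -> : u (a + h) = u (a + h) - u (a + 0) by rewrite addr0 ua0 subr0.
  apply: cvgB; apply: pu => i; last by rewrite mxE nrm0.
  exact: lt_le_trans (hs i) sr.
pose y := fix y k : mpoly n K := if k is k'.+1 then 1 + q k' * y k' else 0.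
have ys k : mnorm s (y k) <= 2.
  elim: k => [|k IH] /=; first by rewrite mnorm0.
  apply: le_trans (mnormD _ _ _ (ltW s0)) _; rewrite mnorm1.
  have := mnormM V (q k) (y k) (ltW s0).
  have : mnorm s (q k) * mnorm s (y k) <= 1 / 2 * 2.
    by apply: ler_pM; rewrite ?mnorm_ge0 ?(ltW s0).
  lra.
have yC : cau V s y.
  apply: (@small2_contract _ _ 4) => [k l|e e0].
    by apply: le_trans (mnormB _ _ _ (ltW s0)) _; have := ys k; have := ys l; lra.
  have e2 : 0 < e / 2 by rewrite divr_gt0.
  have [N HN] := qC _ e2; exists N => k l Nk Nl /=.
  have -> : 1 + q k * y k - (1 + q l * y l) = q k * (y k - y l) + (q k - q l) * y l by ring.
  apply: le_trans (mnormD _ _ _ (ltW s0)) _; apply: lerD.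
    apply: le_trans (mnormM _ _ _ (ltW s0)) _; rewrite mulrC.
    by rewrite ler_wpM2l ?mnorm_ge0 ?(ltW s0) // (le_trans (qs k)) // div1r.
  apply: le_trans (mnormM _ _ _ (ltW s0)) _.
  apply: (@le_trans _ _ (e / 2 * 2)); last by rewrite divfK.
  by apply: ler_pM; rewrite ?mnorm_ge0 ?(ltW s0) ?(ltW (HN _ _ _ _)).
pose Y (z : 'rV[K]_n) := limn (fun k => meval ((z - a) 0) (y k)).
have yY : approx s y (fun h => Y (a + h)).
  apply: approx_eq (approx_lim s0 yC) => h _.
  by rewrite /Y [a + h]addrC addrK.
exists Y; first by exists s, y.
apply/nbhs_rowP; exists s => // h hs.
have [_ _ yY'] := yY; have {}yY' := yY' h hs.
have [_ _ qu'] := qu; have {}qu' := qu' h hs.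
have H1 : (fun k => meval (h 0) (y k.+1)) @ \oo --> Y (a + h) by rewrite -(cvg_shiftS (fun k => meval (h 0) (y k))) in yY'.
have H2 : (fun k => meval (h 0) (y k.+1)) @ \oo --> 1 + u (a + h) * Y (a + h).
  rewrite (_ : (fun k => _) = (fun=> 1) \+
    ((fun k => meval (h 0) (q k)) \* (fun k => meval (h 0) (y k)))).
    by apply: cvgD; [exact: cvg_cst|exact: cvgM].
  by apply/funext => k; rewrite /= mevalD mevalM meval1.
have E : Y (a + h) = 1 + u (a + h) * Y (a + h).
  exact: (cvg_unique (@norm_hausdorff _ _) H1 H2).
by rewrite mulrBr mulr1 {1}E; ring.
Qed.

Lemma anaV f a : ana f a -> f a != 0 -> ana (fun z => (f z)^-1) a.
Proof.
move=> fa fa0; have ua : ana (fun z => 1 - (f a)^-1 * f z) a.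
  by apply: anaB; [apply: ana_cst|apply: anaZ].
have [|y ya yE] := ana_geom ua; first by rewrite mulVf ?subrr.
apply: (@ana_eq (fun z => (f a)^-1 * y z)); last exact: anaZ.
near=> z; have : y z * (1 - (1 - (f a)^-1 * f z)) = 1 by near: z.
rewrite subKr => H; have fz : f z != 0.
  by apply: contra_eq_neq H => ->; rewrite !mulr0 eq_sym oner_neq0.
by rewrite -[RHS]mul1r -H; field; rewrite fz fa0.
Unshelve. all: by end_near.
Qed.

End AnaCalculus.

Lemma near_near (T : topologicalType) (x : T) (P : set T) :
  (\forall z \near x, P z) -> \forall z \near x, \forall t \near z, P t.
Proof. exact: nbhs_interior. Qed.

Lemma near_forall (T : topologicalType) (I : finType) (x : T) (P : I -> set T) :
  (forall i, \forall z \near x, P i z) -> \forall z \near x, forall i, P i z.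
Proof. by move=> HP; apply: filter_forall. Qed.

Section PartialDerivatives.
Variable n : nat.
Implicit Types (f g : 'rV[K]_n -> K) (a z : 'rV[K]_n).

Lemma pd_eq i f g a : (\forall z \near a, f z = g z) -> pd i f a = pd i g a.
Proof. exact: near_eq_derive. Qed.

Lemma pd_cst i c a : pd i (fun=> c) a = 0.
Proof. exact: derive_cst. Qed.

Lemma pdD i f g a : ana f a -> ana g a ->
  pd i (fun z => f z + g z) a = pd i f a + pd i g a.
Proof. by move=> fa ga; apply: deriveD; apply: ana_derivable. Qed.

Lemma pdN i f a : ana f a -> pd i (fun z => - f z) a = - pd i f a.
Proof. by move=> fa; apply: deriveN; apply: ana_derivable. Qed.

Lemma pdB i f g a : ana f a -> ana g a ->
  pd i (fun z => f z - g z) a = pd i f a - pd i g a.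
Proof. by move=> fa ga; rewrite pdD ?pdN //; apply: anaN. Qed.

Lemma pdM i f g a : ana f a -> ana g a ->
  pd i (fun z => f z * g z) a = pd i f a * g a + f a * pd i g a.
Proof.
move=> fa ga; rewrite /pd deriveM; [|exact: ana_derivable..].
by rewrite addrC /GRing.scale /= mulrC.
Qed.

Lemma pd_sum i (I : Type) (s : seq I) (P : pred I) (F : I -> 'rV[K]_n -> K) a :
  (forall j, P j -> ana (F j) a) ->
  pd i (fun z => \sum_(j <- s | P j) F j z) a = \sum_(j <- s | P j) pd i (F j) a.
Proof.
move=> Fa; elim: s => [|j s IH].
  by rewrite big_nil; under eq_fun do rewrite big_nil; apply: pd_cst.
rewrite big_cons; have [Pj|nPj] := boolP (P j); last first.
  by under eq_fun do rewrite big_cons (negbTE nPj).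
under eq_fun do rewrite big_cons Pj.
by rewrite pdD ?IH //; [apply: Fa|apply: ana_sum].
Qed.

Lemma pd_coord i j a : pd i (fun z => z 0 j) a = (j == i)%:R.
Proof.
have [_ <- //] : is_derive a (delta_mx 0 i) (fun z : 'rV[K]_n => z 0 j) (j == i)%:R.
apply: (@is_derive_bound _ _ _ _ _ 0 1) => // t _.
by rewrite !mxE eqxx addrK /= subrr nrm0 mul0r.
Qed.

Lemma ana_common (I : finType) (f : I -> 'rV[K]_n -> K) a : (forall i, ana (f i) a) ->
  exists r : R, 0 < r /\ forall s, 0 < s -> s <= r ->
    exists p : I -> nat -> mpoly n K, forall i, approx s (p i) (fun h => f i (a + h)).
Proof.
move=> fa; have [r Hr] := choice fa; have [p Hp] := choice Hr.
have r0 i : 0 < r i by case: (Hp i).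
exists (\big[Num.min/1]_i r i); split; first by apply/lt_bigmin.
move=> s s0 sr; exists p => i; apply: approx_shrink (Hp i) => //.
by apply: le_trans sr _; apply: bigmin_le_cond.
Qed.

End PartialDerivatives.

(** * Identity theorem and linear equations along rays *)

Section Identity.
Variable n : nat.
Implicit Types (p : nat -> mpoly n K).

(** A coefficient is a derivative at the origin, and derivatives of the zero
    function vanish. *)
Lemma approx0_coeff r p m : approx r p (fun=> 0) ->
  (fun k => mcoeff m (p k)) @ \oo --> (0 : K).
Proof.
elim/mnm_ind: m r p => [|i m IH] r p p0.
  have [r0 _ H] := p0; have := H 0; under eq_fun do rewrite meval_origin; apply.
  by move=> i; rewrite mxE nrm0.
have p0' := @approx_pd n (fun=> 0) 0 r p p0 i.
have {}p0' : approx (r / 2) (fun k => mderiv i (p k)) (fun=> 0).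
  by apply: approx_eq p0' => h _; rewrite pd_cst.
have dm := IH _ _ p0'.
have m1 : (m i).+1%:R != 0 :> K by rewrite pnatr_eq0.
rewrite -[X in _ --> X](mulr0 ((m i).+1%:R^-1 : K)).
rewrite (_ : (fun k => _) = (fun k => (m i).+1%:R^-1 * mcoeff m (mderiv i (p k)))).
  exact: cvgMl_tmp.
apply/funext => k; by rewrite mcoeff_mderiv -[X in _ = _ * X]mulr_natl mulKf // addmC.
Qed.

(** Convergence to zero at every point forces convergence in norm: the Cauchy
    condition reduces the claim to the finitely many coefficients of one
    polynomial, and each of these tends to zero. *)
Lemma approx0_norm r p e : approx r p (fun=> 0) -> 0 < e ->
  exists N, forall k, (N <= k)%N -> mnorm r (p k) < e.
Proof.
move=> p0 e0; have [r0 pC _] := p0; have e3 : 0 < e / 3 by rewrite divr_gt0.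
have [N HN] := pC _ e3.
pose S l := \sum_(m <- msupp (p N)) abs (mcoeff m (p l)) * r ^+ mdeg m.
have [l Nl Sl] : exists2 l, (N <= l)%N & S l <= e / 3.
  have [B HB] : exists B, forall l, (B <= l)%N -> S l < e / 3.
    rewrite /S; elim: (msupp (p N)) (e / 3) e3 => [|m s IH] d d0.
      by exists 0%N => l _; rewrite big_nil.
    have d2 : 0 < d / 2 by rewrite divr_gt0.
    have [B HB] := IH _ d2.
    have rm : 0 < r ^+ mdeg m by rewrite exprn_gt0.
    have [B' HB'] := (cvg_nrmP V _ _).1 (approx0_coeff m p0) _ (divr_gt0 d2 rm).
    exists (maxn B B') => l; rewrite geq_max => /andP[Bl Bl'].
    rewrite big_cons [d]splitr ltrD ?HB // -ltr_pdivlMr //.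
    by have := HB' l Bl'; rewrite subr0.
  by exists (maxn N B); rewrite ?leq_maxl // ltW // HB // leq_maxr.
exists N => k Nk; rewrite -[p k](subrK (p N)).
apply: le_lt_trans (mnormD _ _ _ (ltW r0)) _.
suff : mnorm r (p N) <= e / 3 + e / 3 by have := HN k N Nk (leqnn N); lra.
apply: (@le_trans _ _ (mnorm r (p N - p l) + S l)); last first.
  by rewrite lerD // ltW // HN.
apply: (@le_trans _ _ (\sum_(m <- msupp (p N)) abs (mcoeff m (p N - p l)) * r ^+ mdeg m + S l)).
  rewrite -big_split /=; apply: ler_sum => m _; rewrite -mulrDl ler_wpM2r ?exprn_ge0 ?(ltW r0) //.
  by rewrite mcoeffB -{1}[mcoeff m (p N)](subrK (mcoeff m (p l))) nrmD.
by rewrite lerD2r mnorm_sub ?msupp_uniq // ltW.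
Qed.

End Identity.

Section RayEquation.
Variables (n : nat) (I : finType) (A : 'I_n -> I -> I -> 'rV[K]_n -> K).
Variable a : 'rV[K]_n.
Hypothesis Aa : forall b i j, ana (A b i j) a.

(** On a small polydisc the operator [W |-> sum_b X_b (A_b W)] is a contraction
    by one half. *)
Lemma ray_contraction : exists r : R, 0 < r /\ forall s, 0 < s -> s <= r ->
  exists2 q : 'I_n -> I -> I -> nat -> mpoly n K,
    (forall b i j, approx s (q b i j) (fun h => A b i j (a + h))) &
    forall k (w : I -> mpoly n K),
      \sum_i mnorm s (\sum_b mpolyX K (mnm1 b) * \sum_j q b i j k * w j)
      <= (\sum_i mnorm s (w i)) / 2.
Proof.
have [r [r0 Hr]] := @ana_common n ('I_n * I * I)%type (fun x => A x.1.1 x.1.2 x.2) a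
  (fun x => Aa x.1.1 x.1.2 x.2).
have [q Hq] := Hr r r0 (lexx r).
have qC x : exists C, forall k, mnorm r (q x k) <= C.
  have [_ qC _] := Hq x; have [C C0 HC] := cau_bound (ltW r0) qC.
  by exists C.
have [C HC] := choice qC.
pose D := \sum_x C x.
have C0 x : 0 <= C x by apply: le_trans (HC x 0%N); rewrite mnorm_ge0 // ltW.
have D0 : 0 <= D by apply: sumr_ge0.
have CD x : C x <= D.
  by rewrite /D (bigD1 x) //= lerDl; apply: sumr_ge0.
pose B := n%:R * #|I|%:R * D + 1; have B0 : 0 < B.
  by rewrite ltr_wpDl // !mulr_ge0.
exists (Num.min r (1 / (2 * B))); split; first by rewrite lt_min r0 divr_gt0 ?mulr_gt0.
move=> s s0; rewrite le_min => /andP[sr sB]; exists (fun b i j => q (b, i, j)).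
  by move=> b i j; apply: approx_shrink (Hq (b, i, j)).
move=> k w; set W := \sum_i mnorm s (w i).
have W0 : 0 <= W by apply: sumr_ge0 => i _; rewrite mnorm_ge0 // ltW.
have step i : mnorm s (\sum_b mpolyX K (mnm1 b) * \sum_j q (b, i, j) k * w j)
    <= n%:R * s * D * W.
  apply: le_trans (mnorm_sum _ _ _ _ (ltW s0)) _.
  apply: (@le_trans _ _ (\sum_(b < n) s * D * W)); last first.
    by rewrite sumr_const card_ord -[X in X <= _]mulr_natl !mulrA.
  apply: ler_sum => b _; apply: le_trans (mnormM _ _ _ (ltW s0)) _.
  rewrite mnormX mdeg1 expr1 -mulrA ler_wpM2l ?(ltW s0) //.
  apply: le_trans (mnorm_sum _ _ _ _ (ltW s0)) _; rewrite /W mulr_sumr.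
  apply: ler_sum => j _; apply: le_trans (mnormM _ _ _ (ltW s0)) _.
  rewrite ler_wpM2r ?mnorm_ge0 ?(ltW s0) //.
  by apply: le_trans (mnorm_mono _ _ (ltW s0) sr) _; apply: le_trans (HC _ k) (CD _).
apply: (@le_trans _ _ (\sum_(i : I) n%:R * s * D * W)); first by apply: ler_sum.
rewrite sumr_const -[X in X <= _]mulr_natl !mulrA [leRHS]mulrC ler_wpM2r //.
have : s * B <= 1 / 2.
  have := ler_wpM2r (ltW B0) sB; rewrite (_ : 1 / (2 * B) * B = 1 / 2) //.
  by field; rewrite gt_eqF.
rewrite /B => H; have : #|I|%:R * n%:R * s * D = s * (n%:R * #|I|%:R * D + 1) - s.
  by ring.
by move=> ->; lra.
Qed.

(** With [g] the gradient of a function this is its radial derivative at [z],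
    seen from [a]. *)
Definition along (z : 'rV[K]_n) (g : 'I_n -> K) := \sum_b (z - a) 0 b * g b.

(** A solution of [W + E W = sum_b h_b A_b W], with [E] the Euler operator,
    vanishes: dividing the part of degree [k] by [k + 1] shows that its norm is
    at most half of itself. *)
Lemma ray_unique (W : I -> 'rV[K]_n -> K) : (forall i, ana (W i) a) ->
    (\forall z \near a, forall i, W i z + along z (fun b => pd b (W i) z) =
       along z (fun b => \sum_j A b i j z * W j z)) ->
  \forall z \near a, forall i, W i z = 0.
Proof.
move=> Wa /nbhs_rowP[t t0 HW].
have [r1 [r10 Hr1]] := ray_contraction.
have [r2 [r20 Hr2]] := ana_common Wa.
pose r := Num.min t (Num.min r1 r2).
have r0 : 0 < r by rewrite !lt_min t0 r10.
have [w Hw] : exists w : I -> nat -> mpoly n K, forall i, approx r (w i) (fun h => W i (a + h)).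
  by apply: Hr2 => //; rewrite !ge_min lexx !orbT.
pose s := r / 2; have s0 : 0 < s by rewrite divr_gt0.
have sr : s <= r by rewrite /s; lra.
have [q Hq Hc] : exists2 q : 'I_n -> I -> I -> nat -> mpoly n K,
    (forall b i j, approx s (q b i j) (fun h => A b i j (a + h))) &
    forall k (w : I -> mpoly n K),
      \sum_i mnorm s (\sum_b mpolyX K (mnm1 b) * \sum_j q b i j k * w j)
      <= (\sum_i mnorm s (w i)) / 2.
  by apply: Hr1 => //; apply: le_trans sr _; rewrite !ge_min lexx !orbT.
pose op k i := \sum_b mpolyX K (mnm1 b) * \sum_j q b i j k * w j k.
pose v i k := euler (w i k) + w i k - op k i.
have v0 i : approx s (v i) (fun=> 0).
  have Hw' j : approx s (w j) (fun h => W j (a + h)) by apply: approx_shrink (Hw j).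
  have C1 b : cau V s (fun k => mpolyX K (mnm1 b) * mderiv b (w i k)).
    apply: (cauM (ltW s0)); first exact: cau_cst.
    by have [] := approx_pd (Hw i) b.
  have C2 b : cau V s (fun k => mpolyX K (mnm1 b) * \sum_j q b i j k * w j k).
    apply: (cauM (ltW s0)); first exact: cau_cst.
    apply: (cau_sum (ltW s0)) => j; apply: (cauM (ltW s0)).
      by have [] := Hq b i j.
    by have [] := Hw' j.
  split=> //.
    apply: (cauD (ltW s0)); last by apply: cauN; apply: (cau_sum (ltW s0)).
    apply: (cauD (ltW s0)); first by apply: (cau_sum (ltW s0)).
    by have [] := Hw' i.
  move=> h hs.
  have E : W i (a + h) + along (a + h) (fun b => pd b (W i) (a + h)) -
       along (a + h) (fun b => \sum_j A b i j (a + h) * W j (a + h)) = 0.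
    apply/eqP; rewrite subr_eq0; apply/eqP/HW => b.
    apply: lt_le_trans (hs b) _; apply: (le_trans sr).
    by rewrite ge_min lexx.
  have aE g : along (a + h) g = \sum_b h 0 b * g b by rewrite /along addrC addKr.
  rewrite -[X in _ --> X]E !aE addrC.
  rewrite (_ : (fun k => _) = (fun k =>
     (- \sum_b h 0 b * \sum_j meval (h 0) (q b i j k) * meval (h 0) (w j k)) +
     (meval (h 0) (w i k) + \sum_b h 0 b * meval (h 0) (mderiv b (w i k))))); last first.
    apply/funext => k; rewrite /v /op /euler mevalB mevalD addrC.
    rewrite !(raddf_sum (meval (h 0))); congr (- _ + _).
      apply: eq_bigr => b _; rewrite /= mevalM mevalXU raddf_sum; congr (_ * _).
      by apply: eq_bigr => j _; rewrite /= mevalM.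
    by rewrite addrC; congr (_ + _); apply: eq_bigr => b _; rewrite /= mevalM mevalXU.
  have cw j : (fun k => meval (h 0) (w j k)) @ \oo --> W j (a + h).
    by have [_ _] := Hw' j; apply.
  apply: cvgD.
    apply: cvgN; apply: cvgn_sum => b; apply: cvgMl_tmp; apply: cvgn_sum => j.
    by apply: cvgM => //; have [_ _] := Hq b i j; apply.
  apply: cvgD => //; apply: cvgn_sum => b; apply: cvgMl_tmp.
  by have [_ _] := approx_pd (Hw i) b; apply.
have vw k i : mnorm s (w i k) <= mnorm s (v i k) + mnorm s (op k i).
  rewrite -{1}[w i k]rayint_euler.
  apply: le_trans (mnorm_rayint V _ (ltW s0)) _.
  by rewrite -[X in mnorm s X](subrK (op k i)) mnormD // ltW.
have vw2 k : \sum_i mnorm s (w i k) <= 2 * \sum_i mnorm s (v i k).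
  have : \sum_i mnorm s (w i k) <= \sum_i (mnorm s (v i k) + mnorm s (op k i)).
    by apply: ler_sum.
  rewrite big_split /=; have := Hc k (fun i => w i k); rewrite -/(op k _) /op; lra.
apply/nbhs_rowP; exists s => // h hs i.
have [_ _ /(_ h)cw] := Hw i.
have {}cw := cw (fun b => lt_le_trans (hs b) sr).
apply: (cvg_unique (@norm_hausdorff _ _) cw); apply/(cvg_nrmP V) => e e0.
have cI : 0 < 2 * (#|I|%:R + 1) :> R by rewrite mulr_gt0 // ltr_wpDl.
have [N HN] : exists N, forall j k, (N <= k)%N -> mnorm s (v j k) < e / (2 * (#|I|%:R + 1)).
  have [N HN] := choice (fun j => approx0_norm (v0 j) (divr_gt0 e0 cI)).
  exists (\max_j N j) => j k Nk; apply: HN; apply: leq_trans Nk.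
  exact: leq_bigmax.
exists N => k Nk; rewrite subr0.
apply: (@le_lt_trans _ _ (mnorm s (w i k))).
  by apply: nrm_meval => b; apply: ltW.
apply: (@le_lt_trans _ _ (\sum_i mnorm s (w i k))).
  by rewrite (bigD1 i) //= lerDl; apply: sumr_ge0 => j _; rewrite mnorm_ge0 // ltW.
apply: (le_lt_trans (vw2 k)).
apply: (@le_lt_trans _ _ (2 * \sum_(j : I) e / (2 * (#|I|%:R + 1)))).
  by rewrite ler_pM2l //; apply: ler_sum => j _; apply: ltW; apply: HN.
pose x : R := #|I|%:R; rewrite -/x; have x1 : 0 < x + 1 by rewrite ltr_wpDl.
have -> : \sum_(j : I) e / (2 * (x + 1)) = e / (2 * (x + 1)) * x.
  by rewrite sumr_const mulr_natr.
rewrite (_ : 2 * (e / (2 * (x + 1)) * x) = e * (x / (x + 1))); last first.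
  by field; rewrite gt_eqF.
by rewrite gtr_pMr // ltr_pdivrMr // mul1r ltrDl.
Qed.

End RayEquation.

(** * Linear total differential equations *)

(** The primitive of [p] along rays that vanishes at the origin; it inverts the
    Euler operator on polynomials without constant term. *)
Definition rayprim n (p : mpoly n K) : mpoly n K :=
  mscale (fun m => (mdeg m)%:R^-1) p.

Lemma mnorm_rayprim n (p : mpoly n K) r : 0 <= r -> mnorm r (rayprim p) <= mnorm r p.
Proof.
move=> r0; rewrite -[leRHS]mul1r; apply: mnorm_mscale => // m.
rewrite ler_wpM2r ?exprn_ge0 // nrmV nrm_nat; case: (mdeg m) => [|k].
  by rewrite invr0 ler01.
by rewrite invf_le1 ?ltr0n // ler1n.
Qed.

Lemma euler_rayprim n c (p : mpoly n K) : mcoeff mnm0 p = 0 ->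
  euler (mpolyC n c + rayprim p) = p.
Proof.
move=> p0; apply/mpolyP => m.
rewrite mcoeff_euler mcoeffD mcoeff_mscale mcoeffC mulrDr.
have [->|] := eqVneq m mnm0; first by rewrite mdeg0 !mul0r addr0 p0.
rewrite -mdeg_eq0 => m0; rewrite !mulr0 add0r mulrA mulfV ?mul1r //.
by rewrite pnatr_eq0.
Qed.

Section Frobenius.
Variables (n : nat) (I : finType) (A : 'I_n -> I -> I -> 'rV[K]_n -> K).
Variable a : 'rV[K]_n.
Hypothesis Aa : forall b i j, ana (A b i j) a.
Local Notation along := (along a).

(** Picard iteration along rays: only the radial part of the system is solved,
    which needs no compatibility. *)
Lemma ray_exists (U0 : I -> K) : exists U : I -> 'rV[K]_n -> K,
  [/\ forall i, ana (U i) a, forall i, U i a = U0 i &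
    \forall z \near a, forall i, along z (fun b => pd b (U i) z) =
       along z (fun b => \sum_j A b i j z * U j z)].
Proof.
have [s [s0 Hs]] := ray_contraction Aa; have [q Hq Hc] := Hs s s0 (lexx s).
have s_ge0 := ltW s0.
pose op (k : nat) (w : I -> mpoly n K) i :=
  \sum_b mpolyX K (mnm1 b) * \sum_j q b i j k * w j.
have op0 k w i : mcoeff mnm0 (op k w i) = 0.
  rewrite -meval_origin raddf_sum big1 // => b _ /=.
  by rewrite mevalM mevalXU mxE mul0r.
pose u := fix u k : I -> mpoly n K :=
  if k is k'.+1 then fun i => mpolyC n (U0 i) + rayprim (op k' (u k') i)
  else fun=> 0.
pose S k := \sum_i mnorm s (u k i).
have S0 k : 0 <= S k by apply: sumr_ge0 => i _; apply: mnorm_ge0.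
pose M := \sum_i abs (U0 i).
have M0 : 0 <= M by apply: sumr_ge0 => i _; apply: nrm_ge0.
have SM k : S k <= 2 * M.
  elim: k => [|k IH]; first by rewrite /S big1 ?mulr_ge0 // => i _; rewrite mnorm0.
  have : S k.+1 <= \sum_i (abs (U0 i) + mnorm s (op k (u k) i)).
    apply: ler_sum => i _; apply: le_trans (mnormD _ _ _ s_ge0) _.
    by rewrite mnormC lerD2l mnorm_rayprim.
  by rewrite big_split /= -/M; have := Hc k (u k); rewrite -/(S k) /op; lra.
have uS : small2 (fun k l => \sum_i mnorm s (u k i - u l i)).
  apply: (@small2_contract _ _ (4 * M)) => [k l|e e0].
    apply: (@le_trans _ _ (S k + S l)); last by have := SM k; have := SM l; lra.
    by rewrite -big_split /=; apply: ler_sum => i _; apply: mnormB.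
  have qS : small2 (fun k l => 2 * M * \sum_i \sum_b \sum_j s * mnorm s (q b i j k - q b i j l)).
    apply: small2Z; first by rewrite mulr_ge0.
    apply: small2_sum => i; apply: small2_sum => b; apply: small2_sum => j.
    by apply: small2Z => //; have [] := Hq b i j.
  have [N HN] := qS _ e0; exists N => k l Nk Nl.
  have -> : \sum_i mnorm s (u k.+1 i - u l.+1 i) =
      \sum_i mnorm s (rayprim (op k (u k) i - op l (u l) i)).
    by apply: eq_bigr => i _; rewrite /rayprim mscaleB /= opprD addrACA subrr add0r.
  have opB i : op k (u k) i - op l (u l) i =
      op k (fun j => u k j - u l j) i +
      \sum_b mpolyX K (mnm1 b) * \sum_j (q b i j k - q b i j l) * u l j.
    rewrite /op -sumrB -big_split; apply: eq_bigr => b _ /=.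
    rewrite -mulrBr -mulrDr; congr (_ * _).
    rewrite -sumrB -big_split; apply: eq_bigr => j _ /=; ring.
  apply: (@le_trans _ _ (\sum_i (mnorm s (op k (fun j => u k j - u l j) i) +
     mnorm s (\sum_b mpolyX K (mnm1 b) * \sum_j (q b i j k - q b i j l) * u l j)))).
    apply: ler_sum => i _; apply: le_trans (mnorm_rayprim _ s_ge0) _.
    by rewrite opB mnormD.
  rewrite big_split /= lerD //; first exact: Hc.
  apply: le_trans (ltW (HN _ _ Nk Nl)); rewrite mulr_sumr.
  apply: ler_sum => i _; apply: le_trans (mnorm_sum _ _ _ _ s_ge0) _.
  rewrite mulr_sumr; apply: ler_sum => b _; apply: le_trans (mnormM _ _ _ s_ge0) _.
  rewrite mnormX mdeg1 expr1 mulrC -mulr_sumr mulrCA mulrC ler_wpM2l //.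
  apply: le_trans (mnorm_sum _ _ _ _ s_ge0) _; rewrite mulr_sumr.
  apply: ler_sum => j _; apply: le_trans (mnormM _ _ _ s_ge0) _.
  rewrite mulrC ler_wpM2r ?mnorm_ge0 //; apply: le_trans (SM l).
  by rewrite /S (bigD1 j) //= lerDl; apply: sumr_ge0 => j' _; apply: mnorm_ge0.
have uC i : cau V s (fun k => u k i).
  apply: small2_le uS => k l; rewrite [leRHS](bigD1 i) //= lerDl.
  by apply: sumr_ge0 => j' _; apply: mnorm_ge0.
pose U i (z : 'rV[K]_n) := limn (fun k => meval ((z - a) 0) (u k i)).
have uU i : approx s (fun k => u k i) (fun h => U i (a + h)).
  apply: approx_eq (approx_lim s0 (uC i)) => h _.
  by rewrite /U [a + h]addrC addrK.
exists U; split=> [i|i|].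
- by exists s, (fun k => u k i).
- have cU : (fun k => meval ((0 : 'rV[K]_n) 0) (u k i)) @ \oo --> U i a.
    have [_ _ /(_ 0)] := uU i; rewrite addr0; apply => j.
    by rewrite mxE nrm0.
  suff cU0 : (fun k => meval ((0 : 'rV[K]_n) 0) (u k i)) @ \oo --> U0 i.
    exact: (cvg_unique (@norm_hausdorff _ _) cU cU0).
  rewrite -(cvg_shiftS (fun k => meval ((0 : 'rV[K]_n) 0) (u k i))).
  rewrite (_ : (fun k => _) = fun=> U0 i); first exact: cvg_cst.
  apply/funext => k; rewrite meval_origin /= mcoeffD mcoeffC eqxx mulr1.
  by rewrite mcoeff_mscale op0 mulr0 addr0.
- apply/nbhs_rowP; exists (s / 2); first by rewrite divr_gt0.
  move=> h hs i; have aE g : along (a + h) g = \sum_b h 0 b * g b by rewrite /along addrC addKr.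
  have hs' b : abs (h 0 b) < s by apply: lt_trans (hs b) _; lra.
  rewrite !aE; have cU j : (fun k => meval (h 0) (u k j)) @ \oo --> U j (a + h).
    by have [_ _] := uU j; apply.
  pose e k := meval (h 0) (euler (u k.+1 i)).
  suff [e1 e2] : e @ \oo --> \sum_b h 0 b * pd b (U i) (a + h) /\
      e @ \oo --> \sum_b h 0 b * \sum_j A b i j (a + h) * U j (a + h).
    exact: (cvg_unique (@norm_hausdorff _ _) e1 e2).
  rewrite /e; split.
    rewrite (_ : (fun k => _) =
      (fun k => \sum_b h 0 b * meval (h 0) (mderiv b (u k.+1 i)))); last first.
      apply/funext => k; rewrite /euler raddf_sum; apply: eq_bigr => b _ /=.
      by rewrite mevalM mevalXU.
    apply: cvgn_sum => b; apply: cvgMl_tmp.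
    rewrite (cvg_shiftS (fun k => meval (h 0) (mderiv b (u k i)))).
    by have [_ _] := approx_pd (uU i) b; apply.
  rewrite (_ : (fun k => _) =
    (fun k => \sum_b h 0 b * \sum_j meval (h 0) (q b i j k) * meval (h 0) (u k j))); last first.
    apply/funext => k; rewrite /= euler_rayprim ?op0 // raddf_sum; apply: eq_bigr => b _ /=.
    rewrite mevalM mevalXU raddf_sum; congr (_ * _).
    by apply: eq_bigr => j _; rewrite /= mevalM.
  apply: cvgn_sum => b; apply: cvgMl_tmp; apply: cvgn_sum => j.
  by apply: cvgM => //; have [_ _] := Hq b i j; apply.
Qed.

Lemma along_sum z (J : finType) (c : J -> K) (g : J -> 'I_n -> K) :
  \sum_j c j * along z (g j) = along z (fun b => \sum_j c j * g j b).
Proof.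
rewrite /along; under eq_bigr => j _ do rewrite mulr_sumr.
rewrite exchange_big; apply: eq_bigr => b _ /=; rewrite mulr_sumr.
by apply: eq_bigr => j _; rewrite mulrCA.
Qed.

Lemma alongB z g g' : along z g - along z g' = along z (fun b => g b - g' b).
Proof. by rewrite /along -sumrB; apply: eq_bigr => b _; rewrite mulrBr. Qed.

Lemma pd_along b (g : 'I_n -> 'rV[K]_n -> K) z : (forall c, ana (g c) z) ->
  pd b (fun z => along z (fun c => g c z)) z = g b z + along z (fun c => pd b (g c) z).
Proof.
move=> ga; have ca c : ana (fun z => (z - a) 0 c) z.
  apply: (@ana_eq _ (fun z => z 0 c - a 0 c)); first by near=> y; rewrite !mxE.
  by apply: anaB; [apply: ana_coord|apply: ana_cst].
rewrite pd_sum => [|c _]; last exact: anaM.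
under eq_bigr => c _ do rewrite pdM //.
rewrite big_split /=; congr (_ + _).
have pdc c : pd b (fun z => (z - a) 0 c) z = (c == b)%:R.
  rewrite (@pd_eq _ b _ (fun z => z 0 c - a 0 c)); last by near=> y; rewrite !mxE.
  by rewrite pdB ?pd_coord ?pd_cst ?subr0 //; [apply: ana_coord|apply: ana_cst].
under eq_bigr => c _ do rewrite pdc.
rewrite (bigD1 b) //= eqxx mul1r big1 ?addr0 // => c /negbTE ->.
by rewrite mul0r.
Unshelve. all: by end_near.
Qed.

Hypothesis A_compat : \forall z \near a, forall b c i k,
  pd b (A c i k) z + \sum_j A c i j z * A b j k z =
  pd c (A b i k) z + \sum_j A b i j z * A c j k z.

(** Solutions along rays solve the whole system: by compatibility their defect
    satisfies the equation of [ray_unique]. *)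
Lemma linear_frobenius (U0 : I -> K) : exists U : I -> 'rV[K]_n -> K,
  [/\ forall i, ana (U i) a, forall i, U i a = U0 i &
    \forall z \near a, forall b i, pd b (U i) z = \sum_j A b i j z * U j z].
Proof.
have [U [Ua UU0 Uray]] := ray_exists U0; exists U; split=> //.
pose W b i z := pd b (U i) z - \sum_j A b i j z * U j z.
suff H b : \forall z \near a, forall i, W b i z = 0.
  have : \forall z \near a, forall b i, W b i z = 0 by apply: near_forall.
  by apply: filterS => z Wz b i; apply/eqP; rewrite -subr_eq0; apply/eqP/Wz.
apply: (ray_unique Aa) => [i|].
  apply: anaB; first exact: ana_pd.
  by apply: ana_sum => j _; apply: anaM.
have UaN : \forall z \near a, forall i, ana (U i) z.
  by apply: near_forall => i; apply: ana_near.
have AaN : \forall z \near a, forall x : 'I_n * I * I, ana (A x.1.1 x.1.2 x.2) z.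
  by apply: near_forall => x; apply: ana_near.
have UrN := near_near Uray.
near=> z => i.
have Uz : forall j, ana (U j) z by near: z.
have Az c j k : ana (A c j k) z.
  have H : forall x : 'I_n * I * I, ana (A x.1.1 x.1.2 x.2) z by near: z.
  exact: (H (c, j, k)).
have ray_z : forall i, along z (fun b => pd b (U i) z) =
       along z (fun b => \sum_j A b i j z * U j z) by near: z.
have AUz c j : ana (fun z => \sum_k A c j k z * U k z) z.
  by apply: ana_sum => k _; apply: anaM.
have dray : pd b (U i) z + along z (fun c => pd b (pd c (U i)) z) =
    \sum_j A b i j z * U j z +
    along z (fun c => \sum_j (pd b (A c i j) z * U j z + A c i j z * pd b (U j) z)).
  rewrite -(@pd_along b (fun c => pd c (U i)) z) => [|c]; last exact: ana_pd.
  rewrite (@pd_eq _ b _ (fun z => along z (fun c => \sum_j A c i j z * U j z))); last first.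
    have : \forall t \near z, forall i, along t (fun b => pd b (U i) t) =
       along t (fun b => \sum_j A b i j t * U j t) by near: z.
    by apply: filterS.
  rewrite (@pd_along b (fun c z => \sum_j A c i j z * U j z)) //; congr (_ + _).
  rewrite /along; apply: eq_bigr => c _; congr (_ * _).
  rewrite pd_sum => [|j _]; last exact: anaM.
  by apply: eq_bigr => j _; rewrite pdM.
have WE c : pd c (W b i) z = pd b (pd c (U i)) z -
   \sum_j (pd c (A b i j) z * U j z + A b i j z * pd c (U j) z).
  rewrite pdB //; last exact: ana_pd.
  rewrite ana_schwarz //; congr (_ - _).
  rewrite pd_sum => [|j _]; last exact: anaM.
  by apply: eq_bigr => j _; rewrite pdM.
have A_z : forall b c i k, pd b (A c i k) z + \sum_j A c i j z * A b j k z =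
  pd c (A b i k) z + \sum_j A b i j z * A c j k z by near: z.
have -> : along z (fun c => pd c (W b i) z) =
   along z (fun c => pd b (pd c (U i)) z) -
   along z (fun c => \sum_j pd c (A b i j) z * U j z) -
   \sum_j A b i j z * along z (fun c => \sum_k A c j k z * U k z).
  under [in RHS]eq_bigr => j _ do rewrite -ray_z.
  rewrite along_sum !alongB /along; apply: eq_bigr => c _; rewrite WE.
  by rewrite big_split /= opprD addrA.
set X := along z _ in dray *; set Y := along z _ in dray.
have -> : W b i z + (X - along z (fun c => \sum_j pd c (A b i j) z * U j z) -
    \sum_j A b i j z * along z (fun c => \sum_k A c j k z * U k z)) =
  Y - along z (fun c => \sum_j pd c (A b i j) z * U j z) -
  \sum_j A b i j z * along z (fun c => \sum_k A c j k z * U k z).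
  have -> : Y = pd b (U i) z + X - \sum_j A b i j z * U j z.
    by rewrite dray addrAC subrr add0r.
  by rewrite /W; ring.
rewrite /Y.
rewrite along_sum !alongB /along; apply: eq_bigr => c _; congr (_ * _).
have -> : \sum_j A b i j z * (\sum_k A c j k z * U k z) =
   \sum_k (\sum_j A b i j z * A c j k z) * U k z.
  under eq_bigr => j _ do rewrite mulr_sumr.
  rewrite exchange_big; apply: eq_bigr => k _ /=; rewrite mulr_suml.
  by apply: eq_bigr => j _; rewrite mulrA.
have -> : \sum_j A c i j z * W b j z = \sum_j A c i j z * pd b (U j) z -
   \sum_k (\sum_j A c i j z * A b j k z) * U k z.
  under eq_bigr => j _ do rewrite /W mulrBr mulr_sumr.
  rewrite sumrB exchange_big; congr (_ - _); apply: eq_bigr => k _ /=.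
  by rewrite mulr_suml; apply: eq_bigr => j _; rewrite mulrA.
set S1 := \sum_k (\sum_j A b i j z * _) * _.
set S2 := \sum_k (\sum_j A c i j z * _) * _.
have key : \sum_j pd b (A c i j) z * U j z - \sum_j pd c (A b i j) z * U j z - S1 = - S2.
  rewrite /S1 /S2 -!sumrB -sumrN; apply: eq_bigr => k _.
  rewrite -!mulrBl -mulNr; congr (_ * _).
  by have := A_z b c i k; move/(canRL (addrK _)) => ->; ring.
by rewrite big_split /= -[X in _ = _ - X]opprK -key; ring.
Unshelve. all: by end_near.
Qed.

End Frobenius.

(** * Composition and local inversion *)

(** The inner polynomials stay in the polydisc of half the radius of the outer
    ones, where these are uniformly Lipschitz. *)
Lemma approx_comp n n' r s (p : nat -> mpoly n K) g
    (q : 'I_n -> nat -> mpoly n' K) (u : 'I_n -> 'rV[K]_n' -> K) :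
    approx r p g -> 0 < s -> (forall i, approx s (q i) (u i)) ->
    (forall i k, mnorm s (q i k) <= r / 2) ->
  approx s (fun k => compmp (fun i => q i k) (p k)) (fun h => g (\row_i u i h)).
Proof.
move=> [r0 pC pg] s0 qu qr; have s_ge0 := ltW s0.
have [C C0 HC] := cau_bound (ltW r0) pC.
have D0 k l : 0 <= \sum_i mnorm s (q i k - q i l).
  by apply: sumr_ge0 => i _; apply: mnorm_ge0.
split=> //.
  apply: (@small2_le _ _ (fun k l => mnorm r (p k - p l) +
      2 / r * C * \sum_i mnorm s (q i k - q i l))).
    move=> k l.
    have -> : compmp (fun i => q i k) (p k) - compmp (fun i => q i l) (p l) =
      compmp (fun i => q i k) (p k - p l) +
      (compmp (fun i => q i k) (p l) - compmp (fun i => q i l) (p l)).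
      by rewrite compmpB addrA subrK.
    apply: le_trans (mnormD _ _ _ s_ge0) _; apply: lerD.
      apply: mnorm_comp => // i; apply: le_trans (qr i k) _.
      by rewrite ler_pdivrMr // ler_peMr ?(ltW r0) // ler1n.
    have ql i : mnorm s (q i k - q i l) <= \sum_i mnorm s (q i k - q i l).
      rewrite [leRHS](bigD1 i) //= lerDl.
      by apply: sumr_ge0 => j _; apply: mnorm_ge0.
    apply: (le_trans (mnorm_comp_lip (p l) r0 s_ge0 (D0 k l)
      (fun i => qr i k) (fun i => qr i l) ql)).
    rewrite (_ : 2 / r * C * _ = 2 * (\sum_i mnorm s (q i k - q i l)) / r * C); last by ring.
    by rewrite ler_wpM2l // divr_ge0 ?mulr_ge0 // ltW.
  apply: small2D => //; apply: small2Z.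
    by rewrite mulr_ge0 ?divr_ge0 // ltW.
  by apply: small2_sum => i; have [] := qu i.
move=> h hs; pose v : 'rV[K]_n := \row_i u i h.
have cu i : (fun k => meval (h 0) (q i k)) @ \oo --> u i h by have [_ _] := qu i; apply.
have qh i k : abs (meval (h 0) (q i k)) <= r / 2.
  by apply: le_trans (qr i k); apply: nrm_meval => j; apply: ltW.
have vr i : abs (v 0 i) <= r / 2.
  by rewrite mxE; apply: (cvg_nrm_le (N := 0%N) (cu i)) => k _.
have vr' i : abs (v 0 i) < r by apply: le_lt_trans (vr i) _; lra.
apply/(cvg_nrmP V) => e e0; have e2 : 0 < e / 2 by rewrite divr_gt0.
have [N1 HN1] := (cvg_nrmP V _ _).1 (pg v vr') _ e2.
pose d : R := e / 2 * r / (2 * (C + 1)).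
have C1 : 0 < C + 1 by rewrite addr_gt0.
have d0 : 0 < d by rewrite /d divr_gt0 ?mulr_gt0.
have [N2 HN2] : exists N, forall i k, (N <= k)%N -> abs (meval (h 0) (q i k) - u i h) < d.
  have [N HN] := choice (fun i => (cvg_nrmP V _ _).1 (cu i) _ d0).
  exists (\max_i N i) => i k Nk; apply: HN; apply: leq_trans Nk.
  exact: leq_bigmax.
exists (maxn N1 N2) => k; rewrite geq_max => /andP[Nk1 Nk2].
rewrite -/v meval_compmp.
rewrite -(subrK (meval (v 0) (p k)) (meval _ (p k))) -addrA.
apply: le_lt_trans (nrmD _ _ _) _; rewrite [e]splitr; apply: ler_ltD; last exact: HN1.
have ld i : abs (meval (h 0) (q i k) - v 0 i) <= d by rewrite mxE ltW // HN2.
apply: (le_trans (meval_lip (p k) r0 (ltW d0) (fun i => qh i k) vr ld)).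
apply: (@le_trans _ _ (2 * d / r * (C + 1))).
  apply: ler_wpM2l; first by apply: divr_ge0; [apply: mulr_ge0 => //; exact: ltW|exact: ltW].
  by apply: le_trans (HC k) _; rewrite lerDl.
by rewrite le_eqVlt; apply/orP; left; apply/eqP; rewrite /d; field; rewrite !gt_eqF.
Qed.

(** Removing the terms of degree at most one changes nothing in the limit when
    the function vanishes to second order. *)
Lemma approx_hipart2 n r (p : nat -> mpoly n K) (g : 'rV[K]_n -> K) :
    approx r p g -> g 0 = 0 -> (forall i, pd i g 0 = 0) ->
  approx r (fun k => hipart 2 (p k)) g.
Proof.
move=> pg g0 dg; have [r0 pC pg'] := pg; split=> //.
  apply: (@cau_le _ _ _ _ _ _ _ _ 1 _ _ pC) => // k l.
  rewrite /hipart -mscaleB; apply: le_trans (mnorm_hipart V 2 _ r0 (lexx r)) _.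
  by rewrite divff ?gt_eqF // expr1n.
have z0 (t : R) : 0 < t -> forall j, abs ((0 : 'rV[K]_n) 0 j) < t.
  by move=> t0 j; rewrite mxE nrm0.
have c0 : (fun k => mcoeff mnm0 (p k)) @ \oo --> (0 : K).
  by rewrite -[X in _ --> X]g0; under eq_fun do rewrite -meval_origin; apply: pg'; apply: z0.
have pg0 : approx r p (fun h => g (0 + h)) by apply: approx_eq pg => h _; rewrite add0r.
have c1 i : (fun k => mcoeff (mnm1 i) (p k)) @ \oo --> (0 : K).
  have [_ _ /(_ 0)] := approx_pd pg0 i; rewrite addr0 dg.
  rewrite (_ : (fun k => _) = (fun k => mcoeff (mnm1 i) (p k))).
    by apply; apply: z0; rewrite divr_gt0.
  apply/funext => k; rewrite meval_origin mcoeff_mderiv add0m mnm0E mulr1n //.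
move=> h hr.
rewrite -[g h]subr0 -[X in _ --> _ - X](_ : 0 + \sum_i h 0 i * 0 = 0); last first.
  by rewrite big1 ?addr0 // => i _; rewrite mulr0.
rewrite (_ : (fun k => _) = (fun k => meval (h 0) (p k) -
  (mcoeff mnm0 (p k) + \sum_i h 0 i * mcoeff (mnm1 i) (p k)))).
  apply: cvgB; first exact: pg'.
  by apply: cvgD => //; apply: cvgn_sum => i; apply: cvgMl_tmp.
apply/funext => k; rewrite hipart2 !mevalB mevalC opprD addrA; congr (_ - _).
rewrite raddf_sum; apply: eq_bigr => i _ /=.
by rewrite mevalZ mevalXU mulrC.
Qed.

(** In coordinates centred at [a] and [Phi a], [Phi] is [h + g h] with [g] of
    second order, hence a contraction in norm on a small polydisc; the inverse is
    the fixed point of [psi = h - g psi]. That it is also a left inverse follows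
    from the injectivity of [h + g h]. *)
Lemma local_inverse n (Phi : 'rV[K]_n -> 'rV[K]_n) a :
    (forall i, ana (fun z => Phi z 0 i) a) ->
    (forall i j, pd j (fun z => Phi z 0 i) a = (i == j)%:R) ->
  exists Psi : 'rV[K]_n -> 'rV[K]_n,
    [/\ forall i, ana (fun z => Psi z 0 i) (Phi a),
        \forall z \near a, Psi (Phi z) = z &
        \forall z \near Phi a, Phi (Psi z) = z].
Proof.
move=> Pa dP; pose g i (h : 'rV[K]_n) := Phi (a + h) 0 i - Phi a 0 i - h 0 i.
have g0 i : g i 0 = 0 by rewrite /g addr0 subrr mxE subrr.
have [rho [rho0 Hrho]] := ana_common Pa.
have [p0 Hp0] := Hrho _ rho0 (lexx _).
pose p i k : mpoly n K := p0 i k + mpolyC n (- Phi a 0 i) + - mpolyX K (mnm1 i).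
have pg i : approx rho (p i) (g i).
  apply: approxD; last first.
    have := approxM (approxC V n (-1) rho0) (approxX V i rho0).
    rewrite (_ : (fun k : nat => _ * _) = (fun=> - mpolyX K (mnm1 i))); last first.
      by apply/funext => k; rewrite mul_mpolyC scaleN1r.
    by apply: approx_eq => h _; rewrite mulN1r.
  exact: approxD (Hp0 i) (approxC V n _ rho0).
have ga i : ana (g i) 0.
  by exists rho, (p i); apply: approx_eq (pg i) => h _; rewrite add0r.
have dg i j : pd j (g i) 0 = 0.
  have Ph : approx rho (p0 i) (fun h => Phi (a + (0 + h)) 0 i).
    by apply: approx_eq (Hp0 i) => h _; rewrite add0r.
  have Pa0 : ana (fun h => Phi (a + h) 0 i) 0 by exists rho, (p0 i).
  have PaE : pd j (fun h => Phi (a + h) 0 i) 0 = pd j (fun z => Phi z 0 i) a.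
    have z0 k : abs ((0 : 'rV[K]_n) 0 k) < rho / 2 by rewrite mxE nrm0 divr_gt0.
    have := @approx_pdE n (fun h => Phi (a + h) 0 i) 0 _ _ Ph 0 j z0.
    have := @approx_pdE n (fun z => Phi z 0 i) a _ _ (Hp0 i) 0 j z0.
    by rewrite !addr0 => -> ->.
  rewrite pdB; last exact: ana_coord.
    rewrite pdB //; last exact: ana_cst.
    by rewrite pd_cst subr0 PaE dP pd_coord subrr.
  by apply: anaB => //; apply: ana_cst.
pose G i k := hipart 2 (p i k).
have [C HC] : exists C, forall i k, mnorm rho (p i k) <= C.
  have cb i : exists C, forall k, mnorm rho (p i k) <= C.
    have [_ pC _] := pg i; have [C _ HC] := cau_bound (ltW rho0) pC.
    by exists C.
  have [C HC] := choice cb; exists (\sum_i C i) => i k; apply: le_trans (HC i k) _.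
  rewrite (bigD1 i) //= lerDl; apply: sumr_ge0 => j _.
  by apply: le_trans (HC j k); apply: mnorm_ge0; apply: ltW.
pose m : R := n%:R + 1; have m0 : 0 < m by rewrite ltr_wpDl.
have [r [r0 rrho Gr]] : exists r, [/\ 0 < r, r <= rho &
    forall i k, mnorm r (G i k) <= r / (4 * m)].
  pose D : R := `|C| + 1; have D0 : 0 < D by rewrite ltr_wpDl.
  pose r : R := Num.min rho (rho ^+ 2 / (4 * m * D)); exists r.
  have r0 : 0 < r by rewrite lt_min rho0 divr_gt0 ?exprn_gt0 ?mulr_gt0.
  have rrho : r <= rho by rewrite ge_min lexx.
  split=> // i k; apply: (le_trans (mnorm_hipart V 2 (p i k) r0 rrho)).
  apply: (@le_trans _ _ ((r / rho) ^+ 2 * D)).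
    rewrite ler_wpM2l ?exprn_ge0 ?divr_ge0 ?(ltW r0) ?(ltW rho0) //.
    by apply: (le_trans (HC i k)); apply: le_trans (ler_norm _) _; rewrite lerDl.
  have : r <= rho ^+ 2 / (4 * m * D) by rewrite ge_min lexx orbT.
  rewrite ler_pdivlMr ?mulr_gt0 // => H.
  rewrite ler_pdivlMr ?mulr_gt0 // exprMn exprVn.
  rewrite (_ : r ^+ 2 * (rho ^+ 2)^-1 * D * (4 * m) = r * (r * (4 * m * D)) / rho ^+ 2); last by ring.
  by rewrite ler_pdivrMr ?exprn_gt0 // ler_pM2l.
have r_ge0 := ltW r0.
have m1 : 1 <= m by rewrite lerDr.
have Gr4 i k : mnorm r (G i k) <= r / 4.
  apply: le_trans (Gr i k) _; rewrite ler_wpM2l // lef_pV2 ?posrE ?mulr_gt0 //.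
  by rewrite ler_peMr.
have Gg i : approx r (G i) (g i).
  apply: approx_hipart2 => //; exact: approx_shrink (pg i).
(* on the polydisc of radius r / 2 the map g is a contraction *)
have g_lip (h h' : 'rV[K]_n) : (forall i, abs (h 0 i) <= r / 2) ->
    (forall i, abs (h' 0 i) <= r / 2) -> (forall i, g i h + h 0 i = g i h' + h' 0 i) -> h = h'.
  move=> hr hr' E; pose d := \sum_i abs (h 0 i - h' 0 i).
  have d0 : 0 <= d by apply: sumr_ge0 => i _; apply: nrm_ge0.
  have hd i : abs (h 0 i - h' 0 i) <= d.
    by rewrite /d (bigD1 i) //= lerDl; apply: sumr_ge0 => j _; apply: nrm_ge0.
  have gd i : abs (h 0 i - h' 0 i) <= d / (2 * m).
    have -> : h 0 i - h' 0 i = - (g i h - g i h').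
      by have /(canRL (addKr _)) -> := E i; ring.
    rewrite nrmN; have [_ _ Gi] := Gg i.
    have lt_r (x : 'rV[K]_n) : (forall i, abs (x 0 i) <= r / 2) -> forall i, abs (x 0 i) < r.
      by move=> xr j; apply: le_lt_trans (xr j) _; lra.
    apply: (@cvg_nrm_le _ _ V (fun k => meval (h 0) (G i k) - meval (h' 0) (G i k)) _ _ 0%N).
      by apply: cvgB; apply: Gi; apply: lt_r.
    move=> k _; apply: (le_trans (meval_lip (G i k) r0 d0 hr hr' hd)).
    apply: (@le_trans _ _ (2 * d / r * (r / (4 * m)))).
      by rewrite ler_wpM2l // divr_ge0 ?mulr_ge0.
    by rewrite le_eqVlt; apply/orP; left; apply/eqP; field; rewrite !gt_eqF.
  have : d <= d / 2.
    apply: (@le_trans _ _ (\sum_(i < n) d / (2 * m))); first exact: ler_sum.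
    rewrite sumr_const card_ord -[X in X <= _]mulr_natr.
    rewrite (_ : d / (2 * m) * n%:R = d / 2 * (n%:R / m)); last by field; rewrite gt_eqF.
    by rewrite ler_piMr ?divr_ge0 // ler_pdivrMr // mul1r lerDl.
  move=> dd; have {dd}d_eq0 : d = 0 by lra.
  apply/rowP => i; apply/eqP; rewrite -subr_eq0 -(nrm_eq0 V) eq_le nrm_ge0 andbT.
  by rewrite -d_eq0.
pose s : R := r / 4; have s0 : 0 < s by rewrite divr_gt0.
have s_ge0 := ltW s0.
pose psi := fix psi k : 'I_n -> mpoly n K :=
  if k is k'.+1 then fun i => mpolyX K (mnm1 i) - compmp (psi k') (G i k')
  else fun=> 0.
have psir k i : mnorm s (psi k i) <= r / 2.
  elim: k i => [|k IH] i; first by rewrite /= mnorm0 divr_ge0.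
  apply: le_trans (mnormB _ _ _ s_ge0) _; rewrite mnormX mdeg1 expr1.
  have : mnorm s (compmp (psi k) (G i k)) <= mnorm (r / 2) (G i k) by apply: mnorm_comp.
  have : mnorm (r / 2) (G i k) <= mnorm r (G i k) by apply: mnorm_mono; lra.
  by have := Gr4 i k; rewrite /s; lra.
have psiS : small2 (fun k l => \sum_i mnorm s (psi k i - psi l i)).
  apply: (@small2_contract _ _ (\sum_(i < n) r)) => [k l|e e0].
    apply: ler_sum => i _; apply: le_trans (mnormB _ _ _ s_ge0) _.
    by have := psir k i; have := psir l i; lra.
  have gS : small2 (fun k l => \sum_i mnorm r (G i k - G i l)).
    by apply: small2_sum => i; have [] := Gg i.
  have [N HN] := gS _ e0; exists N => k l Nk Nl.
  set d := \sum_i mnorm s (psi k i - psi l i).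
  have d0 : 0 <= d by apply: sumr_ge0 => i _; apply: mnorm_ge0.
  have ld i : mnorm s (psi k i - psi l i) <= d.
    by rewrite /d (bigD1 i) //= lerDl; apply: sumr_ge0 => j _; apply: mnorm_ge0.
  apply: (@le_trans _ _ (\sum_(i < n) (d / (2 * m) + mnorm r (G i k - G i l)))).
    apply: ler_sum => i _ /=.
    have -> : mpolyX K (mnm1 i) - compmp (psi k) (G i k) -
       (mpolyX K (mnm1 i) - compmp (psi l) (G i l)) =
       (compmp (psi l) (G i l) - compmp (psi k) (G i l)) - compmp (psi k) (G i k - G i l).
      have dist (x y z t : mpoly n K) : x - y - (x - z) = z - t - (y - t).
        by ring.
      by rewrite compmpB; apply: dist.
    apply: le_trans (mnormB _ _ _ s_ge0) _; apply: lerD; last first.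
      by apply: mnorm_comp => // j; apply: le_trans (psir k j) _; lra.
    have ld' j : mnorm s (psi l j - psi k j) <= d by rewrite mnormBC.
    apply: (le_trans (mnorm_comp_lip (G i l) r0 s_ge0 d0 (psir l) (psir k) ld')).
    apply: (@le_trans _ _ (2 * d / r * (r / (4 * m)))).
      by rewrite ler_wpM2l // divr_ge0 ?mulr_ge0.
    by rewrite le_eqVlt; apply/orP; left; apply/eqP; field; rewrite !gt_eqF.
  rewrite big_split /= lerD //; last by apply: ltW; apply: HN.
  rewrite sumr_const card_ord -[X in X <= _]mulr_natr.
  rewrite (_ : d / (2 * m) * n%:R = d / 2 * (n%:R / m)); last by field; rewrite gt_eqF.
  by rewrite ler_piMr ?divr_ge0 // ler_pdivrMr // mul1r lerDl.
have psiC i : cau V s (fun k => psi k i).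
  apply: small2_le psiS => k l; rewrite [leRHS](bigD1 i) //= lerDl.
  by apply: sumr_ge0 => j' _; apply: mnorm_ge0.
pose q i (h : 'rV[K]_n) := limn (fun k => meval (h 0) (psi k i)).
have psiq i : approx s (fun k => psi k i) (q i) by apply: approx_lim.
pose b := Phi a; pose Q (h : 'rV[K]_n) : 'rV[K]_n := \row_i q i h.
have Qr (h : 'rV[K]_n) i : (forall i, abs (h 0 i) < s) -> abs (Q h 0 i) <= r / 2.
  move=> hs; rewrite mxE; have [_ _ qi] := psiq i.
  apply: (cvg_nrm_le (N := 0%N) (qi h hs)) => k _.
  by apply: le_trans (psir k i); apply: nrm_meval => j; apply: ltW.
have Qeq (h : 'rV[K]_n) i : (forall i, abs (h 0 i) < s) -> g i (Q h) + Q h 0 i = h 0 i.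
  move=> hs; have [_ _ /(_ h hs) c1] := approx_comp (Gg i) s0 psiq (fun i k => psir k i).
  have [_ _ /(_ h hs) c2] := psiq i.
  have c3 : (fun k => meval (h 0) (psi k.+1 i)) @ \oo --> h 0 i - g i (Q h).
    rewrite (_ : (fun k => _) = (fun k => h 0 i - meval (h 0) (compmp (psi k) (G i k)))).
      by apply: cvgB => //; exact: cvg_cst.
    by apply/funext => k; rewrite /= mevalB mevalXU.
  rewrite (cvg_shiftS (fun k => meval (h 0) (psi k i))) in c3.
  have -> : Q h 0 i = h 0 i - g i (Q h).
    rewrite [LHS]mxE; exact: (cvg_unique (@norm_hausdorff _ _) c2 c3).
  by rewrite addrC subrK.
have PhiE (h : 'rV[K]_n) : Phi (a + h) = b + \row_i (g i h + h 0 i).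
  by apply/rowP => i; rewrite !mxE /g -/b subrK addrC subrK.
exists (fun z => a + Q (z - b)); split.
- move=> i; apply: (@ana_eq _ (fun z => a 0 i + q i (z - b))).
    by near=> z; rewrite !mxE.
  apply: anaD; first exact: ana_cst.
  exists s, (fun k => psi k i); apply: approx_eq (psiq i) => h _.
  by rewrite [Phi a + h]addrC addrK.
- have : \forall z \near a, (forall i, abs ((Phi z - b) 0 i) < s) /\
      (forall i, abs ((z - a) 0 i) <= r / 2).
    apply: filterI; last first.
      apply/nbhs_rowP; exists (r / 2); first by rewrite divr_gt0.
      by move=> h hr i; rewrite addrC addKr ltW.
    apply: (@near_forall _ _ a (fun i z => abs ((Phi z - b) 0 i) < s)) => i.
    have := ana_continuous (Pa i) => /cvgrPdist_lt/(_ (emb V s)).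
    rewrite emb_gt0 => /(_ s0); apply: filterS => z.
    by rewrite lt_norm_emb !mxE nrmB.
  apply: filterS => z [zs zr].
  rewrite -[RHS](subrK a) addrC; congr (_ + _); apply: g_lip => //.
    by move=> i; apply: Qr.
  move=> i; rewrite Qeq //; have := PhiE (z - a); rewrite addrC subrK => ->.
  by rewrite addrC addKr mxE.
- apply/nbhs_rowP; exists s => // h hs; rewrite -/b (addrC b) addrK PhiE addrC.
  by congr (_ + _); apply/rowP => i; rewrite mxE Qeq.
Unshelve. all: by end_near.
Qed.

(** * Jets *)

Section RingClosed.
Variables (X : Type) (P : (X -> K) -> Prop).
Hypotheses (Pc : forall c, P (fun=> c)).
Hypotheses (PD : forall f g, P f -> P g -> P (fun x => f x + g x)).
Hypotheses (PM : forall f g, P f -> P g -> P (fun x => f x * g x)).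

(** Determinants and inverses are polynomial expressions; this section transports
    through them analyticity, differentiability along jets and continuity alike. *)
Lemma closed_sum (I : Type) (s : seq I) (F : I -> X -> K) :
  (forall i, P (F i)) -> P (fun x => \sum_(i <- s) F i x).
Proof.
move=> PF; elim: s => [|i s IH].
  by under eq_fun do rewrite big_nil.
by under eq_fun do rewrite big_cons; apply: PD.
Qed.

Lemma closed_prod (I : Type) (s : seq I) (F : I -> X -> K) :
  (forall i, P (F i)) -> P (fun x => \prod_(i <- s) F i x).
Proof.
move=> PF; elim: s => [|i s IH].
  by under eq_fun do rewrite big_nil.
by under eq_fun do rewrite big_cons; apply: PM.
Qed.

Lemma closed_det m (M : X -> 'M[K]_m) :
  (forall i j, P (fun x => M x i j)) -> P (fun x => \det (M x)).
Proof. by move=> PMx; apply: closed_sum => s; apply: PM => //; apply: closed_prod. Qed.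

Lemma closed_invmx m (M : X -> 'M[K]_m) i j :
  (forall i j, P (fun x => M x i j)) -> P (fun x => (\det (M x))^-1) ->
  P (fun x => (\det (M x))^-1 * \adj (M x) i j).
Proof.
move=> PMx PV; apply: PM => //; under eq_fun do rewrite mxE /cofactor.
apply: PM => //; apply: closed_det => k l; under eq_fun do rewrite !mxE.
exact: PMx.
Qed.

End RingClosed.

Lemma invmx_entry m (M : 'M[K]_m) i j : M \in unitmx ->
  invmx M i j = (\det M)^-1 * \adj M i j.
Proof. by move=> Mu; rewrite /invmx Mu mxE. Qed.

Section Jets.
Variable n : nat.
Local Notation J0 := ('rV[K]_n * K)%type.
Local Notation J1 := ('rV[K]_n * K * 'rV[K]_n)%type.
Local Notation ro := (@row_of_J0 K n).
Local Notation jo := (@J0_of_row K n).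

Definition ix (i : 'I_n) : 'I_(n + 1) := lshift 1 i.
Definition iy : 'I_(n + 1) := rshift n ord0.

Lemma jet_sum (F : 'I_(n + 1) -> K) : \sum_a F a = \sum_(i < n) F (ix i) + F iy.
Proof. by rewrite big_split_ord big_ord1. Qed.

Lemma jet_ind (P : 'I_(n + 1) -> Prop) : (forall i, P (ix i)) -> P iy -> forall a, P a.
Proof.
move=> Px Py a; case: (split_ordP a) => [i ->|i ->]; first exact: Px.
by rewrite (ord1 i).
Qed.

Lemma ix_iy i : (ix i == iy) = false.
Proof. by rewrite eq_lrshift. Qed.

Lemma iy_ix i : (iy == ix i) = false.
Proof. by rewrite eq_rlshift. Qed.

Lemma ixE i j : (ix i == ix j) = (i == j).
Proof. by rewrite eq_lshift. Qed.

Lemma ro_x z i : ro z 0 (ix i) = z.1 0 i.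
Proof. by rewrite /row_of_J0 row_mxEl. Qed.

Lemma ro_y z : ro z 0 iy = z.2.
Proof. by rewrite /row_of_J0 row_mxEr mxE eqxx. Qed.

Lemma jo_x v i : (jo v).1 0 i = v 0 (ix i).
Proof. by rewrite mxE. Qed.

Lemma jo_y v : (jo v).2 = v 0 iy.
Proof. by rewrite /J0_of_row /= mxE. Qed.

Lemma ro_jo v : ro (jo v) = v.
Proof.
apply/rowP; elim/jet_ind => [i|]; first by rewrite ro_x mxE.
by rewrite ro_y /J0_of_row /= mxE.
Qed.

Lemma jo_ro z : jo (ro z) = z.
Proof.
case: z => x y; congr pair; first by apply/rowP => i; rewrite mxE -/(ix i) ro_x.
by rewrite mxE -/iy ro_y.
Qed.

Lemma ro_linear c u z : ro (c *: u + z) = c *: ro u + ro z.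
Proof.
by apply/rowP; elim/jet_ind => [i|]; rewrite [RHS]mxE [X in _ = X + _]mxE
  ?ro_x ?ro_y //= !mxE.
Qed.

Lemma nbhs_J0P (z0 : J0) (P : set J0) : (\forall z \near z0, P z) <->
  exists2 r : R, 0 < r & forall z : J0, (forall i, abs (z.1 0 i - z0.1 0 i) < r) ->
    abs (z.2 - z0.2) < r -> P z.
Proof.
split=> [/nbhs_ballP[_ /= /gt0_emb -/(_ _ V)[r r0 ->] HP]|[r r0 HP]].
  exists r => // z zx zy; apply: HP; split=> /=.
    split=> [|i j]; first by rewrite emb_gt0.
    by rewrite !ord1 /ball /= distrC lt_norm_emb.
  by rewrite /ball /= distrC lt_norm_emb.
apply/nbhs_ballP; exists (emb V r); first by rewrite /= emb_gt0.
move=> z [[_ zx] zy]; apply: HP => [i|].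
  by have := zx 0 i; rewrite /ball /= distrC lt_norm_emb.
by move: zy; rewrite /ball /= distrC lt_norm_emb.
Qed.

Lemma nbhs_J1P (w0 : J1) (P : set J1) : (\forall w \near w0, P w) <->
  exists2 r : R, 0 < r & forall w : J1, (forall i, abs (w.1.1 0 i - w0.1.1 0 i) < r) ->
    abs (w.1.2 - w0.1.2) < r -> (forall i, abs (w.2 0 i - w0.2 0 i) < r) -> P w.
Proof.
split=> [/nbhs_ballP[_ /= /gt0_emb -/(_ _ V)[r r0 ->] HP]|[r r0 HP]].
  exists r => // w wx wy wp; apply: HP; split=> /=.
    split=> /=; last by rewrite /ball /= distrC lt_norm_emb.
    split=> [|i j]; first by rewrite emb_gt0.
    by rewrite !ord1 /ball /= distrC lt_norm_emb.
  split=> [|i j]; first by rewrite emb_gt0.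
  by rewrite !ord1 /ball /= distrC lt_norm_emb.
apply/nbhs_ballP; exists (emb V r); first by rewrite /= emb_gt0.
move=> w [[[_ wx] wy] [_ wp]]; apply: HP => [i||i].
- by have := wx 0 i; rewrite /ball /= distrC lt_norm_emb.
- by move: wy; rewrite /ball /= distrC lt_norm_emb.
- by have := wp 0 i; rewrite /ball /= distrC lt_norm_emb.
Qed.

Lemma near_J0 (z0 : J0) (P : set J0) :
  (\forall z \near z0, P z) <-> (\forall v \near ro z0, P (jo v)).
Proof.
split=> [/nbhs_J0P[r r0 HP]|/nbhs_rowP[r r0 HP]].
  apply/nbhs_rowP; exists r => // h hr; apply: HP => [i|].
    by rewrite jo_x [X in abs (X - _)]mxE ro_x addrAC subrr add0r.
  by rewrite jo_y [X in abs (X - _)]mxE ro_y addrAC subrr add0r.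
apply/nbhs_J0P; exists r => // z zx zy.
rewrite -[z]jo_ro -[ro z](subrK (ro z0)) addrC; apply: HP.
by elim/jet_ind => [i|]; rewrite [X in abs X]mxE [X in _ + X]mxE ?ro_x ?ro_y.
Qed.

Lemma near_J1_base (w0 : J1) (P : set 'rV[K]_(n + 1)) :
  (\forall v \near ro w0.1, P v) -> \forall w \near w0, P (ro w.1).
Proof.
move=> /nbhs_rowP[r r0 HP]; apply/nbhs_J1P; exists r => // w wx wy _.
rewrite -[ro w.1](subrK (ro w0.1)) addrC; apply: HP.
by elim/jet_ind => [i|]; rewrite [X in abs X]mxE [X in _ + X]mxE ?ro_x ?ro_y.
Qed.

Lemma derive_row (f : J0 -> K) u z : 'D_u f z = 'D_(ro u) (f \o jo) (ro z).
Proof.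
have E : (fun h => h^-1 *: (f (h *: u + z) - f z)) =
   (fun h => h^-1 *: ((f \o jo) (h *: ro u + ro z) - (f \o jo) (ro z))).
  by apply/funext => h; rewrite /= -ro_linear !jo_ro.
by rewrite /derive E.
Qed.

(** [evec p i] spans, with the other [evec p j], the hyperplane [dy = p dx], of
    which [xi p] is the conormal. *)
Definition evec (p : 'rV[K]_n) (i : 'I_n) (a : 'I_(n + 1)) : K :=
  row_mx (delta_mx 0 i) (p 0 i)%:M 0 a.
Definition xi (p : 'rV[K]_n) (a : 'I_(n + 1)) : K := row_mx p (-1)%:M 0 a.

Lemma evec_x p i j : evec p i (ix j) = (j == i)%:R.
Proof. by rewrite /evec row_mxEl mxE eqxx. Qed.

Lemma evec_y p i : evec p i iy = p 0 i.
Proof. by rewrite /evec row_mxEr mxE eqxx. Qed.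

Lemma xi_x p i : xi p (ix i) = p 0 i.
Proof. by rewrite /xi row_mxEl. Qed.

Lemma xi_y p : xi p iy = -1.
Proof. by rewrite /xi row_mxEr mxE eqxx. Qed.

Lemma evec_sum p i (F : 'I_(n + 1) -> K) :
  \sum_a evec p i a * F a = F (ix i) + p 0 i * F iy.
Proof.
rewrite jet_sum evec_y (bigD1 i) //= evec_x eqxx mul1r big1 ?addr0 // => j /negbTE ji.
by rewrite evec_x ji mul0r.
Qed.

Lemma xi_evec p i : \sum_a evec p i a * xi p a = 0.
Proof. by rewrite evec_sum xi_x xi_y mulrN1 subrr. Qed.

Lemma D0E f i w : D0 f i w = \sum_a evec w.2 i a * pd a (f \o jo) (ro w.1).
Proof.
have ex : ro (delta_mx 0 i, 0) = delta_mx 0 (ix i).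
  apply/rowP; elim/jet_ind => [j|]; rewrite ?ro_x ?ro_y !mxE ?eqxx ?ixE //.
  by rewrite iy_ix andbF.
have ey : ro (0, 1) = delta_mx 0 iy.
  apply/rowP; elim/jet_ind => [j|]; rewrite ?ro_x ?ro_y !mxE ?eqxx //.
  by rewrite ix_iy andbF.
by rewrite evec_sum /D0 !derive_row /pd ex ey.
Qed.

(** * Derivations along second-order jets *)

(** All that the rules for total derivatives require; jets do not enter as row
    vectors, so the calculus of analytic germs does not apply to functions of [w]
    directly. *)
Definition smooth1 (f : J1 -> K) w := forall v, derivable f w v.

Lemma smooth1_cst c w : smooth1 (fun=> c) w.
Proof. by move=> v; apply: derivable_cst. Qed.

Lemma smooth1D f g w : smooth1 f w -> smooth1 g w -> smooth1 (fun x => f x + g x) w.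
Proof. by move=> fw gw v; apply: derivableD. Qed.

Lemma smooth1M f g w : smooth1 f w -> smooth1 g w -> smooth1 (fun x => f x * g x) w.
Proof. by move=> fw gw v; apply: derivableM. Qed.

Lemma smooth1V f w : smooth1 f w -> f w != 0 -> smooth1 (fun x => (f x)^-1) w.
Proof. by move=> fw f0 v; apply: derivableV. Qed.

Lemma smooth1_sum (I : Type) (s : seq I) (F : I -> J1 -> K) w :
  (forall i, smooth1 (F i) w) -> smooth1 (fun x => \sum_(i <- s) F i x) w.
Proof.
apply: (closed_sum (P := fun f => smooth1 f w)); first by move=> c; apply: smooth1_cst.
by move=> f g; apply: smooth1D.
Qed.

Lemma smooth1_eq f g w : (\forall w' \near w, f w' = g w') -> smooth1 f w -> smooth1 g w.
Proof. by move=> fg fw v; apply: near_eq_derivable fg (fw v). Qed.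

Lemma is_derive_fiber k (w : J1) v : is_derive w v (fun w : J1 => w.2 0 k) (v.2 0 k).
Proof.
have cv : (fun h => h^-1 *: ((h *: v + w).2 0 k - w.2 0 k)) @ 0^' --> v.2 0 k.
  apply/cvgrPdist_lt => e e0; near=> h.
  rewrite /= !mxE addrK /GRing.scale /= mulKf ?subrr ?normr0 //.
  by near: h; apply: nbhs_dnbhs_neq.
by apply: DeriveDef; [apply/cvg_ex; eexists; exact: cv|apply: cvg_lim].
Unshelve. all: by end_near.
Qed.

Lemma smooth1_fiber k w : smooth1 (fun w => w.2 0 k) w.
Proof. by move=> v; have [] := is_derive_fiber k w v. Qed.

Lemma is_derive_base (g : 'rV[K]_(n + 1) -> K) (w v : J1) : ana g (ro w.1) ->
  is_derive w v (fun w => g (ro w.1)) (\sum_a ro v.1 0 a * pd a g (ro w.1)).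
Proof.
move=> /(ana_is_derive (ro v.1))[ex vE]; rewrite /derive in vE.
have E : (fun h => h^-1 *: (g (ro (h *: v + w).1) - g (ro w.1))) =
   (fun h => h^-1 *: (g (h *: ro v.1 + ro w.1) - g (ro w.1))).
  by apply/funext => h; rewrite -ro_linear.
by apply: DeriveDef; [rewrite /derivable E|rewrite /derive E].
Qed.

Lemma smooth1_base g w : ana g (ro w.1) -> smooth1 (fun w => g (ro w.1)) w.
Proof. by move=> ga v; have [] := is_derive_base v ga. Qed.

Section D1.
Variables (r : 'M[K]_n) (i : 'I_n) (w : J1).

Lemma D1_eq f g : (\forall w' \near w, f w' = g w') -> D1 f r i w = D1 g r i w.
Proof.
move=> fg; rewrite /D1; congr (_ + _ * _ + _); try exact: near_eq_derive.
by apply: eq_bigr => l _; congr (_ * _); apply: near_eq_derive.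
Qed.

Lemma D1_cst c : D1 (fun=> c) r i w = 0.
Proof.
rewrite /D1 !derive_cst mulr0 !add0r big1 // => l _.
by rewrite derive_cst mulr0.
Qed.

Lemma D1D f g : smooth1 f w -> smooth1 g w ->
  D1 (fun x => f x + g x) r i w = D1 f r i w + D1 g r i w.
Proof.
move=> fw gw; rewrite /D1 !deriveD //.
under eq_bigr => l _ do rewrite deriveD // mulrDr.
have dist (x y p x' y' s s' : K) :
  x + y + p * (x' + y') + (s + s') = x + p * x' + s + (y + p * y' + s') by ring.
by rewrite big_split; apply: dist.
Qed.

Lemma D1M f g : smooth1 f w -> smooth1 g w ->
  D1 (fun x => f x * g x) r i w = D1 f r i w * g w + f w * D1 g r i w.
Proof.
move=> fw gw; rewrite /D1 !deriveM // /GRing.scale /=.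
under eq_bigr => l _ do rewrite deriveM // /GRing.scale /= mulrDr !(mulrCA (r i l)).
have dist (x y p x' y' s s' u v : K) :
  u * x + v * y + p * (u * x' + v * y') + (u * s + v * s') =
  (y + p * y' + s') * v + u * (x + p * x' + s) by ring.
by rewrite big_split /= -!mulr_sumr; apply: dist.
Qed.

Lemma D1_sum (I : Type) (s : seq I) (F : I -> J1 -> K) :
  (forall j, smooth1 (F j) w) ->
  D1 (fun x => \sum_(j <- s) F j x) r i w = \sum_(j <- s) D1 (F j) r i w.
Proof.
move=> Fw; elim: s => [|j s IH].
  by rewrite big_nil; under eq_fun do rewrite big_nil; apply: D1_cst.
rewrite big_cons; under eq_fun do rewrite big_cons.
by rewrite D1D ?IH //; apply: smooth1_sum.
Qed.

Lemma D1_fiber k : D1 (fun w => w.2 0 k) r i w = r i k.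
Proof.
have E v := @derive_val _ _ _ _ _ _ _ (is_derive_fiber k w v).
rewrite /D1 !E /= !mxE mulr0 !add0r (bigD1 k) //= E /= mxE !eqxx mulr1.
by rewrite big1 ?addr0 // => l /negbTE lk; rewrite E /= mxE eq_sym lk andbF mulr0.
Qed.

Lemma D1_base g : ana g (ro w.1) ->
  D1 (fun w => g (ro w.1)) r i w = \sum_a evec w.2 i a * pd a g (ro w.1).
Proof.
move=> ga; have E v := @derive_val _ _ _ _ _ _ _ (is_derive_base v ga).
rewrite /D1 !E [X in _ + _ + X]big1 ?addr0 => [|l _]; last first.
  rewrite E big1 ?mulr0 // => a _.
  by elim/jet_ind: a => [j|]; rewrite ?ro_x ?ro_y ?mxE mul0r.
rewrite evec_sum; congr (_ + _ * _).
  rewrite (bigD1 (ix i)) //= ro_x /= mxE !eqxx mul1r big1 ?addr0 //.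
  elim/jet_ind => [j|_]; last by rewrite ro_y /= mul0r.
  by rewrite ixE ro_x /= mxE => /negbTE ->; rewrite andbF mul0r.
rewrite (bigD1 iy) //= ro_y mul1r big1 ?addr0 //.
elim/jet_ind => [j _|]; last by rewrite eqxx.
by rewrite ro_x /= mxE mul0r.
Qed.

Lemma smooth1_evec j b : smooth1 (fun w => evec w.2 j b) w.
Proof.
elim/jet_ind: b => [l|].
  by under eq_fun do rewrite evec_x; apply: smooth1_cst.
by under eq_fun do rewrite evec_y; apply: smooth1_fiber.
Qed.

Lemma D1_evec j b : D1 (fun w => evec w.2 j b) r i w = (b == iy)%:R * r i j.
Proof.
elim/jet_ind: b => [l|].
  by under eq_fun do rewrite evec_x; rewrite D1_cst ix_iy mul0r.
by under eq_fun do rewrite evec_y; rewrite D1_fiber eqxx mul1r.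
Qed.

Lemma smooth1_xi b : smooth1 (fun w => xi w.2 b) w.
Proof.
elim/jet_ind: b => [l|].
  by under eq_fun do rewrite xi_x; apply: smooth1_fiber.
by under eq_fun do rewrite xi_y; apply: smooth1_cst.
Qed.

Lemma D1_xi b : D1 (fun w => xi w.2 b) r i w =
  (\sum_l (b == ix l)%:R * r i l).
Proof.
elim/jet_ind: b => [l|].
  under eq_fun do rewrite xi_x; rewrite D1_fiber (bigD1 l) //= eqxx mul1r.
  by rewrite big1 ?addr0 // => k /negbTE kl; rewrite ixE eq_sym kl mul0r.
under eq_fun do rewrite xi_y; rewrite D1_cst big1 // => l _.
by rewrite iy_ix mul0r.
Qed.

Lemma smooth1_D0 f j : (forall b, ana (pd b (f \o jo)) (ro w.1)) ->
  smooth1 (D0 f j) w.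
Proof.
move=> fa; rewrite (_ : D0 f j = fun w => \sum_b evec w.2 j b * pd b (f \o jo) (ro w.1)).
  apply: smooth1_sum => b; apply: smooth1M; first exact: smooth1_evec.
  exact: smooth1_base.
by apply/funext => x; rewrite D0E.
Qed.

(** Differentiating [D0 f j] along a second-order jet: besides the second
    derivatives of [f], the term [r i j] arises because the vector [evec p j]
    itself turns. *)
Lemma D1_D0 f j : (forall b, ana (pd b (f \o jo)) (ro w.1)) ->
  D1 (D0 f j) r i w =
   \sum_a \sum_b evec w.2 i a * evec w.2 j b * pd a (pd b (f \o jo)) (ro w.1)
   + r i j * pd iy (f \o jo) (ro w.1).
Proof.
move=> fa; rewrite (_ : D0 f j = fun w => \sum_b evec w.2 j b * pd b (f \o jo) (ro w.1)); last first.
  by apply/funext => x; rewrite D0E.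
rewrite D1_sum => [|b]; last by apply: smooth1M; [exact: smooth1_evec|exact: smooth1_base].
under eq_bigr => b _.
  rewrite D1M; [|exact: smooth1_evec|exact: smooth1_base].
  rewrite D1_evec D1_base // mulr_sumr; over.
rewrite big_split /= addrC exchange_big; congr (_ + _).
  by apply: eq_bigr => a _; apply: eq_bigr => b _; rewrite mulrCA mulrA.
rewrite (bigD1 iy) //= eqxx mul1r big1 ?addr0 // => b /negbTE ->.
by rewrite !mul0r.
Qed.

End D1.
End Jets.

(** * Prolongation of a point transformation *)

Section Prolongation.
Variable n : nat.
Local Notation J0 := ('rV[K]_n * K)%type.
Local Notation J1 := ('rV[K]_n * K * 'rV[K]_n)%type.
Local Notation ro := (@row_of_J0 K n).
Local Notation jo := (@J0_of_row K n).
Variable phi : J0 -> J0.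

Definition comp (A : 'I_(n + 1)) (v : 'rV[K]_(n + 1)) : K := ro (phi (jo v)) 0 A.

Lemma comp_x k : (fun z => (phi z).1 0 k) \o jo = comp (ix k).
Proof. by apply/funext => v; rewrite /comp ro_x. Qed.

Lemma comp_y : (fun z => (phi z).2) \o jo = comp (iy n).
Proof. by apply/funext => v; rewrite /comp ro_y. Qed.

(** The conormal of the image hyperplane, in the target coordinates. *)
Definition conormal (w : J1) (A : 'I_(n + 1)) : K :=
  row_mx (- (prolong1 phi w)^T) 1%:M 0 A.

Lemma conormal_x w k : conormal w (ix k) = - prolong1 phi w k 0.
Proof. by rewrite /conormal row_mxEl !mxE. Qed.

Lemma conormal_y w : conormal w (iy n) = 1.
Proof. by rewrite /conormal row_mxEr mxE eqxx. Qed.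

(** The pull-back of [conormal w] to the source, a multiple of [xi w.2]. *)
Definition pullback (w : J1) (a : 'I_(n + 1)) : K :=
  \sum_A conormal w A * pd a (comp A) (ro w.1).

Lemma jacobianE w i k : total_jacobian phi w i k =
  \sum_a evec w.2 i a * pd a (comp (ix k)) (ro w.1).
Proof. by rewrite mxE D0E comp_x. Qed.

Lemma prolong1E w i : total_jacobian phi w \in unitmx ->
  D0 (fun z => (phi z).2) i w = \sum_k total_jacobian phi w i k * prolong1 phi w k 0.
Proof.
move=> Tu; have /matrixP/(_ i 0) : total_jacobian phi w *m prolong1 phi w =
    \col_i D0 (fun z => (phi z).2) i w by rewrite mulKVmx.
by rewrite !mxE => <-.
Qed.

Lemma pullback_evec w i : total_jacobian phi w \in unitmx ->
  \sum_a evec w.2 i a * pullback w a = 0.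
Proof.
move=> Tu; rewrite /pullback; under eq_bigr => a _ do rewrite mulr_sumr.
rewrite exchange_big /= jet_sum conormal_y.
have -> : \sum_a evec w.2 i a * (1 * pd a (comp (iy n)) (ro w.1)) =
    D0 (fun z => (phi z).2) i w.
  by rewrite D0E comp_y; apply: eq_bigr => a _; rewrite mul1r.
rewrite prolong1E // -big_split big1 //= => k _; rewrite conormal_x jacobianE.
rewrite mulr_suml -big_split big1 //= => a _.
by rewrite mulNr mulrN (mulrC (prolong1 _ _ _ _)) mulrA addNr.
Qed.

(** The prolonged map sends contact elements to contact elements: the pull-back
    annihilates the vectors [evec p i], hence is a multiple of [xi p]. *)
Lemma pullbackE w a : total_jacobian phi w \in unitmx ->
  pullback w a = - pullback w (iy n) * xi w.2 a.
Proof.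
move=> Tu; elim/jet_ind: a => [i|]; last by rewrite xi_y mulrN1 opprK.
have := pullback_evec i Tu; rewrite evec_sum xi_x => /eqP.
by rewrite addr_eq0 => /eqP ->; rewrite mulNr mulrC.
Qed.

Lemma total_jacobian_smooth w i k : (forall A b, ana (pd b (comp A)) (ro w.1)) ->
  smooth1 (fun w => total_jacobian phi w i k) w.
Proof.
move=> Pa; rewrite (_ : (fun w => _) = D0 (fun z => (phi z).1 0 k) i).
  by apply: smooth1_D0 => b; rewrite comp_x.
by apply/funext => x; rewrite mxE.
Qed.

Lemma prolong1_smooth w k : (forall A b, ana (pd b (comp A)) (ro w.1)) ->
  (\forall w' \near w, total_jacobian phi w' \in unitmx) ->
  smooth1 (fun w => prolong1 phi w k 0) w.
Proof.
move=> Pa Tu; pose T w := total_jacobian phi w.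
have Ts i j : smooth1 (fun w => T w i j) w by apply: total_jacobian_smooth.
have dT : smooth1 (fun w => \det (T w)) w.
  exact: (@closed_det J1 (fun f => smooth1 f w) (fun c => @smooth1_cst n c w)
    (fun f g => @smooth1D n f g w) (fun f g => @smooth1M n f g w) n T Ts).
have Tw : \det (T w) != 0 by rewrite -unitfE -unitmxE; apply: nbhs_singleton Tu.
have iT i j : smooth1 (fun w => (\det (T w))^-1 * \adj (T w) i j) w.
  exact: (@closed_invmx J1 (fun f => smooth1 f w) (fun c => @smooth1_cst n c w)
    (fun f g => @smooth1D n f g w) (fun f g => @smooth1M n f g w) n T i j Ts (smooth1V dT Tw)).
apply: (@smooth1_eq _ (fun w => \sum_i ((\det (T w))^-1 * \adj (T w) k i) *
    D0 (fun z => (phi z).2) i w)).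
  apply: filterS Tu => w' Tw'; rewrite /prolong1 mxE; apply: eq_bigr => i _.
  by rewrite [in RHS]mxE (invmx_entry _ _ Tw').
apply: smooth1_sum => i; apply: smooth1M; first exact: iT.
by apply: smooth1_D0 => b; rewrite comp_y.
Qed.

Section AtJet.
Variables (w : J1) (r : 'M[K]_n).
Hypothesis Pa : forall A b, ana (pd b (comp A)) (ro w.1).
Hypothesis Tu : \forall w' \near w, total_jacobian phi w' \in unitmx.

(** Differentiating [D_i Y = sum_k (D_i X^k) Y_k] once more. *)
Lemma total_jacobian_D1_prolong1 i j :
  \sum_k total_jacobian phi w i k * D1 (fun w' => prolong1 phi w' k 0) r j w =
  \sum_a \sum_b evec w.2 j a * evec w.2 i b *
     (\sum_A conormal w A * pd a (pd b (comp A)) (ro w.1))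
  + r j i * pullback w (iy n).
Proof.
have Ps k : smooth1 (fun w' => prolong1 phi w' k 0) w by apply: prolong1_smooth.
have Ts k : smooth1 (fun w => total_jacobian phi w i k) w by apply: total_jacobian_smooth.
have D1T k : D1 (fun w => total_jacobian phi w i k) r j w =
    D1 (D0 (fun z => (phi z).1 0 k) i) r j w.
  have -> : (fun w => total_jacobian phi w i k) = D0 (fun z => (phi z).1 0 k) i.
    by apply/funext => x; rewrite mxE.
  by [].
have yE : D1 (D0 (fun z => (phi z).2) i) r j w =
    \sum_k (D1 (D0 (fun z => (phi z).1 0 k) i) r j w * prolong1 phi w k 0 +
      total_jacobian phi w i k * D1 (fun w' => prolong1 phi w' k 0) r j w).
  rewrite (@D1_eq _ r j w _ (fun w => \sum_k total_jacobian phi w i k * prolong1 phi w k 0)).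
    rewrite (D1_sum r j _ (fun k => smooth1M (Ts k) (Ps k))).
    by apply: eq_bigr => k _; rewrite (D1M r j (Ts k) (Ps k)) D1T.
  by apply: filterS Tu => w' Tw'; apply: prolong1E.
have {yE}-> : \sum_k total_jacobian phi w i k * D1 (fun w' => prolong1 phi w' k 0) r j w =
  D1 (D0 (fun z => (phi z).2) i) r j w -
  \sum_k D1 (D0 (fun z => (phi z).1 0 k) i) r j w * prolong1 phi w k 0.
  by rewrite yE big_split /= addrAC subrr add0r.
have dA f A : f \o jo = comp A -> D1 (D0 f i) r j w =
   \sum_a \sum_b evec w.2 j a * evec w.2 i b * pd a (pd b (comp A)) (ro w.1)
   + r j i * pd (iy n) (comp A) (ro w.1).
  by move=> fA; rewrite D1_D0 ?fA.
rewrite (dA _ _ comp_y); pose H A := \sum_a \sum_b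
   evec w.2 j a * evec w.2 i b * pd a (pd b (comp A)) (ro w.1) +
   r j i * pd (iy n) (comp A) (ro w.1).
have -> : \sum_k D1 (D0 (fun z => (phi z).1 0 k) i) r j w * prolong1 phi w k 0 =
    \sum_k H (ix k) * prolong1 phi w k 0.
  by apply: eq_bigr => k _; rewrite (dA _ _ (@comp_x k)).
rewrite -/(H (iy n)).
have -> : \sum_a \sum_b evec w.2 j a * evec w.2 i b *
     (\sum_A conormal w A * pd a (pd b (comp A)) (ro w.1)) =
  \sum_A conormal w A * \sum_a \sum_b evec w.2 j a * evec w.2 i b *
     pd a (pd b (comp A)) (ro w.1).
  under eq_bigr => a _ do (under eq_bigr => b _ do rewrite mulr_sumr; rewrite exchange_big).
  rewrite exchange_big; apply: eq_bigr => A _; rewrite mulr_sumr.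
  apply: eq_bigr => a _; rewrite mulr_sumr; apply: eq_bigr => b _ /=.
  by rewrite mulrCA.
have -> : r j i * pullback w (iy n) = \sum_A conormal w A * (r j i * pd (iy n) (comp A) (ro w.1)).
  by rewrite mulr_sumr; apply: eq_bigr => A _; rewrite mulrCA.
rewrite -big_split /= jet_sum conormal_y !mul1r [LHS]addrC -sumrN; congr (_ + _).
by apply: eq_bigr => k _; rewrite conormal_x -mulrDr mulNr mulrC.
Qed.

(** The prolonged second derivatives solve a linear system with invertible
    matrix, so that they vanish together with its right-hand side. *)
Lemma prolong2_eq0 : prolong2 phi w r = 0 <->
  forall i j, \sum_a \sum_b evec w.2 j a * evec w.2 i b *
     (\sum_A conormal w A * pd a (pd b (comp A)) (ro w.1))
  + r j i * pullback w (iy n) = 0.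
Proof.
have Tw := nbhs_singleton Tu.
pose E := \matrix_(i < n, j < n) D1 (fun w' => prolong1 phi w' j 0) r i w.
have TE i j : (total_jacobian phi w *m E^T) i j =
    \sum_k total_jacobian phi w i k * D1 (fun w' => prolong1 phi w' k 0) r j w.
  by rewrite mxE; apply: eq_bigr => k _; rewrite !mxE.
rewrite /prolong2 -/E; split=> [E0 i j|E0].
  rewrite -total_jacobian_D1_prolong1 -TE.
  have -> : E = 0 by rewrite -[E](mulKVmx Tw) E0 mulmx0.
  by rewrite trmx0 mulmx0 mxE.
have -> : E = 0; last by rewrite mulmx0.
apply: trmx_inj; rewrite trmx0 -[E^T](mulKmx Tw).
have -> : total_jacobian phi w *m E^T = 0; last by rewrite mulmx0.
by apply/matrixP => i j; rewrite TE total_jacobian_D1_prolong1 E0 mxE.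
Qed.

(** The flat system in the source coordinates, once the second derivatives of
    the transformation are expressed through the first ones. *)
Lemma prolong2_eq0_connection (Gam : 'I_(n + 1) -> 'I_(n + 1) -> 'I_(n + 1) -> K) :
    (forall a b A, pd a (pd b (comp A)) (ro w.1) =
       \sum_c Gam a b c * pd c (comp A) (ro w.1)) ->
    pullback w (iy n) != 0 ->
  prolong2 phi w r = 0 <->
  forall i j, r i j = \sum_a \sum_b evec w.2 i a * evec w.2 j b *
     \sum_c xi w.2 c * Gam a b c.
Proof.
move=> GamE py0; rewrite prolong2_eq0; have Tw := nbhs_singleton Tu.
have E i j : \sum_a \sum_b evec w.2 j a * evec w.2 i b *
     (\sum_A conormal w A * pd a (pd b (comp A)) (ro w.1))
  + r j i * pullback w (iy n) = pullback w (iy n) * (r j i -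
    \sum_a \sum_b evec w.2 j a * evec w.2 i b * \sum_c xi w.2 c * Gam a b c).
  have hE a b : \sum_A conormal w A * pd a (pd b (comp A)) (ro w.1) =
      - pullback w (iy n) * \sum_c xi w.2 c * Gam a b c.
    under eq_bigr => A _ do rewrite GamE mulr_sumr.
    rewrite exchange_big mulr_sumr; apply: eq_bigr => c _ /=.
    rewrite mulrA -pullbackE // /pullback mulr_suml; apply: eq_bigr => A _.
    by rewrite mulrAC mulrA.
  under eq_bigr => a _ do under eq_bigr => b _ do rewrite hE mulrCA.
  under eq_bigr => a _ do rewrite -mulr_sumr.
  by rewrite -mulr_sumr mulrBr addrC mulNr (mulrC (r j i)).
split=> H i j.
  have := H j i; rewrite E => /eqP; rewrite mulf_eq0 (negbTE py0) /= subr_eq0.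
  by move/eqP.
by rewrite E H subrr mulr0.
Qed.

End AtJet.
End Prolongation.

(** * Systems equivalent to the flat one are cubic *)

Section Cubic.
Variable n : nat.
Local Notation J0 := ('rV[K]_n * K)%type.
Local Notation J1 := ('rV[K]_n * K * 'rV[K]_n)%type.
Local Notation ro := (@row_of_J0 K n).
Local Notation jo := (@J0_of_row K n).
Local Notation y := (iy n).

Definition hess (w : J1) (S : 'I_(n + 1) -> 'I_(n + 1) -> K) i j :=
  \sum_a \sum_b evec w.2 i a * evec w.2 j b * S a b.

Lemma hessE w S i j : hess w S i j = S (ix i) (ix j) + w.2 0 j * S (ix i) y
  + w.2 0 i * (S y (ix j) + w.2 0 j * S y y).
Proof.
rewrite /hess; under eq_bigr => a _ do
  (under eq_bigr => b _ do rewrite -mulrA; rewrite -mulr_sumr).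
by rewrite evec_sum !evec_sum.
Qed.

Lemma xi_sum (p : 'rV[K]_n) (Q : 'I_(n + 1) -> K) :
  \sum_c xi p c * Q c = \sum_(k < n) p 0 k * Q (ix k) - Q y.
Proof.
by rewrite jet_sum xi_y mulN1r; congr (_ - _); apply: eq_bigr => k _; rewrite xi_x.
Qed.

Lemma sum_delta (p : 'rV[K]_n) i (x : K) : \sum_k p 0 k * ((k == i)%:R * x) = p 0 i * x.
Proof.
rewrite (bigD1 i) //= eqxx mul1r big1 ?addr0 // => k /negbTE ->.
by rewrite mul0r mulr0.
Qed.

(** A cubic right-hand side is the second fundamental form of the hyperplanes
    with respect to a symmetric connection. *)
Lemma hess_connection w i j (Gam : 'I_(n + 1) -> 'I_(n + 1) -> 'I_(n + 1) -> K) :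
    (forall a b c, Gam a b c = Gam b a c) ->
  hess w (fun a b => \sum_c xi w.2 c * Gam a b c) i j =
  - Gam (ix i) (ix j) y + \sum_(k < n) w.2 0 k *
     (Gam (ix i) (ix j) (ix k) - (k == i)%:R * Gam (ix j) y y - (k == j)%:R * Gam (ix i) y y
      + 2^-1 * w.2 0 i * (2 * Gam (ix j) y (ix k) - (k == j)%:R * Gam y y y)
      + 2^-1 * w.2 0 j * (2 * Gam (ix i) y (ix k) - (k == i)%:R * Gam y y y)
      + w.2 0 i * w.2 0 j * Gam y y (ix k)).
Proof.
move=> Gs; rewrite hessE.
have -> : \sum_c xi w.2 c * Gam y (ix j) c = \sum_c xi w.2 c * Gam (ix j) y c.
  by apply: eq_bigr => c _; rewrite Gs.
rewrite !xi_sum.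
have E k : w.2 0 k *
     (Gam (ix i) (ix j) (ix k) - (k == i)%:R * Gam (ix j) y y - (k == j)%:R * Gam (ix i) y y
      + 2^-1 * w.2 0 i * (2 * Gam (ix j) y (ix k) - (k == j)%:R * Gam y y y)
      + 2^-1 * w.2 0 j * (2 * Gam (ix i) y (ix k) - (k == i)%:R * Gam y y y)
      + w.2 0 i * w.2 0 j * Gam y y (ix k)) =
  w.2 0 k * Gam (ix i) (ix j) (ix k) +
  (w.2 0 i * (w.2 0 k * Gam (ix j) y (ix k)) +
  (w.2 0 j * (w.2 0 k * Gam (ix i) y (ix k)) +
  (w.2 0 i * w.2 0 j * (w.2 0 k * Gam y y (ix k)) -
  (w.2 0 k * ((k == i)%:R * (Gam (ix j) y y + 2^-1 * w.2 0 j * Gam y y y)) +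
   w.2 0 k * ((k == j)%:R * (Gam (ix i) y y + 2^-1 * w.2 0 i * Gam y y y)))))).
  by field.
under [in RHS]eq_bigr => k _ do rewrite E.
rewrite !big_split /= sumrN big_split /= !sum_delta -!mulr_sumr.
set s1 := \sum_k w.2 0 k * Gam (ix i) (ix j) _; set s2 := \sum_k w.2 0 k * Gam (ix i) y _.
set s3 := \sum_k w.2 0 k * Gam (ix j) y _; set s4 := \sum_k w.2 0 k * Gam y y _.
by field.
Qed.

(** A vector killed by the Jacobian lies in the hyperplane of the jet, since the
    pull-back of the conormal is a nonzero multiple of [xi]; and on that
    hyperplane the total Jacobian is injective. *)
Lemma jacobian_unit (phi : J0 -> J0) w : total_jacobian phi w \in unitmx ->
  pullback phi w y != 0 -> \matrix_(a, A) pd a (comp phi A) (ro w.1) \in unitmx.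
Proof.
move=> Tu py0; rewrite -row_free_unit; apply: inj_row_free => v v0.
have vA A : \sum_a v 0 a * pd a (comp phi A) (ro w.1) = 0.
  have /matrixP/(_ 0 A) := v0; rewrite !mxE => E; rewrite -[RHS]E.
  by apply: eq_bigr => a _; rewrite mxE.
have vxi : \sum_a v 0 a * xi w.2 a = 0.
  have : \sum_a v 0 a * pullback phi w a = 0.
    rewrite /pullback; under eq_bigr => a _ do rewrite mulr_sumr.
    rewrite exchange_big big1 //= => A _; under eq_bigr => a _ do rewrite mulrCA.
    by rewrite -mulr_sumr vA mulr0.
  under eq_bigr => a _ do rewrite pullbackE // mulrCA.
  by rewrite -mulr_sumr => /eqP; rewrite mulf_eq0 oppr_eq0 (negbTE py0) => /eqP.
have vy : v 0 y = \sum_i v 0 (ix i) * w.2 0 i.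
  move: vxi; rewrite jet_sum xi_y mulrN1 => /eqP; rewrite subr_eq0 => /eqP <-.
  by apply: eq_bigr => i _; rewrite xi_x.
have vx i : v 0 (ix i) = 0.
  pose u : 'rV[K]_n := \row_i v 0 (ix i).
  suff u0 : u = 0 by have /rowP/(_ i) := u0; rewrite !mxE.
  apply: (row_free_inj (A := total_jacobian phi w)); first by rewrite row_free_unit.
  rewrite mul0mx; apply/rowP => k; rewrite !mxE -[RHS](vA (ix k)) jet_sum vy mulr_suml -big_split.
  by apply: eq_bigr => j _ /=; rewrite !mxE D0E comp_x evec_sum mulrDr mulrA.
apply/rowP; elim/jet_ind => [i|]; rewrite mxE ?vx // vy big1 // => i _.
by rewrite vx mul0r.
Qed.

Lemma ana_det m N (M : 'rV[K]_N -> 'M[K]_m) z :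
  (forall i j, ana (fun z => M z i j) z) -> ana (fun z => \det (M z)) z.
Proof.
exact: (@closed_det _ (fun f => ana f z) (fun c => ana_cst c z)
  (fun f g => @anaD _ f g z) (fun f g => @anaM _ f g z) m M).
Qed.

Lemma near_ana_neq0 N (f : 'rV[K]_N -> K) z : ana f z -> f z != 0 ->
  \forall t \near z, f t != 0.
Proof.
move=> /ana_continuous fz f0; have F : Filter (nbhs z) by exact: nbhs_filter.
have f00 : 0 < `|f z| by rewrite normr_gt0.
move/cvgrPdist_lt: fz => /(_ _ f00); apply: filterS => t.
by apply: contraTneq => ->; rewrite subr0 ltxx.
Qed.

Section FlatIsCubic.
Variables (phi : J0 -> J0) (F : 'I_n -> 'I_n -> J1 -> K) (w0 : J1).
Hypothesis n0 : (0 < n)%N.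
Hypothesis Pa : forall A, ana (comp phi A) (ro w0.1).
Hypothesis F_sym : forall i j, \forall w \near w0, F i j w = F j i w.
Hypothesis flat : transforms_to_flat phi F w0.

(** If the pull-back of the conormal vanished at a jet, the second derivatives
    would drop out of the prolonged equation, and a right-hand side could be
    changed at will; but the system determines it. *)
Lemma flat_pullback_neq0 : \forall w \near w0, pullback phi w y != 0.
Proof.
have PaN : \forall w \near w0, forall A, ana (comp phi A) (ro w.1).
  apply: (@near_J1_base n w0 (fun v => forall A, ana (comp phi A) v)).
  by apply: near_forall => A; exact: ana_near.
have FN : \forall w \near w0, forall x : 'I_n * 'I_n, F x.1 x.2 w = F x.2 x.1 w.
  by apply: near_forall => x; apply: F_sym.
have flatN := near_near flat.
near=> w; apply/negP => /eqP py0.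
have Pw : forall A, ana (comp phi A) (ro w.1) by near: w.
have Pw' A b : ana (pd b (comp phi A)) (ro w.1) by apply: ana_pd.
have flatw : \forall t \near w, total_jacobian phi t \in unitmx /\
    forall r : 'M[K]_n, r^T = r -> (prolong2 phi t r = 0 <-> r = rhs F t) by near: w.
have Tu : \forall t \near w, total_jacobian phi t \in unitmx.
  by apply: filterS flatw => t [].
have [_ Hw] := nbhs_singleton flatw.
have Fw : forall x : 'I_n * 'I_n, F x.1 x.2 w = F x.2 x.1 w by near: w.
have rs : (rhs F w)^T = rhs F w.
  by apply/matrixP => i j; rewrite !mxE; apply: (Fw (j, i)).
have := (Hw _ rs).2 erefl; rewrite (prolong2_eq0 _ Pw' Tu) => E.
have rs1 : (rhs F w + 1%:M)^T = rhs F w + 1%:M by rewrite linearD /= rs trmx1.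
have : prolong2 phi w (rhs F w + 1%:M) = 0.
  by rewrite (prolong2_eq0 _ Pw' Tu) => i j; rewrite -[RHS](E i j) py0 !mulr0.
move/(Hw _ rs1).1/(congr1 (fun M => M - rhs F w)); rewrite addrAC !subrr add0r.
move/matrixP/(_ (Ordinal n0) (Ordinal n0)); rewrite !mxE eqxx => /eqP.
by rewrite oner_eq0.
Unshelve. all: by end_near.
Qed.

(** The Jacobian of the transformation is invertible, so that its second
    derivatives are combinations of the first ones; the coefficients [(d Phi)^-1
    d d Phi] form the connection. *)
Lemma flat_is_cubic : exists Gam : 'I_(n + 1) -> 'I_(n + 1) -> 'I_(n + 1) -> 'rV[K]_(n + 1) -> K,
  [/\ forall a b c, ana (Gam a b c) (ro w0.1),
     \forall v \near ro w0.1, forall a b c, Gam a b c v = Gam b a c v &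
     \forall w \near w0, forall i j, F i j w =
       hess w (fun a b => \sum_c xi w.2 c * Gam a b c (ro w.1)) i j].
Proof.
pose J v := \matrix_(a, A) pd a (comp phi A) v.
have J0u : J (ro w0.1) \in unitmx.
  by apply: jacobian_unit; [have [] := nbhs_singleton flat|apply: nbhs_singleton flat_pullback_neq0].
have Ja a A : ana (fun v => J v a A) (ro w0.1).
  by under eq_fun do rewrite mxE; apply: ana_pd.
have detJ : ana (fun v => \det (J v)) (ro w0.1) by apply: ana_det.
have detJ0 : \det (J (ro w0.1)) != 0 by rewrite -unitfE -unitmxE.
have iJa A c : ana (fun v => (\det (J v))^-1 * \adj (J v) A c) (ro w0.1).
  exact: (@closed_invmx _ (fun f => ana f (ro w0.1)) (fun k => ana_cst k (ro w0.1))
    (fun f g => @anaD _ f g (ro w0.1)) (fun f g => @anaM _ f g (ro w0.1)) _ J A c Ja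
    (anaV detJ detJ0)).
exists (fun a b c v => \sum_A pd a (pd b (comp phi A)) v * ((\det (J v))^-1 * \adj (J v) A c)).
have PaN : \forall v \near ro w0.1, forall A, ana (comp phi A) v.
  by apply: near_forall => A; exact: ana_near.
split.
- by move=> a b c; apply: ana_sum => A _; apply: anaM => //; do 2 apply: ana_pd.
- apply: filterS PaN => v Pv a b c; apply: eq_bigr => A _.
  by rewrite ana_schwarz.
have JN : \forall v \near ro w0.1, J v \in unitmx.
  by apply: filterS (near_ana_neq0 detJ detJ0) => v; rewrite unitmxE unitfE.
have flatN := near_near flat; have pyN := flat_pullback_neq0.
have {}PaN := near_J1_base PaN; have {}JN := near_J1_base JN.
near=> w; have Pw : forall A, ana (comp phi A) (ro w.1) by near: w.
have Jw : J (ro w.1) \in unitmx by near: w.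
have py0 : pullback phi w y != 0 by near: w.
have Pw' A b : ana (pd b (comp phi A)) (ro w.1) by apply: ana_pd.
have flatw : \forall t \near w, total_jacobian phi t \in unitmx /\
    forall r : 'M[K]_n, r^T = r -> (prolong2 phi t r = 0 <-> r = rhs F t) by near: w.
have Tu : \forall t \near w, total_jacobian phi t \in unitmx.
  by apply: filterS flatw => t [].
have [_ Hw] := nbhs_singleton flatw.
pose Gam a b c := \sum_A pd a (pd b (comp phi A)) (ro w.1) *
  ((\det (J (ro w.1)))^-1 * \adj (J (ro w.1)) A c).
have GamE a b A : pd a (pd b (comp phi A)) (ro w.1) =
    \sum_c Gam a b c * pd c (comp phi A) (ro w.1).
  pose h : 'rV[K]_(n + 1) := \row_A pd a (pd b (comp phi A)) (ro w.1).
  have /rowP/(_ A) : h = h *m invmx (J (ro w.1)) *m J (ro w.1) by rewrite mulmxKV.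
  rewrite [LHS]mxE => ->; rewrite mxE; apply: eq_bigr => c _.
  rewrite [J _ _ _]mxE; congr (_ * _); rewrite mxE; apply: eq_bigr => B _.
  by rewrite mxE invmx_entry.
have Gs a b c : Gam a b c = Gam b a c.
  by apply: eq_bigr => A _; rewrite ana_schwarz.
pose r : 'M[K]_n := \matrix_(i, j) hess w (fun a b => \sum_c xi w.2 c * Gam a b c) i j.
have rs : r^T = r.
  have SE a b : \sum_c xi w.2 c * Gam a b c = \sum_c xi w.2 c * Gam b a c.
    by apply: eq_bigr => c _; rewrite Gs.
  clearbody Gam.
  apply/matrixP => i j; rewrite !mxE /hess exchange_big; apply: eq_bigr => a _.
  by apply: eq_bigr => b _; rewrite SE (mulrC (evec w.2 j b)).
have rF : r = rhs F w.
  apply/(Hw _ rs); apply/(prolong2_eq0_connection r Pw' Tu GamE py0) => i j.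
  by rewrite mxE.
by move=> i j; have /matrixP/(_ i j) := rF; rewrite !mxE => <-.
Unshelve. all: by end_near.
Qed.

End FlatIsCubic.
End Cubic.

(** * Curvature tensors with vanishing projective part *)

Section WeylAlgebra.
Variables (N : nat) (Rt : 'I_N -> 'I_N -> 'I_N -> 'I_N -> K).
Hypothesis N3 : (2 < N)%N.
(** [Rt c b d a] is the component [R^c_{b,da}]. *)
Hypothesis Rt_anti : forall c b d a, Rt c b d a = - Rt c b a d.
Hypothesis Rt_bianchi : forall c b d a, Rt c b d a + Rt c d a b + Rt c a b d = 0.
Hypothesis Rt_trace : forall d a, \sum_c Rt c c d a = 0.

Definition hyperplane_curvature (xi u v w : 'I_N -> K) :=
  \sum_c xi c * \sum_b u b * \sum_d v d * \sum_a w a * Rt c b d a.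

Hypothesis Rt_hyper : forall xi u v w : 'I_N -> K,
  \sum_c u c * xi c = 0 -> \sum_c v c * xi c = 0 -> \sum_c w c * xi c = 0 ->
  hyperplane_curvature xi u v w = 0.

Lemma exists_third (a b : 'I_N) : exists2 d, d != a & d != b.
Proof.
have : exists d, d \notin [set a; b]%SET.
  apply/existsP; apply: contraLR N3; rewrite negb_exists => /forallP ab.
  rewrite -leqNgt -[X in (X <= _)%N](card_ord N).
  apply: leq_trans (_ : #|[set a; b]%SET| <= 2)%N; last by rewrite cards2; case: (a != b).
  by apply: subset_leq_card; apply/fintype.subsetP => d _; have := ab d; rewrite negbK.
by case=> d; rewrite !inE negb_or => /andP[da db]; exists d.
Qed.

Let e (c x : 'I_N) : K := (x == c)%:R.

Lemma sum_e c (G : 'I_N -> K) : \sum_x e c x * G x = G c.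
Proof.
rewrite (bigD1 c) //= /e eqxx mul1r big1 ?addr0 // => x /negbTE ->.
by rewrite mul0r.
Qed.

Lemma sum_e2 s c f (G : 'I_N -> K) :
  \sum_x (s * e c x + e f x) * G x = s * G c + G f.
Proof.
under eq_bigr => x _ do rewrite mulrDl -mulrA.
by rewrite big_split /= -mulr_sumr !sum_e.
Qed.

Let eE a b : e a b = (b == a)%:R. Proof. by []. Qed.

Lemma two_neq0 : (2 : K) != 0.
Proof. by rewrite pnatr_eq0. Qed.

Lemma eq0_opp (x : K) : x = - x -> x = 0.
Proof.
move=> xN; apply/eqP; have : 2 * x = 0 by rewrite mulr_natl mulr2n {1}xN addNr.
by move/eqP; rewrite mulf_eq0 (negbTE two_neq0).
Qed.

Lemma Rt_diag c b a : Rt c b a a = 0.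
Proof. exact: eq0_opp. Qed.

(** Evaluation on basis vectors: when the upper index differs from the lower
    ones, the latter are in the kernel of the conormal. *)
Lemma Rt_generic c b d a : c != b -> c != d -> c != a -> Rt c b d a = 0.
Proof.
move=> cb cd ca.
have := @Rt_hyper (e c) (e b) (e d) (e a); rewrite /hyperplane_curvature !sum_e !eE.
by rewrite ![_ == c]eq_sym (negbTE cb) (negbTE cd) (negbTE ca); apply.
Qed.

Lemma e_neq a b : a != b -> e a b = 0 /\ e b a = 0.
Proof. by rewrite !eE => ab; rewrite (negbTE ab) eq_sym (negbTE ab). Qed.

Lemma ee c : e c c = 1.
Proof. by rewrite eE eqxx. Qed.

(** Conormals [e_c - s e_f], with the vector [s e_c + e_f] of their kernels. *)
Lemma Rt_swap1 c f d a : c != f -> c != d -> c != a -> f != d -> f != a ->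
  Rt c c d a = Rt f f d a.
Proof.
move=> cf cd ca fd fa.
have fc : f != c by rewrite eq_sym.
have [[cf0 fc0] [cd0 dc0]] := (e_neq cf, e_neq cd).
have [[ca0 ac0] [fd0 df0]] := (e_neq ca, e_neq fd); have [fa0 af0] := e_neq fa.
have := @Rt_hyper (fun x => -1 * e f x + e c x) (fun x => 1 * e c x + e f x) (e d) (e a).
rewrite /hyperplane_curvature !(sum_e2, sum_e) !ee.
rewrite !(cf0, fc0, cd0, dc0, fd0, df0, ca0, ac0, fa0, af0) (@Rt_generic f c) // (@Rt_generic c f) //.
rewrite !(mulr0, mul1r, mulr1, addr0, add0r) => H.
have := H (subrr 1) erefl erefl.
by rewrite mulN1r addrC => /eqP; rewrite subr_eq0 => /eqP.
Qed.

Lemma Rt_swap2 c f b a : c != f -> c != b -> c != a -> f != b -> f != a ->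
  Rt c b c a = Rt f b f a.
Proof.
move=> cf cb ca fb fa.
have fc : f != c by rewrite eq_sym.
have [[cf0 fc0] [cb0 bc0]] := (e_neq cf, e_neq cb).
have [[ca0 ac0] [fb0 bf0]] := (e_neq ca, e_neq fb); have [fa0 af0] := e_neq fa.
have := @Rt_hyper (fun x => -1 * e f x + e c x) (e b) (fun x => 1 * e c x + e f x) (e a).
rewrite /hyperplane_curvature !(sum_e2, sum_e) !ee.
rewrite !(cf0, fc0, cb0, bc0, fb0, bf0, ca0, ac0, fa0, af0) (@Rt_generic f b c) // (@Rt_generic c b f) //.
rewrite !(mulr0, mul1r, mulr1, addr0, add0r) => H.
have := H erefl (subrr 1) erefl.
by rewrite mulN1r addrC => /eqP; rewrite subr_eq0 => /eqP.
Qed.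

(** The condition is a quadratic polynomial in the parameter [s] of the conormal,
    and its leading coefficient vanishes. *)
Lemma Rt_swap3 c f a : c != f -> c != a -> f != a ->
  Rt c c c a = Rt f c f a + Rt f f c a.
Proof.
move=> cf ca fa.
have fc : f != c by rewrite eq_sym.
have [[cf0 fc0] [ca0 ac0]] := (e_neq cf, e_neq ca); have [fa0 af0] := e_neq fa.
set X := Rt c c c a - Rt f c f a - Rt f f c a.
set Y := Rt c c f a + Rt c f c a - Rt f f f a.
have Q s : s * (s * X + Y) = 0.
  have := @Rt_hyper (fun x => - s * e f x + e c x) (fun x => s * e c x + e f x)
    (fun x => s * e c x + e f x) (e a).
  rewrite /hyperplane_curvature !(sum_e2, sum_e) !ee.
  rewrite !(cf0, fc0, ca0, ac0, fa0, af0) (@Rt_generic f c c) // (@Rt_generic c f f) //.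
  rewrite !(mulr0, mul1r, mulr1, addr0, add0r) => H.
  by rewrite -[RHS](H (subrr _) (subrr _) erefl) /X /Y; ring.
have X0 : X = 0.
  apply: eq0_opp; have := Q 1; have := Q (-1); rewrite !(mulN1r, mul1r) => /eqP.
  rewrite oppr_eq0 addrC subr_eq0 => /eqP ->; move/eqP; rewrite addr_eq0.
  by move/eqP.
by apply/eqP; rewrite -subr_eq0 opprD addrA; apply/eqP.
Qed.

(** The trace condition, together with the Bianchi identity, turns the equality
    of the components [R^c_{c,da}] for distinct indices into [(N + 1) R^c_{c,da}
    = 0]. *)
Lemma Rt_diag_upper c d a : c != d -> c != a -> Rt c c d a = 0.
Proof.
move=> cd ca; have [->|da] := eqVneq d a; first exact: Rt_diag.
have [dc ac ad] : [/\ d != c, a != c & a != d] by rewrite ![_ == c]eq_sym [a == d]eq_sym.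
set l := Rt c c d a.
have lE x : x != d -> x != a -> Rt x x d a = l.
  move=> xd xa; have [->//|xc] := eqVneq x c.
  by apply: Rt_swap1.
have Rd : Rt d d d a = Rt c d c a + l by rewrite (@Rt_swap3 d c a).
have Ra : Rt a a d a = - Rt c a c d + l.
  rewrite Rt_anti (@Rt_swap3 a c d) // opprD; congr (_ + _).
  by rewrite /l Rt_anti opprK.
have Rb := Rt_bianchi c c d a.
have : \sum_x (Rt x x d a - l) = - (N%:R * l).
  by rewrite sumrB Rt_trace sub0r sumr_const card_ord mulr_natl.
rewrite (bigD1 d) //= (bigD1 a) //= big1 ?addr0; last first.
  by move=> x /andP[xd xa]; rewrite lE ?subrr.
rewrite Rd Ra !addrK => E.
have : (N.+1%:R : K) * l = 0.
  have -> : N.+1%:R * l = N%:R * l + l by rewrite -natr1 mulrDl mul1r.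
  rewrite -[N%:R * l]opprK -E -[RHS]Rb -/l (Rt_anti c d a c); ring.
by move/eqP; rewrite mulf_eq0 pnatr_eq0 => /eqP.
Qed.

Lemma Rt_off c b d a : c != d -> c != a -> Rt c b d a = 0.
Proof.
move=> cd ca; have [<-|cb] := eqVneq c b; first exact: Rt_diag_upper.
exact: Rt_generic.
Qed.

Lemma Rt_contract c f b a : c != a -> f != a -> Rt c b c a = Rt f b f a.
Proof.
move=> ca fa; have [->//|cf] := eqVneq c f.
have [cb|cb] := eqVneq c b.
  by subst b; rewrite (@Rt_swap3 c f a) // (@Rt_diag_upper f c a) ?addr0 // eq_sym.
have [fb|fb] := eqVneq f b; last exact: Rt_swap2.
by subst b; rewrite (@Rt_swap3 f c a) ?(@Rt_diag_upper c f a) ?addr0 // eq_sym.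
Qed.

Definition schouten a b : K := - (N.-1%:R)^-1 * \sum_c Rt c b c a.

Lemma schoutenE c a b : c != a -> Rt c b c a = - schouten a b.
Proof.
move=> ca; rewrite /schouten mulNr opprK; set l := Rt c b c a.
have : \sum_x (Rt x b x a - l) = - l.
  rewrite (bigD1 a) //= Rt_diag big1 ?addr0 ?sub0r // => x xa.
  by rewrite /l (@Rt_contract x c) // subrr.
rewrite sumrB sumr_const card_ord => /eqP; rewrite subr_eq => /eqP ->.
have N1 : N.-1%:R != 0 :> K by rewrite pnatr_eq0 -lt0n -subn1 subn_gt0 ltnW.
by rewrite addrC -{2}(prednK (ltnW (ltnW N3))) mulrSr addrK -[l *+ _]mulr_natl mulKf.
Qed.

Lemma schouten_sym a b : schouten a b = schouten b a.
Proof.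
have [->//|ab] := eqVneq a b; have [d da db] := exists_third a b.
apply: oppr_inj; rewrite -(schoutenE _ da) -(schoutenE _ db).
have := Rt_bianchi d b d a; rewrite (@Rt_diag_upper d a b) // addr0 => /eqP.
by rewrite addr_eq0 => /eqP ->; rewrite Rt_anti opprK.
Qed.

(** All components are zero except those in which the upper index is repeated in
    the antisymmetric pair, and these do not depend on the repeated index. *)
Lemma curvature_schouten c b d a :
  Rt c b d a = (c == a)%:R * schouten d b - (c == d)%:R * schouten a b.
Proof.
have [ca|ca] := eqVneq c a; have [cd|cd] := eqVneq c d.
- by rewrite -cd -ca Rt_diag subrr.
- by subst c; rewrite mul1r mul0r subr0 Rt_anti schoutenE // opprK.
- by subst c; rewrite mul0r mul1r sub0r schoutenE.
- by rewrite !mul0r subrr Rt_off.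
Qed.

End WeylAlgebra.

(** * The second Bianchi identity *)

Section Cotton.
Variable N : nat.

Lemma addmxE m k (A B : 'M[K]_(m, k)) i j : (A + B) i j = A i j + B i j.
Proof. by rewrite mxE. Qed.

Lemma oppmxE m k (A : 'M[K]_(m, k)) i j : (- A) i j = - A i j.
Proof. by rewrite mxE. Qed.

Lemma combine (l1 r1 l2 r2 l3 r3 l r : K) :
  l - r = - (l1 - r1 + (l2 - r2) + (l3 - r3)) -> l1 = r1 -> l2 = r2 -> l3 = r3 -> l = r.
Proof.
by move=> E H1 H2 H3; apply/eqP; rewrite -subr_eq0 E H1 H2 H3 !subrr !addr0 oppr0.
Qed.

(** The form of the curvature, differentiated in the direction [f] and summed
    cyclically over [f, a, d], is the second Bianchi identity. The column [eta]
    selects the component of index [f]; with [f] distinct from [a] and [d] only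
    the Cotton tensor survives. *)
Lemma cotton_algebra (f a d : 'I_N) (P : 'I_N -> 'M[K]_N) (r : 'I_N -> 'cV[K]_N)
    (D : 'I_N -> 'I_N -> 'M[K]_N) (DD : 'I_N -> 'I_N -> 'I_N -> 'M[K]_N)
    (Dr : 'I_N -> 'I_N -> 'cV[K]_N) (eps : 'I_N -> 'rV[K]_N) (eta : 'cV[K]_N) :
    (forall a d, D a d + r d *m eps a + P d *m P a = D d a + r a *m eps d + P a *m P d) ->
    (forall f a d, DD f a d + Dr f d *m eps a + (D f d *m P a + P d *m D f a) =
       DD f d a + Dr f a *m eps d + (D f a *m P d + P a *m D f d)) ->
    (forall f a d, DD f a d = DD a f d) ->
    (forall a b, eps a *m P b = eps b *m P a) ->
    eps f *m eta = 1%:M -> eps a *m eta = 0 -> eps d *m eta = 0 ->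
  Dr a d + P d *m r a = Dr d a + P a *m r d.
Proof.
move=> Q DQ DDs Ps ef ea ed.
have X x z : D x z = D z x + r x *m eps z + P x *m P z - P z *m P x - r z *m eps x.
  by rewrite -Q !addrK.
have := congr1 (fun M => M *m eta) (DQ f a d).
have := congr1 (fun M => M *m eta) (DQ a d f).
have := congr1 (fun M => M *m eta) (DQ d f a).
rewrite (DDs d f a) (DDs a f d) (DDs a d f) (X d f) (X d a) (X f a).
rewrite !(mulmxDl, mulmxDr, mulmxN, mulNmx) -!mulmxA ef ea ed.
have Pse x z : eps x *m (P z *m eta) = eps z *m (P x *m eta) by rewrite !mulmxA Ps.
rewrite !(Pse a f, Pse d a, Pse d f) !mulmx0 !mulmx1.
move=> H1 H2 H3; apply/matrixP => i j.
have {}H1 := congr1 (fun M => fun_of_matrix M i j) H1.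
have {}H2 := congr1 (fun M => fun_of_matrix M i j) H2.
have {}H3 := congr1 (fun M => fun_of_matrix M i j) H3.
move: H1 H2 H3; rewrite !(addmxE, oppmxE).
rewrite ![fun_of_matrix 0 _ _]mxE => H1 H2 H3; apply: (combine _ H1 H2 H3).
ring.
Qed.

End Cotton.

(** * Flat coordinates of a projective connection *)

Section ProjectiveCoordinates.
Variables (N : nat) (Pi : 'I_N -> 'I_N -> 'I_N -> 'rV[K]_N -> K) (z0 : 'rV[K]_N).
Hypothesis N3 : (2 < N)%N.
Hypothesis Pi_ana : forall a b c, ana (Pi a b c) z0.
Hypothesis Pi_sym : forall a b c, Pi a b c = Pi b a c.
Hypothesis Pi_trace : forall a z, \sum_c Pi a c c z = 0.

(** The component [R^c_{b,da}] of the curvature of the connection [Pi]. *)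
Definition curvature z c b d a : K :=
  pd d (Pi a b c) z - pd a (Pi d b c) z
  + \sum_e (Pi a b e z * Pi d e c z - Pi d b e z * Pi a e c z).

Hypothesis Pi_flat : \forall z \near z0, forall xi u v w : 'I_N -> K,
  \sum_c u c * xi c = 0 -> \sum_c v c * xi c = 0 -> \sum_c w c * xi c = 0 ->
  hyperplane_curvature (curvature z) xi u v w = 0.

Lemma curvature_anti z c b d a : curvature z c b d a = - curvature z c b a d.
Proof.
rewrite /curvature opprD opprB; congr (_ + _); rewrite -sumrN.
by apply: eq_bigr => e _; rewrite opprB.
Qed.

Lemma curvature_bianchi z c b d a :
  curvature z c b d a + curvature z c d a b + curvature z c a b d = 0.
Proof.
have Ps x y : Pi x y = Pi y x by apply/funext => k; apply: Pi_sym.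
rewrite /curvature !sumrB (Ps b a) (Ps b d) (Ps d a).
have cyc (x1 x2 x3 y1 y2 y3 : K) :
  x1 - x2 + (y1 - y2) + (x2 - x3 + (y2 - y3)) + (x3 - x1 + (y3 - y1)) = 0 by ring.
exact: cyc.
Qed.

Lemma curvature_trace z d a : (forall a b c, ana (Pi a b c) z) ->
  \sum_c curvature z c c d a = 0.
Proof.
move=> Pz; rewrite /curvature big_split /= sumrB.
have pd0 i j : \sum_c pd i (Pi j c c) z = 0.
  rewrite -pd_sum => [|c _ //]; rewrite (_ : (fun z => _) = fun=> 0) ?pd_cst //.
  by apply/funext => x; apply: Pi_trace.
rewrite !pd0 subrr add0r; under eq_bigr => c _ do rewrite sumrB.
rewrite sumrB exchange_big /= -sumrB big1 // => e _.
by rewrite -sumrB big1 // => c _; rewrite mulrC subrr.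
Qed.

(** The projective Schouten tensor of [Pi]. *)
Definition rho a b z := schouten (curvature z) a b.

Lemma ana_curvature c b d a : ana (fun z => curvature z c b d a) z0.
Proof.
apply: anaD; first by apply: anaB; apply: ana_pd.
by apply: ana_sum => e _; apply: anaB; apply: anaM.
Qed.

Lemma ana_rho a b : ana (rho a b) z0.
Proof. by apply: anaZ; apply: ana_sum => c _; apply: ana_curvature. Qed.

Lemma Pi_near : \forall z \near z0, forall a b c, ana (Pi a b c) z.
Proof.
suff : \forall z \near z0, forall x : 'I_N * 'I_N * 'I_N, ana (Pi x.1.1 x.1.2 x.2) z.
  by apply: filterS => z H a b c; apply: (H (a, b, c)).
by apply: near_forall => x; apply: ana_near.
Qed.

Lemma rho_near : \forall z \near z0, forall a b, ana (rho a b) z.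
Proof.
suff : \forall z \near z0, forall x : 'I_N * 'I_N, ana (rho x.1 x.2) z.
  by apply: filterS => z H a b; apply: (H (a, b)).
by apply: near_forall => x; apply: ana_near; apply: ana_rho.
Qed.

(** The connection being trace free, its Ricci tensor is symmetric. *)
Lemma rho_sym : \forall z \near z0, forall a b, rho a b z = rho b a z.
Proof.
have Pn := Pi_near; near=> z => a b.
apply: schouten_sym => // [c b' d a'|c b' d a'|d a'|].
- exact: curvature_anti.
- exact: curvature_bianchi.
- by apply: curvature_trace; near: z.
- by near: z.
Unshelve. all: by end_near.
Qed.

Lemma curvature_rho : \forall z \near z0, forall a d b c,
  pd a (Pi d b c) z + rho d b z * (a == c)%:R + \sum_e Pi d b e z * Pi a e c z =
  pd d (Pi a b c) z + rho a b z * (d == c)%:R + \sum_e Pi a b e z * Pi d e c z.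
Proof.
have Pn := Pi_near; near=> z => a d b c.
have E : curvature z c b d a =
    (c == a)%:R * rho d b z - (c == d)%:R * rho a b z.
  apply: curvature_schouten => // [c' b' d' a'|c' b' d' a'|d' a'|].
  - exact: curvature_anti.
  - exact: curvature_bianchi.
  - by apply: curvature_trace; near: z.
  - by near: z.
move: E; rewrite /curvature sumrB ![c == _]eq_sym.
set x1 := pd d _ z; set x2 := pd a _ z; set s1 := \sum_e _; set s2 := \sum_e _.
set r1 := rho d b z; set r2 := rho a b z => /eqP; rewrite -subr_eq0 => /eqP E.
apply/eqP; rewrite -subr_eq0 -oppr_eq0 -[X in _ == X]E; apply/eqP; ring.
Unshelve. all: by end_near.
Qed.

(** In dimension at least three there is an index [f] distinct from [a] and [d],
    and the second Bianchi identity then yields the Cotton tensor. *)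
Lemma cotton_eq0 : \forall z \near z0, forall a d b,
  pd a (rho d b) z + \sum_e Pi d b e z * rho a e z =
  pd d (rho a b) z + \sum_e Pi a b e z * rho d e z.
Proof.
move: Pi_near rho_near (near_near curvature_rho); move: rho => rho' Pn rn Cn.
near=> z => a d b.
have Pz : forall a b c, ana (Pi a b c) z by near: z.
have rz : forall a b, ana (rho' a b) z by near: z.
have Cz : \forall z \near z, forall a d b c,
  pd a (Pi d b c) z + rho' d b z * (a == c)%:R + \sum_e Pi d b e z * Pi a e c z =
  pd d (Pi a b c) z + rho' a b z * (d == c)%:R + \sum_e Pi a b e z * Pi d e c z by near: z.
have [->//|ad] := eqVneq a d; have [f fa fd] := exists_third N3 a d.
have mat (M : 'I_N -> 'I_N -> 'I_N -> K) :
    exists M' : 'I_N -> 'M[K]_N, forall a b c, M' a b c = M a b c.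
  by exists (fun a => \matrix_(b, c) M a b c) => ? ? ?; rewrite mxE.
have [P PE] := mat (fun a b c => Pi a b c z).
have [r rE] : exists r : 'I_N -> 'cV[K]_N, forall a b i, r a b i = rho' a b z.
  by exists (fun a => \col_b rho' a b z) => ? ? ?; rewrite mxE.
have [Dr DrE] : exists Dr : 'I_N -> 'I_N -> 'cV[K]_N,
    forall f a b i, Dr f a b i = pd f (rho' a b) z.
  by exists (fun f a => \col_b pd f (rho' a b) z) => ? ? ? ?; rewrite mxE.
have [D DE] : exists D : 'I_N -> 'I_N -> 'M[K]_N, forall f a b c, D f a b c = pd f (Pi a b c) z.
  by exists (fun f a => \matrix_(b, c) pd f (Pi a b c) z) => ? ? ? ?; rewrite mxE.
have [DD DDE] : exists DD : 'I_N -> 'I_N -> 'I_N -> 'M[K]_N,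
    forall e f a b c, DD e f a b c = pd e (pd f (Pi a b c)) z.
  by exists (fun e f a => \matrix_(b, c) pd e (pd f (Pi a b c)) z) => ? ? ? ? ?; rewrite mxE.
have := @cotton_algebra N f a d P r D DD Dr (fun a => delta_mx 0 a) (delta_mx f 0).
have dE i j (M : 'cV[K]_N) : (M *m (delta_mx 0 j : 'rV[K]_N)) i =1 fun c => M i 0 * (j == c)%:R.
  by move=> c; rewrite mxE big_ord1 mxE eqxx eq_sym.
have H1 x y : D x y + r y *m delta_mx 0 x + P y *m P x = D y x + r x *m delta_mx 0 y + P x *m P y.
  apply/matrixP => i c; rewrite !addmxE !dE; have := nbhs_singleton Cz x y i c.
  have PP x' y' : (P x' *m P y') i c = \sum_e Pi x' i e z * Pi y' e c z.
    by rewrite mxE; apply: eq_bigr => e _; rewrite !PE.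
  by rewrite !PP !DE !rE.
have H2 g x y : DD g x y + Dr g y *m delta_mx 0 x + (D g y *m P x + P y *m D g x) =
       DD g y x + Dr g x *m delta_mx 0 y + (D g x *m P y + P x *m D g y).
  apply/matrixP => i c; rewrite !addmxE !dE !DDE !DrE.
  have PP x' y' : (D g x' *m P y') i c + (P x' *m D g y') i c =
     pd g (fun z => \sum_e Pi x' i e z * Pi y' e c z) z.
    rewrite pd_sum => [|e _]; last exact: anaM.
    rewrite !mxE -big_split; apply: eq_bigr => e _ /=.
    by rewrite pdM // !DE !PE.
  rewrite !PP.
  have PQ x' y' : pd g (fun z => pd x' (Pi y' i c) z + rho' y' i z * (x' == c)%:R +
      \sum_e Pi y' i e z * Pi x' e c z) z =
    pd g (pd x' (Pi y' i c)) z + pd g (rho' y' i) z * (x' == c)%:R +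
    pd g (fun z => \sum_e Pi y' i e z * Pi x' e c z) z.
    have a1 : ana (fun z => rho' y' i z * (x' == c)%:R) z by apply: anaM => //; apply: ana_cst.
    have a2 : ana (fun z => \sum_e Pi y' i e z * Pi x' e c z) z.
      by apply: ana_sum => e _; apply: anaM.
    have a3 : ana (pd x' (Pi y' i c)) z by apply: ana_pd.
    rewrite pdD //; last exact: anaD.
    rewrite pdD //; congr (_ + _ + _); rewrite pdM //; last exact: ana_cst.
    by rewrite pd_cst mulr0 addr0.
  rewrite -(PQ x y) -(PQ y x); apply: pd_eq; apply: filterS Cz => t Ct; exact: Ct.
have H3 g x y : DD g x y = DD x g y.
  by apply/matrixP => i c; rewrite !DDE ana_schwarz.
have H4 x y : delta_mx 0 x *m P y = delta_mx 0 y *m P x :> 'rV[K]_N.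
  by rewrite -!rowE; apply/rowP => c; rewrite !mxE !PE Pi_sym.
have H5 : delta_mx 0 f *m delta_mx f 0 = 1%:M :> 'M[K]_1.
  by rewrite mul_delta_mx; apply/matrixP => i j; rewrite !mxE !ord1 !eqxx.
have H6 x : f != x -> delta_mx 0 x *m delta_mx f 0 = 0 :> 'M[K]_1.
  by move=> fx; rewrite mul_delta_mx_cond eq_sym (negbTE fx) mulr0n.
move/(_ H1 H2 H3 H4 H5 (H6 a fa) (H6 d fd)) => /matrixP/(_ b 0).
rewrite !addmxE !DrE ![(P _ *m _) _ _]mxE => E.
rewrite (_ : \sum_e Pi d b e z * _ = \sum_j P d b j * r a j 0); last first.
  by apply: eq_bigr => e _; rewrite PE rE.
by rewrite E; congr (_ + _); apply: eq_bigr => e _; rewrite PE rE.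
Unshelve. all: by end_near.
Qed.

Local Notation idx := ('I_1 + 'I_N)%type.

Lemma idx_sum (F : idx -> K) : \sum_j F j = F (inl ord0) + \sum_c F (inr c).
Proof. by rewrite big_sumType big_ord1. Qed.

(** The system [d_a d_b u = Pi_ab^c d_c u + rho_ab u], with unknowns [u] and its
    first derivatives. *)
Definition tractor a (i j : idx) (z : 'rV[K]_N) : K :=
  match i, j with
  | inl _, inl _ => 0
  | inl _, inr c => (a == c)%:R
  | inr b, inl _ => rho a b z
  | inr b, inr c => Pi a b c z
  end.

Lemma ana_tractor a i j : ana (tractor a i j) z0.
Proof.
by case: i => [k0|b]; case: j => [k|c]; [exact: ana_cst|exact: ana_cst|exact: ana_rho|exact: Pi_ana].
Qed.

(** Component by component: the symmetry of [Pi] and of [rho], the form of the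
    curvature and the vanishing of the Cotton tensor. *)
Lemma tractor_compat : \forall z \near z0, forall b c i k,
  pd b (tractor c i k) z + \sum_j tractor c i j z * tractor b j k z =
  pd c (tractor b i k) z + \sum_j tractor b i j z * tractor c j k z.
Proof.
have Sn := rho_sym; have Cn := curvature_rho; have Tn := cotton_eq0.
near=> z => a d i k; rewrite !idx_sum.
have Sz : forall a b, rho a b z = rho b a z by near: z.
have Cz : forall a d b c,
  pd a (Pi d b c) z + rho d b z * (a == c)%:R + \sum_e Pi d b e z * Pi a e c z =
  pd d (Pi a b c) z + rho a b z * (d == c)%:R + \sum_e Pi a b e z * Pi d e c z by near: z.
have Tz : forall a d b,
  pd a (rho d b) z + \sum_e Pi d b e z * rho a e z =
  pd d (rho a b) z + \sum_e Pi a b e z * rho d e z by near: z.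
have del (x : 'I_N) (G : 'I_N -> K) : \sum_c (x == c)%:R * G c = G x.
  rewrite (bigD1 x) //= eqxx mul1r big1 ?addr0 // => c.
  by rewrite eq_sym => /negbTE ->; rewrite mul0r.
case: i k => [k0|b] [k1|c]; rewrite /tractor ?pd_cst.
- by rewrite !mul0r !add0r !del Sz.
- by rewrite !mul0r !add0r !del Pi_sym.
- rewrite !mulr0 !add0r; apply: Tz.
- rewrite !addrA; apply: Cz.
Unshelve. all: by end_near.
Qed.

Lemma tractor_solution (c0 : K) (c1 : 'I_N -> K) : exists u : 'rV[K]_N -> K,
  [/\ ana u z0, u z0 = c0, forall b, pd b u z0 = c1 b &
   \forall z \near z0, forall a b, pd a (pd b u) z =
      \sum_c Pi a b c z * pd c u z + rho a b z * u z].
Proof.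
have [U [Ua U0 dU]] := linear_frobenius ana_tractor tractor_compat
  (fun i => match i with inl _ => c0 | inr b => c1 b end).
pose u := U (inl ord0); exists u.
have du : \forall z \near z0, forall b, pd b u z = U (inr b) z.
  apply: filterS dU => z dUz b; rewrite dUz idx_sum mul0r add0r /=.
  rewrite (bigD1 b) //= eqxx mul1r big1 ?addr0 // => c.
  by rewrite eq_sym => /negbTE ->; rewrite mul0r.
split=> [||b|]; first exact: Ua.
- exact: U0.
- by rewrite (nbhs_singleton du) U0.
have ddu := near_near du; near=> z => a b.
have duz : forall b, pd b u z = U (inr b) z by near: z.
have dUz : forall a i, pd a (U i) z = \sum_j tractor a i j z * U j z by near: z.
rewrite (@pd_eq _ a _ (U (inr b))); last first.
  have : \forall t \near z, forall b, pd b u t = U (inr b) t by near: z.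
  by apply: filterS => t H; apply: H.
have -> : pd a (U (inr b)) z = \sum_j tractor a (inr b) j z * U j z.
  by apply: dUz.
rewrite idx_sum addrC /=; congr (_ + _).
by apply: eq_bigr => c _; rewrite duz.
Unshelve. all: by end_near.
Qed.

(** The quotients of solutions [U A / u], where [U A] vanishes to first order
    like the coordinate of index [A] and [u] is [1] to first order. In the
    Hessian of a quotient the [rho] terms cancel, and the derivatives of [u]
    contribute only projective changes. *)
Lemma projective_coordinates : exists (Phi : 'rV[K]_N -> 'rV[K]_N) (ups : 'I_N -> 'rV[K]_N -> K),
  [/\ forall A, ana (fun z => Phi z 0 A) z0,
      forall A b, pd b (fun z => Phi z 0 A) z0 = (A == b)%:R &
      \forall z \near z0, forall A a b, pd a (pd b (fun z => Phi z 0 A)) z =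
        \sum_c (Pi a b c z + (a == c)%:R * ups b z + (b == c)%:R * ups a z)
          * pd c (fun z => Phi z 0 A) z].
Proof.
have [u [ua u0 du0 ddu]] := tractor_solution 1 (fun=> 0).
have [U HU] := choice (fun A => tractor_solution 0 (fun b => (A == b)%:R)).
have uz0 : u z0 != 0 by rewrite u0 oner_neq0.
pose Phi z : 'rV[K]_N := \row_A (U A z / u z).
exists Phi, (fun b z => - pd b u z / u z).
have PhiE A : (fun z => Phi z 0 A) = fun z => U A z / u z.
  by apply/funext => z; rewrite mxE.
have Ua A : ana (U A) z0 by have [] := HU A.
have Pa A : ana (fun z => Phi z 0 A) z0.
  by rewrite PhiE; apply: anaM => //; apply: anaV.
have uN : \forall z \near z0, ana u z /\ u z != 0.
  by apply: filterI; [exact: ana_near|exact: near_ana_neq0].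
have PN : \forall z \near z0, forall A, ana (fun z => Phi z 0 A) z.
  by apply: near_forall => A; apply: ana_near.
have UE A : \forall z \near z0, U A z = u z * Phi z 0 A.
  by apply: filterS uN => z [_ uz]; rewrite mxE mulrC divfK.
have dUE A : \forall z \near z0, forall b, pd b (U A) z =
    pd b u z * Phi z 0 A + u z * pd b (fun z => Phi z 0 A) z.
  have UEn := near_near (UE A); near=> z => b.
  have [uz _] : ana u z /\ u z != 0 by near: z.
  have Pz : forall A, ana (fun z => Phi z 0 A) z by near: z.
  rewrite -pdM //; apply: pd_eq.
  by near: z.
split=> //.
- move=> A b; have := nbhs_singleton (dUE A) b; have [_ U0 dU0 _] := HU A.
  by rewrite du0 mul0r add0r u0 mul1r dU0 => ->.
have ddUN : \forall z \near z0, forall A a b, pd a (pd b (U A)) z =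
      \sum_c Pi a b c z * pd c (U A) z + rho a b z * U A z.
  by apply: near_forall => A; have [] := HU A.
have dUN : \forall z \near z0, forall A b, pd b (U A) z =
    pd b u z * Phi z 0 A + u z * pd b (fun z => Phi z 0 A) z.
  by apply: near_forall => A; apply: dUE.
have UN : \forall z \near z0, forall A, U A z = u z * Phi z 0 A.
  by apply: near_forall => A; apply: UE.
have dUNn := near_near dUN.
near=> z => A a b.
have [uz uz_neq0] : ana u z /\ u z != 0 by near: z.
have Pz : forall A, ana (fun z => Phi z 0 A) z by near: z.
have dduz : forall a b, pd a (pd b u) z =
  \sum_c Pi a b c z * pd c u z + rho a b z * u z by near: z.
have ddUz : forall A a b, pd a (pd b (U A)) z =
      \sum_c Pi a b c z * pd c (U A) z + rho a b z * U A z by near: z.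
have dUz : forall A b, pd b (U A) z =
    pd b u z * Phi z 0 A + u z * pd b (fun z => Phi z 0 A) z by near: z.
have Uz : forall A, U A z = u z * Phi z 0 A by near: z.
pose dP c := pd c (fun z => Phi z 0 A) z.
have E : pd a (pd b (U A)) z = pd a (pd b u) z * Phi z 0 A + pd b u z * dP a
    + (pd a u z * dP b + u z * pd a (pd b (fun z => Phi z 0 A)) z).
  rewrite (@pd_eq _ a _ (fun z => pd b u z * Phi z 0 A + u z * pd b (fun z => Phi z 0 A) z)).
    have du_a : ana (pd b u) z by apply: ana_pd.
    have dP_a : ana (pd b (fun z => Phi z 0 A)) z by apply: ana_pd.
    by rewrite pdD ?pdM //; apply: anaM.
  have : \forall t \near z, forall A b, pd b (U A) t =
    pd b u t * Phi t 0 A + u t * pd b (fun z => Phi z 0 A) t by near: z.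
  by apply: filterS.
have del (x : 'I_N) (y : K) : \sum_c (x == c)%:R * y * dP c = y * dP x.
  rewrite (bigD1 x) //= eqxx mul1r big1 ?addr0 // => c.
  by rewrite eq_sym => /negbTE ->; rewrite !mul0r.
have -> : \sum_c (Pi a b c z + (a == c)%:R * (- pd b u z / u z)
     + (b == c)%:R * (- pd a u z / u z)) * dP c =
   \sum_c Pi a b c z * dP c - pd b u z / u z * dP a - pd a u z / u z * dP b.
  under eq_bigr => c _ do rewrite !mulrDl.
  by rewrite !big_split /= !del !mulNr.
move: E; rewrite ddUz dduz Uz; under eq_bigr => c _ do rewrite dUz mulrDr mulrA.
rewrite big_split /= -mulr_suml.
have -> : \sum_c Pi a b c z * (u z * pd c (fun z => Phi z 0 A) z) =
    u z * \sum_c Pi a b c z * dP c.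
  by rewrite mulr_sumr; apply: eq_bigr => c _; rewrite mulrCA.
set S := \sum_c _ * dP c; set S' := \sum_c _ * pd c u z; set X := pd a (pd b _) z.
set f := Phi z 0 A; set d1 := pd a u z; set d2 := pd b u z; set v := u z in uz_neq0 *.
set p1 := dP a; set p2 := dP b; set rr := rho a b z => E.
have {}E : v * X = v * S - d2 * p1 - d1 * p2.
  have -> : v * X = (S' + rr * v) * f + d2 * p1 + (d1 * p2 + v * X)
     - (S' + rr * v) * f - d2 * p1 - d1 * p2 by ring.
  by rewrite -E; ring.
by apply: (mulfI uz_neq0); rewrite E; field.
Unshelve. all: by end_near.
Qed.

End ProjectiveCoordinates.

(** * Curvature on an open set of hyperplanes determines it on all *)

(** A polynomial vanishing on a neighbourhood of the origin has the roots [d / 2,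
    d / 3, ...]. *)
Lemma poly_eq0_small (P : {poly K}) (d : R) : 0 < d ->
  (forall t, abs t < d -> P.[t] = 0) -> P = 0.
Proof.
move=> d0 HP; apply/eqP; apply/negPn/negP => P0.
pose x (k : nat) : K := emb V (d / k.+2%:R).
have x_inj : injective x.
  move=> k l /fmorph_inj /(mulfI (lt0r_neq0 d0)) /invr_inj /eqP.
  by rewrite eqr_nat => /eqP[].
have xr : all (root P) (map x (iota 0 (size P))).
  apply/allP => _ /mapP[k _ ->]; apply/eqP/HP; rewrite nrm_emb ger0_norm.
    by rewrite ltr_pdivrMr // ltr_pMr // ltr1n.
  by rewrite divr_ge0 // ltW.
have := max_poly_roots P0 xr (etrans (map_inj_uniq x_inj _) (iota_uniq _ _)).
by rewrite size_map size_iota ltnn.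
Qed.

Lemma sumZZ (I : finType) (s k : K) (f G H : I -> K) :
  (forall x, G x = k * H x) -> \sum_x (s * f x) * G x = s * k * \sum_x f x * H x.
Proof.
move=> GH; rewrite mulr_sumr; apply: eq_bigr => x _; rewrite GH.
by rewrite -!mulrA; congr (_ * _); rewrite mulrCA.
Qed.

Lemma hyperplane_curvatureZ N (T : 'I_N -> 'I_N -> 'I_N -> 'I_N -> K) s k x u v w :
  hyperplane_curvature T (fun c => s * x c) (fun c => k * u c) (fun c => k * v c)
    (fun c => k * w c) = s * (k * (k * (k * 1))) * hyperplane_curvature T x u v w.
Proof.
apply: sumZZ => c; apply: sumZZ => b; apply: sumZZ => d; apply: sumZZ => a.
by rewrite mul1r.
Qed.

Lemma hyperplane_curvature_poly N (T : 'I_N -> 'I_N -> 'I_N -> 'I_N -> K)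
    (X A B C : 'I_N -> {poly K}) : exists P : {poly K}, forall t,
  P.[t] = hyperplane_curvature T (fun c => (X c).[t]) (fun c => (A c).[t])
    (fun c => (B c).[t]) (fun c => (C c).[t]).
Proof.
exists (\sum_c X c * \sum_b A b * \sum_d B d * \sum_a C a * (T c b d a)%:P) => t.
rewrite horner_sum; apply: eq_bigr => c _; rewrite hornerM horner_sum; congr (_ * _).
apply: eq_bigr => b _; rewrite hornerM horner_sum; congr (_ * _).
apply: eq_bigr => d _; rewrite hornerM horner_sum; congr (_ * _).
by apply: eq_bigr => a _; rewrite hornerM hornerC.
Qed.

(** Join a conormal [x] to [xi p0] by a segment, and carry the vectors of its
    kernel along by projecting parallel to a basis vector; this is polynomial in
    the parameter, and near [xi p0] the segment consists of multiples of
    conormals [xi p]. *)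
Lemma hyperplane_curvature_eq0 n (T : 'I_(n + 1) -> 'I_(n + 1) -> 'I_(n + 1) -> 'I_(n + 1) -> K)
    (p0 : 'rV[K]_n) (r : R) : 0 < r ->
    (forall p : 'rV[K]_n, (forall i, abs (p 0 i - p0 0 i) < r) -> forall u v w,
      \sum_c u c * xi p c = 0 -> \sum_c v c * xi p c = 0 -> \sum_c w c * xi p c = 0 ->
      hyperplane_curvature T (xi p) u v w = 0) ->
  forall x u v w : 'I_(n + 1) -> K,
    \sum_c u c * x c = 0 -> \sum_c v c * x c = 0 -> \sum_c w c * x c = 0 ->
    hyperplane_curvature T x u v w = 0.
Proof.
move=> r0 HT x u v w ux vx wx.
have [/forallP x0|] := boolP [forall c, x c == 0].
  by apply: big1 => c _; rewrite (eqP (x0 c)) mul0r.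
rewrite negb_forall => /existsP[c0 xc0].
pose X c : {poly K} := (xi p0 c)%:P + (x c - xi p0 c)%:P * 'X.
pose kerp (u : 'I_(n + 1) -> K) b : {poly K} :=
  X c0 * (u b)%:P - (\sum_c (u c)%:P * X c) * ((b == c0)%:R)%:P.
have XE c t : (X c).[t] = xi p0 c + (x c - xi p0 c) * t by rewrite !hornerE.
have kerpE u' b t : (kerp u' b).[t] =
    (X c0).[t] * u' b - (\sum_c u' c * (X c).[t]) * (b == c0)%:R.
  rewrite /kerp hornerD hornerN !hornerM !hornerC horner_sum.
  by congr (_ - _ * _); apply: eq_bigr => c _; rewrite hornerM hornerC.
have kerp_ker u' t : \sum_b (kerp u' b).[t] * (X b).[t] = 0.
  under eq_bigr => b _ do rewrite kerpE mulrBl -!mulrA.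
  rewrite sumrB -!mulr_sumr; set S := \sum_c u' c * _.
  rewrite [X in _ - _ * X](bigD1 c0) //= [X in _ * (_ + X)]big1 => [|b /negbTE ->].
    by rewrite eqxx mul1r addr0 mulrC subrr.
  by rewrite mul0r.
have [P PE] := hyperplane_curvature_poly T X (kerp u) (kerp v) (kerp w).
have X1 c : (X c).[1] = x c by rewrite XE mulr1 addrC subrK.
have kerp1 u' : \sum_c u' c * x c = 0 -> (fun b => (kerp u' b).[1]) = fun b => x c0 * u' b.
  move=> ux'; apply/funext => b; rewrite kerpE; under eq_bigr => c _ do rewrite X1.
  by rewrite ux' X1 mul0r subr0.
suff P0 : P = 0.
  have := PE 1; rewrite P0 horner0 !kerp1 //.
  rewrite (_ : (fun c => (X c).[1]) = fun c => 1 * x c); last first.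
    by apply/funext => c; rewrite X1 mul1r.
  rewrite hyperplane_curvatureZ => /esym /eqP.
  by rewrite !mulf_eq0 oner_eq0 (negbTE xc0) => /eqP.
pose y := iy n; pose s t := 1 - (1 + x y) * t.
have Xy t : (X y).[t] = - s t by rewrite XE xi_y /s; ring.
pose C : R := 1 + abs (1 + x y) + \sum_i abs (x (ix i) + x y * p0 0 i).
have C_ge i : abs (x (ix i) + x y * p0 0 i) <= C.
  rewrite /C (bigD1 i) //= addrCA lerDl addr_ge0 ?sumr_ge0 // => [|j _]; last exact: nrm_ge0.
  by rewrite addr_ge0 // nrm_ge0.
have C_ge' : abs (1 + x y) <= C.
  rewrite /C addrAC addrC lerDl addr_ge0 // sumr_ge0 // => j _; exact: nrm_ge0.
have C1 : 1 <= C.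
  by rewrite /C -addrA lerDl addr_ge0 ?nrm_ge0 // sumr_ge0 // => j _; exact: nrm_ge0.
have C0 : 0 < C by apply: lt_le_trans C1.
pose d := Num.min 1 r / (2 * C).
have d0 : 0 < d by rewrite divr_gt0 ?mulr_gt0 // lt_min ltr01.
apply: (poly_eq0_small d0) => t td; rewrite PE.
have dC1 : d * C <= 2^-1.
  rewrite /d invfM mulrA divfK ?gt_eqF // ler_pdivrMr // mulVf // ge_min.
  by rewrite lexx.
have dC2 : d * C <= r / 2.
  rewrite /d invfM mulrA divfK ?gt_eqF // ler_wpM2r ?invr_ge0 // ge_min lexx orbT //.
have st : 2^-1 < abs (s t).
  have E : (1 : K) = s t + (1 + x y) * t by rewrite /s subrK.
  have := nrmD V (s t) ((1 + x y) * t); rewrite -E nrm1 nrmM.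
  have : abs (1 + x y) * abs t < C * d.
    have := nrm_ge0 V t; nra.
  lra.
have s0 : s t != 0 by rewrite -(nrm_gt0 V); lra.
pose p : 'rV[K]_n := \row_i ((X (ix i)).[t] / s t).
have Xp : (fun c => (X c).[t]) = fun c => s t * xi p c.
  apply/funext; elim/jet_ind => [i|]; last by rewrite xi_y mulrN1 -Xy.
  by rewrite xi_x mxE mulrC divfK.
have inker u' : \sum_c (kerp u' c).[t] * xi p c = 0.
  have := kerp_ker u' t.
  rewrite (eq_bigr (fun c => s t * ((kerp u' c).[t] * xi p c))) => [|c _]; last first.
    by rewrite [(X c).[t]](congr1 (fun f => f c) Xp) mulrCA.
  by rewrite -mulr_sumr => /eqP; rewrite mulf_eq0 (negbTE s0) => /eqP.
rewrite Xp -[RHS](mulr0 (s t * (1 * (1 * (1 * 1))))).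
rewrite -[X in _ = _ * X](HT p _ _ _ _ (inker u) (inker v) (inker w)).
  rewrite -hyperplane_curvatureZ; congr (hyperplane_curvature _ _ _ _ _);
  by apply/funext => c; rewrite mul1r.
move=> i; rewrite mxE XE xi_x.
have -> : (p0 0 i + (x (ix i) - p0 0 i) * t) / s t - p0 0 i =
    (x (ix i) + x y * p0 0 i) * t / s t.
  apply: (mulIf s0); rewrite mulrBl !divfK // /s; ring.
rewrite !nrmM nrmV ltr_pdivrMr; last by lra.
have := C_ge i; have := nrm_ge0 V t.
have := nrm_ge0 V (x (ix i) + x y * p0 0 i); nra.
Qed.

(** * Integrability and the curvature of the connection *)

Section Integrability.
Variable n : nat.
Local Notation J0 := ('rV[K]_n * K)%type.
Local Notation J1 := ('rV[K]_n * K * 'rV[K]_n)%type.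
Local Notation ro := (@row_of_J0 K n).
Local Notation jo := (@J0_of_row K n).
Local Notation y := (iy n).
Variables (Pi : 'I_(n + 1) -> 'I_(n + 1) -> 'I_(n + 1) -> 'rV[K]_(n + 1) -> K).
Hypothesis Pi_sym : forall a b c, Pi a b c = Pi b a c.

Local Notation form w := (fun a b => \sum_c xi w.2 c * Pi a b c (ro w.1)).

Lemma hess_sym w i j : hess w (form w) i j = hess w (form w) j i.
Proof.
rewrite /hess exchange_big; apply: eq_bigr => a _; apply: eq_bigr => b _.
rewrite (mulrC (evec w.2 i b)); congr (_ * _).
by apply: eq_bigr => c _; rewrite Pi_sym.
Qed.

(** The vectors [evec p l] and [d_y] span, the coefficient of the latter being
    read off with [xi p]. *)
Lemma evec_span p (x : 'I_(n + 1) -> K) b :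
  \sum_l x (ix l) * evec p l b = x b + (\sum_c xi p c * x c) * (b == y)%:R.
Proof.
rewrite xi_sum; elim/jet_ind: b => [k|].
  rewrite ix_iy mulr0 addr0 (bigD1 k) //= evec_x eqxx mulr1 big1 ?addr0 // => l lk.
  by rewrite evec_x eq_sym (negbTE lk) mulr0.
rewrite eqxx mulr1 addrC subrK; apply: eq_bigr => l _.
by rewrite evec_y mulrC.
Qed.

Lemma sum_y (F : 'I_(n + 1) -> K) : \sum_a (a == y)%:R * F a = F y.
Proof.
rewrite (bigD1 y) //= eqxx mul1r big1 ?addr0 // => a /negbTE ->.
by rewrite mul0r.
Qed.

Section AtJet.
Variable w : J1.
Local Notation z := (ro w.1).
Local Notation e := (evec w.2).
Hypothesis Pi_ana : forall a b c, ana (Pi a b c) z.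

Lemma D1_form r k a b : D1 (fun w => form w a b) r k w =
  \sum_l r k l * Pi a b (ix l) z + \sum_c xi w.2 c * \sum_d e k d * pd d (Pi a b c) z.
Proof.
have Ps c : smooth1 (fun w => Pi a b c (ro w.1)) w by apply: smooth1_base.
have xs c : smooth1 (fun w : J1 => xi w.2 c) w by apply: smooth1_xi.
have S c := smooth1M (xs c) (Ps c).
rewrite (D1_sum _ _ _ S).
under eq_bigr => c _ do rewrite (D1M r k (xs c) (Ps c)) D1_base // D1_xi mulr_suml.
rewrite big_split exchange_big /=; congr (_ + _); apply: eq_bigr => l _.
rewrite (bigD1 (ix l)) //= eqxx mul1r big1 ?addr0 // => c /negbTE ->.
by rewrite !mul0r.
Qed.

Lemma smooth1_form a b : smooth1 (fun w => form w a b) w.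
Proof. by apply: smooth1_sum => c; apply: smooth1M; [exact: smooth1_xi|exact: smooth1_base]. Qed.

(** The derivative falls on the two vectors [evec], which turn in the direction
    of [y]; on the conormal; and on the connection. *)
Lemma D1_hess r k i j : D1 (fun w => hess w (form w) i j) r k w =
  r k i * \sum_b e j b * form w y b + r k j * \sum_a e i a * form w a y
  + \sum_l r k l * hess w (fun a b => Pi a b (ix l) z) i j
  + hess w (fun a b => \sum_c xi w.2 c * \sum_d e k d * pd d (Pi a b c) z) i j.
Proof.
have es l a : smooth1 (fun w : J1 => evec w.2 l a) w by apply: smooth1_evec.
have ees a b := smooth1M (es i a) (es j b).
have Ss a b := smooth1M (ees a b) (@smooth1_form a b).
have Ts a : smooth1 (fun w => \sum_b evec w.2 i a * evec w.2 j b * form w a b) w.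
  by apply: smooth1_sum; apply: Ss.
rewrite /hess (D1_sum r k _ Ts).
under eq_bigr => a _.
  rewrite (D1_sum r k _ (Ss a)).
  under eq_bigr => b _ do rewrite (D1M r k (ees a b) (@smooth1_form a b)) (D1M r k (es i a) (es j b))
    !D1_evec D1_form.
  over.
have dist (d1 d2 r1 r2 e1 e2 s x1 x2 : K) :
    (d1 * r1 * e2 + e1 * (d2 * r2)) * s + e1 * e2 * (x1 + x2) =
    d1 * (r1 * (e2 * s)) + d2 * (r2 * (e1 * s)) + e1 * e2 * x1 + e1 * e2 * x2 by ring.
under eq_bigr => a _ do (under eq_bigr => b _ do rewrite dist; rewrite !big_split /=).
rewrite !big_split /=; congr (_ + _ + _ + _).
- under eq_bigr => a _ do rewrite -mulr_sumr.
  by rewrite sum_y mulr_sumr.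
- by under eq_bigr => a _ do rewrite sum_y; rewrite mulr_sumr.
- under eq_bigr => a _ do (under eq_bigr => b _ do rewrite mulr_sumr; rewrite exchange_big /=).
  rewrite exchange_big /=; apply: eq_bigr => l _; rewrite mulr_sumr; apply: eq_bigr => a _.
  by rewrite mulr_sumr; apply: eq_bigr => b _; rewrite mulrCA.
Qed.

(** The second derivatives [r k l] are the values of a form on the vectors [evec
    p l]; by [evec_span] their contraction with [x] is the value of the form on
    [x] itself, up to a multiple of its value on [d_y]. *)
Lemma hess_extend S k (x : 'I_(n + 1) -> K) : \sum_l hess w S k l * x (ix l) =
  \sum_a \sum_b e k a * x b * S a b + (\sum_c xi w.2 c * x c) * \sum_a e k a * S a y.
Proof.
rewrite /hess; under eq_bigr => l _ do (rewrite mulr_suml;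
  under eq_bigr => a _ do rewrite mulr_suml).
rewrite exchange_big /= [X in _ + X]mulr_sumr -big_split; apply: eq_bigr => a _ /=.
rewrite exchange_big /=.
have E b : \sum_l e k a * e l b * S a b * x (ix l) =
    e k a * x b * S a b + (\sum_c xi w.2 c * x c) * ((b == y)%:R * (e k a * S a b)).
  have -> : \sum_l e k a * e l b * S a b * x (ix l) =
      e k a * S a b * \sum_l x (ix l) * e l b.
    by rewrite mulr_sumr; apply: eq_bigr => l _; ring.
  rewrite evec_span; ring.
by under eq_bigr => b _ do rewrite E; rewrite big_split -mulr_sumr sum_y.
Qed.

Lemma exchange_sumr (I J : finType) (f : I -> K) (g : J -> K) (X : I -> J -> K) :
  \sum_i f i * \sum_j g j * X i j = \sum_j g j * \sum_i f i * X i j.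
Proof.
under eq_bigr => i _ do rewrite mulr_sumr.
rewrite exchange_big; apply: eq_bigr => j _; rewrite mulr_sumr; apply: eq_bigr => i _.
exact: mulrCA.
Qed.

(** One of the two halves, exchanged by [d] and [a], whose difference is the
    curvature. *)
Definition half_curvature c b d a : K :=
  pd d (Pi a b c) z + \sum_f Pi a b f z * Pi d f c z.

Lemma hyperplane_curvature_half x u v u' :
  hyperplane_curvature (curvature Pi z) x u v u' =
  hyperplane_curvature half_curvature x u v u' - hyperplane_curvature half_curvature x u u' v.
Proof.
rewrite /hyperplane_curvature -sumrB; apply: eq_bigr => c _; rewrite -mulrBr; congr (_ * _).
rewrite -sumrB; apply: eq_bigr => b _; rewrite -mulrBr; congr (_ * _).
rewrite [X in _ - X]exchange_sumr -sumrB; apply: eq_bigr => d _; rewrite -mulrBr; congr (_ * _).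
rewrite -sumrB; apply: eq_bigr => a _; rewrite -mulrBr; congr (_ * _).
by rewrite /curvature /half_curvature sumrB opprD addrACA.
Qed.

Lemma hyperplane_half_curvature i j k :
  hyperplane_curvature half_curvature (xi w.2) (e i) (e k) (e j) =
  hess w (fun a b => \sum_c xi w.2 c * \sum_d e k d * pd d (Pi a b c) z) i j +
  \sum_a \sum_b e k a * hess w (fun a' b' => Pi a' b' b z) i j * form w a b.
Proof.
have Pf a b : Pi a b = Pi b a by apply/funext => c; apply: Pi_sym.
rewrite /hyperplane_curvature exchange_sumr.
have E b : \sum_c xi w.2 c * (\sum_d e k d * \sum_a e j a * half_curvature c b d a) =
    \sum_a e j a * (\sum_c xi w.2 c * \sum_d e k d * pd d (Pi a b c) z +
      \sum_f Pi a b f z * \sum_d e k d * form w d f).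
  under eq_bigr => c _ do rewrite exchange_sumr.
  rewrite exchange_sumr; apply: eq_bigr => a _; congr (_ * _).
  under eq_bigr => c _ do under eq_bigr => d _ do rewrite mulrDr.
  under eq_bigr => c _ do rewrite big_split /= mulrDr.
  rewrite big_split; congr (_ + _) => /=.
  under eq_bigr => c _ do rewrite exchange_sumr.
  rewrite exchange_sumr; apply: eq_bigr => f _; congr (_ * _).
  by rewrite exchange_sumr.
under eq_bigr => b _ do rewrite E mulr_sumr.
rewrite /hess.
have D b a (p q : K) : e i b * (e j a * (p + q)) = e i b * e j a * p + e i b * e j a * q by ring.
under eq_bigr => b _ do (under eq_bigr => a _ do rewrite D; rewrite big_split).
rewrite big_split /=; congr (_ + _).
  by apply: eq_bigr => b _; apply: eq_bigr => a _; rewrite (Pf a b).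
rewrite [RHS]exchange_big /=.
under [RHS]eq_bigr => f _ do (under eq_bigr => d _ do rewrite mulrAC mulrC; rewrite -mulr_sumr).
have D' f (Y : K) : (\sum_a \sum_b e i a * e j b * Pi a b f z) * Y =
    \sum_a \sum_b e i a * e j b * (Pi b a f z * Y).
  rewrite mulr_suml; apply: eq_bigr => a _; rewrite mulr_suml; apply: eq_bigr => b _.
  by rewrite mulrA Pi_sym.
under [RHS]eq_bigr => f _ do rewrite D'.
rewrite [RHS]exchange_big; apply: eq_bigr => b _; rewrite [RHS]exchange_big.
by apply: eq_bigr => a _ /=; rewrite [LHS]mulr_sumr.
Qed.

(** The contributions of the derivatives of [evec], together with the correction
    term of [hess_extend], are symmetric in [j] and [k]; what remains of the
    difference is the curvature, restricted to the hyperplane [dy = p dx]. *)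
Lemma D1_hess_curvature i j k (r := \matrix_(i, j) hess w (form w) i j) :
  D1 (fun w => hess w (form w) i j) r k w - D1 (fun w => hess w (form w) i k) r j w =
  hyperplane_curvature (curvature Pi z) (xi w.2) (e i) (e k) (e j).
Proof.
rewrite hyperplane_curvature_half !hyperplane_half_curvature !D1_hess /r.
have ext i' j' k' : \sum_l (\matrix_(i, j) hess w (form w) i j) k' l *
     hess w (fun a b => Pi a b (ix l) z) i' j' =
   \sum_a \sum_b e k' a * hess w (fun a' b' => Pi a' b' b z) i' j' * form w a b +
   hess w (form w) i' j' * \sum_a e k' a * form w a y.
  under eq_bigr => l _ do rewrite mxE.
  rewrite (hess_extend (form w) k' (fun c => hess w (fun a b => Pi a b c z) i' j')).
  congr (_ + _ * _); rewrite /hess.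
  under eq_bigr => c _ do rewrite mulr_sumr.
  rewrite exchange_big; apply: eq_bigr => a _.
  under eq_bigr => c _ do rewrite mulr_sumr.
  rewrite exchange_big; apply: eq_bigr => b _; rewrite mulr_sumr.
  by apply: eq_bigr => c _; rewrite mulrCA.
rewrite !ext ![(\matrix_(_, _) _) _ _]mxE [hess w _ k j]hess_sym [hess w _ k i]hess_sym
  [hess w _ j i]hess_sym.
have Ey l : \sum_b e l b * form w y b = \sum_b e l b * form w b y.
  by apply: eq_bigr => b _; congr (_ * _); apply: eq_bigr => c _; rewrite Pi_sym.
rewrite (Ey j) (Ey k).
have fin (rik rij rjk A B C u1 u2 v1 v2 : K) :
  rik * A + rjk * B + (u1 + rij * C) + v1 - (rij * C + rjk * B + (u2 + rik * A) + v2) =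
  v1 + u1 - (v2 + u2) by ring.
exact: fin.
Qed.

End AtJet.
End Integrability.

Section IntegrableFlat.
Variable n : nat.
Local Notation J1 := ('rV[K]_n * K * 'rV[K]_n)%type.
Local Notation ro := (@row_of_J0 K n).
Local Notation jo := (@J0_of_row K n).

Lemma sum_evec_eq0 (p : 'rV[K]_n) (u G : 'I_(n + 1) -> K) : \sum_c u c * xi p c = 0 ->
  (forall l, \sum_b evec p l b * G b = 0) -> \sum_b u b * G b = 0.
Proof.
move=> ux0 G0; have uE b : u b = \sum_l u (ix l) * evec p l b.
  rewrite evec_span; under eq_bigr => c _ do rewrite mulrC.
  by rewrite ux0 mul0r addr0.
under eq_bigr => b _ do rewrite uE mulr_suml.
rewrite exchange_big big1 // => l _ /=; under eq_bigr => b _ do rewrite -mulrA.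
by rewrite -mulr_sumr G0 mulr0.
Qed.

Lemma hyperplane_curvature_evec T (p : 'rV[K]_n) :
    (forall i j k, hyperplane_curvature T (xi p) (evec p i) (evec p j) (evec p k) = 0) ->
  forall u v w, \sum_c u c * xi p c = 0 -> \sum_c v c * xi p c = 0 ->
    \sum_c w c * xi p c = 0 -> hyperplane_curvature T (xi p) u v w = 0.
Proof.
move=> T0 u v w ux vx wx.
have E1 u' v' w' : hyperplane_curvature T (xi p) u' v' w' =
    \sum_b u' b * \sum_c xi p c * \sum_d v' d * \sum_a w' a * T c b d a.
  exact: exchange_sumr.
have E2 u' v' w' : hyperplane_curvature T (xi p) u' v' w' =
    \sum_d v' d * \sum_c xi p c * \sum_b u' b * \sum_a w' a * T c b d a.
  rewrite [RHS]exchange_sumr; apply: eq_bigr => c _; congr (_ * _); exact: exchange_sumr.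
have E3 u' v' w' : hyperplane_curvature T (xi p) u' v' w' =
    \sum_a w' a * \sum_c xi p c * \sum_b u' b * \sum_d v' d * T c b d a.
  rewrite [RHS]exchange_sumr; apply: eq_bigr => c _; congr (_ * _).
  rewrite [RHS]exchange_sumr; apply: eq_bigr => b _; congr (_ * _).
  exact: exchange_sumr.
rewrite E1; apply: (sum_evec_eq0 ux) => i; rewrite -E1.
rewrite E2; apply: (sum_evec_eq0 vx) => j; rewrite -E2.
by rewrite E3; apply: (sum_evec_eq0 wx) => k; rewrite -E3.
Qed.

Variables (Pi : 'I_(n + 1) -> 'I_(n + 1) -> 'I_(n + 1) -> 'rV[K]_(n + 1) -> K) (w0 : J1).
Variable F : 'I_n -> 'I_n -> J1 -> K.
Hypothesis Pi_sym : forall a b c, Pi a b c = Pi b a c.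
Hypothesis Pi_ana : forall a b c, ana (Pi a b c) (ro w0.1).
Hypothesis FE : \forall w \near w0, forall i j,
  F i j w = hess w (fun a b => \sum_c xi w.2 c * Pi a b c (ro w.1)) i j.

(** The first-order jets near [w0] give all hyperplanes close to the one of [w0]
    at every point close to its base point; the other hyperplanes follow by
    [hyperplane_curvature_eq0]. *)
Lemma integrable_curvature : completely_integrable F w0 ->
  \forall z \near ro w0.1, forall x u v w : 'I_(n + 1) -> K,
    \sum_c u c * x c = 0 -> \sum_c v c * x c = 0 -> \sum_c w c * x c = 0 ->
    hyperplane_curvature (curvature Pi z) x u v w = 0.
Proof.
move=> Fint.
have Pn : \forall w \near w0, forall a b c, ana (Pi a b c) (ro w.1).
  exact: (@near_J1_base n w0 (fun v => forall a b c, ana (Pi a b c) v) (Pi_near Pi_ana)).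
have FEn := near_near FE.
have : \forall w \near w0, forall i j k, hyperplane_curvature (curvature Pi (ro w.1))
    (xi w.2) (evec w.2 i) (evec w.2 j) (evec w.2 k) = 0.
  near=> w => i k j.
  have Pw : forall a b c, ana (Pi a b c) (ro w.1) by near: w.
  have FEw : \forall w \near w, forall i j,
    F i j w = hess w (fun a b => \sum_c xi w.2 c * Pi a b c (ro w.1)) i j by near: w.
  have Fw : forall i j k, D1 (F i j) (rhs F w) k w = D1 (F i k) (rhs F w) j w by near: w.
  rewrite -D1_hess_curvature //.
  have rE : rhs F w = \matrix_(i, j) hess w (fun a b => \sum_c xi w.2 c * Pi a b c (ro w.1)) i j.
    by apply/matrixP => i' j'; rewrite !mxE (nbhs_singleton FEw).
  have DE i' j' k' : D1 (F i' j') (rhs F w) k' w =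
      D1 (fun w => hess w (fun a b => \sum_c xi w.2 c * Pi a b c (ro w.1)) i' j') (rhs F w) k' w.
    by apply: D1_eq; apply: filterS FEw => t Ft; apply: Ft.
  by rewrite -rE -!DE Fw subrr.
move=> /nbhs_J1P[r r0 Hr]; apply/nbhs_rowP; exists r => // h hr.
apply: (hyperplane_curvature_eq0 r0) => p pr.
apply: hyperplane_curvature_evec => i j k.
have := Hr (jo (ro w0.1 + h), p) _ _ pr i j k; rewrite /= ro_jo; apply.
  by move=> l; rewrite jo_x [X in abs (X - _)]mxE ro_x addrAC subrr add0r.
by rewrite -[rsubmx _ 0 0]/((jo _).2) jo_y [X in abs (X - _)]mxE ro_y addrAC subrr add0r.
Unshelve. all: by end_near.
Qed.

End IntegrableFlat.

(** * Integrable cubic systems are flat *)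

Section CubicIsFlat.
Variable n : nat.
Local Notation J0 := ('rV[K]_n * K)%type.
Local Notation J1 := ('rV[K]_n * K * 'rV[K]_n)%type.
Local Notation ro := (@row_of_J0 K n).
Local Notation jo := (@J0_of_row K n).
Local Notation y := (iy n).

Lemma analytic_map_comp (phi : J0 -> J0) z :
  analytic_map_J0 phi z <-> forall A, ana (comp phi A) (ro z).
Proof.
rewrite /analytic_map_J0 /analytic_J0 comp_y; split=> [[Hx Hy]|H].
  elim/jet_ind => [k|]; last exact: analytic_ana.
  by apply: analytic_ana; rewrite -comp_x.
by split=> [k|]; [rewrite comp_x|]; apply: ana_analytic.
Qed.

Lemma sum_delta_eq (I : finType) (a : I) (G : I -> K) : \sum_c (a == c)%:R * G c = G a.
Proof.
rewrite (bigD1 a) //= eqxx mul1r big1 ?addr0 // => c; rewrite eq_sym => /negbTE ->.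
by rewrite mul0r.
Qed.

(** Projectively equivalent connections have the same totally geodesic
    hypersurfaces, since [xi] annihilates the vectors [evec]. *)
Lemma hess_projective w (Gam Gam' : 'I_(n + 1) -> 'I_(n + 1) -> 'I_(n + 1) -> K) u i j :
    (forall a b c, Gam' a b c = Gam a b c + (a == c)%:R * u b + (b == c)%:R * u a) ->
  hess w (fun a b => \sum_c xi w.2 c * Gam' a b c) i j =
  hess w (fun a b => \sum_c xi w.2 c * Gam a b c) i j.
Proof.
move=> GE.
have del a (t : K) : \sum_c xi w.2 c * ((a == c)%:R * t) = xi w.2 a * t.
  by rewrite -[RHS](sum_delta_eq a (fun c => xi w.2 c * t)); apply: eq_bigr => c _; ring.
have E a b : \sum_c xi w.2 c * Gam' a b c =
    \sum_c xi w.2 c * Gam a b c + (xi w.2 a * u b + xi w.2 b * u a).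
  under eq_bigr => c _ do rewrite GE !mulrDr.
  by rewrite !big_split /= !del addrA.
rewrite /hess; under eq_bigr => a _ do (under eq_bigr => b _ do
  rewrite E mulrDr mulrDr; rewrite !big_split /=).
rewrite !big_split /=.
have -> : \sum_a \sum_b evec w.2 i a * evec w.2 j b * (xi w.2 b * u a) = 0.
  rewrite big1 // => a _.
  rewrite (eq_bigr (fun b => evec w.2 i a * u a * (evec w.2 j b * xi w.2 b))).
    by rewrite -mulr_sumr xi_evec mulr0.
  by move=> b _; ring.
have -> : \sum_a \sum_b evec w.2 i a * evec w.2 j b * (xi w.2 a * u b) = 0.
  rewrite exchange_big big1 // => b _ /=.
  rewrite (eq_bigr (fun a => evec w.2 j b * u b * (evec w.2 i a * xi w.2 a))).
    by rewrite -mulr_sumr xi_evec mulr0.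
  by move=> a _; ring.
by rewrite !addr0.
Qed.

(** The total Jacobian is the identity at [w0] and depends continuously on the
    jet. *)
Lemma near_total_jacobian_unit (phi : J0 -> J0) (w0 : J1) :
    (forall A, ana (comp phi A) (ro w0.1)) ->
    (forall A b, pd b (comp phi A) (ro w0.1) = (A == b)%:R) ->
  \forall w \near w0, total_jacobian phi w \in unitmx.
Proof.
move=> Pa dP; pose cont (f : J1 -> K) := f w @[w --> w0] --> f w0.
have contE f : (forall d : R, 0 < d -> \forall w \near w0, abs (f w0 - f w) < d) -> cont f.
  move=> Hf; apply/cvgrPdist_lt => _ /(gt0_emb V)[d d0 ->].
  by apply: filterS (Hf _ d0) => w; rewrite lt_norm_emb.
have contc c : cont (fun=> c) by apply: cvg_cst.
have contD f g : cont f -> cont g -> cont (fun w => f w + g w) by apply: cvgD.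
have contM f g : cont f -> cont g -> cont (fun w => f w * g w) by apply: cvgM.
have conte i a : cont (fun w => evec w.2 i a).
  elim/jet_ind: a => [k|].
    by rewrite (_ : (fun w => _) = fun=> (k == i)%:R) //; apply/funext => w; rewrite evec_x.
  rewrite (_ : (fun w => _) = fun w : J1 => w.2 0 i); last by apply/funext => w; rewrite evec_y.
  apply: contE => d d0; apply/nbhs_J1P; exists d => // w _ _ wp.
  by rewrite nrmB.
have contb g : ana g (ro w0.1) -> cont (fun w => g (ro w.1)).
  move=> /ana_continuous/cvgrPdist_lt gc; apply/cvgrPdist_lt => d d0.
  exact: (@near_J1_base n w0 (fun v => `|g (ro w0.1) - g v| < d) (gc _ d0)).
have contJ i k : cont (fun w => total_jacobian phi w i k).
  rewrite (_ : (fun w => _) =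
    fun w => \sum_a evec w.2 i a * pd a (comp phi (ix k)) (ro w.1)); last first.
    by apply/funext => w; rewrite jacobianE.
  apply: (closed_sum contc contD) => a; apply: contM => //.
  by apply: contb; apply: ana_pd.
have : cont (fun w => \det (total_jacobian phi w)).
  exact: (closed_det contc contD contM).
have J1 : total_jacobian phi w0 = 1%:M.
  apply/matrixP => i k; rewrite jacobianE mxE (bigD1 (ix k)) //= dP eqxx mulr1.
  rewrite evec_x eq_sym big1 ?addr0 // => a; rewrite dP eq_sym => /negbTE ->.
  by rewrite mulr0.
rewrite /cont J1 det1 => /cvgrPdist_lt/(_ 1 ltr01); apply: filterS => w.
by rewrite unitmxE unitfE; apply: contraTneq => ->; rewrite subr0 normr1 ltxx.
Qed.

(** The conormal has [y]-component [1], and an invertible Jacobian does not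
    annihilate it. *)
Lemma pullback_neq0 (phi : J0 -> J0) w : total_jacobian phi w \in unitmx ->
  \matrix_(a, A) pd a (comp phi A) (ro w.1) \in unitmx -> pullback phi w y != 0.
Proof.
move=> Tu Ju; apply/eqP => py0.
pose nu : 'cV[K]_(n + 1) := \col_A conormal phi w A.
have : nu = 0.
  rewrite -[nu](mulKmx Ju) (_ : _ *m nu = 0) ?mulmx0 //.
  apply/colP => a; rewrite !mxE; under eq_bigr => A _ do rewrite !mxE mulrC.
  by rewrite -/(pullback phi w a) pullbackE // py0 oppr0 mul0r.
by move/colP/(_ y); rewrite !mxE conormal_y => /eqP; rewrite oner_eq0.
Qed.

Variables (Gam : 'I_(n + 1) -> 'I_(n + 1) -> 'I_(n + 1) -> 'rV[K]_(n + 1) -> K) (w0 : J1).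
Variable F : 'I_n -> 'I_n -> J1 -> K.
Hypothesis n2 : (2 <= n)%N.
Hypothesis Gam_sym : forall a b c, Gam a b c = Gam b a c.
Hypothesis Gam_ana : forall a b c, ana (Gam a b c) (ro w0.1).
Hypothesis FE : \forall w \near w0, forall i j,
  F i j w = hess w (fun a b => \sum_c xi w.2 c * Gam a b c (ro w.1)) i j.

(** Thomas' trace-free representative of a projective class; [n + 2] is the
    dimension plus one. *)
Definition thomas a b c z : K := Gam a b c z
  - (n.+2%:R)^-1 * ((a == c)%:R * \sum_d Gam b d d z + (b == c)%:R * \sum_d Gam a d d z).

Lemma ana_thomas a b c : ana (thomas a b c) (ro w0.1).
Proof.
apply: anaB => //; apply: anaZ; apply: anaD; apply: anaZ; exact: ana_sum.
Qed.

Lemma thomas_sym a b c : thomas a b c = thomas b a c.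
Proof.
by apply/funext => z; rewrite /thomas Gam_sym [X in _ - _ * X]addrC.
Qed.

Lemma thomas_trace a z : \sum_c thomas a c c z = 0.
Proof.
rewrite sumrB -mulr_sumr big_split /=.
rewrite (sum_delta_eq a (fun c => \sum_d Gam c d d z)).
under [X in _ * (_ + X)]eq_bigr => c _ do rewrite eqxx mul1r.
set S := \sum_d Gam a d d z; rewrite sumr_const card_ord -[S *+ _]mulr_natl.
have -> : S + (n + 1)%:R * S = n.+2%:R * S by rewrite -{1}[S]mul1r -mulrDl addn1 nat1r.
by rewrite mulKf ?subrr // pnatr_eq0.
Qed.

Lemma hess_thomas w i j :
  hess w (fun a b => \sum_c xi w.2 c * thomas a b c (ro w.1)) i j =
  hess w (fun a b => \sum_c xi w.2 c * Gam a b c (ro w.1)) i j.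
Proof.
apply: (@hess_projective _ _ _ (fun a => - (n.+2%:R)^-1 * \sum_d Gam a d d (ro w.1))).
move=> a b c; rewrite /thomas.
set s := \sum_d _; set t := \sum_d _; set m := _^-1; clearbody s t m.
by ring.
Qed.

(** The transformation is given by the projective coordinates of the trace-free
    connection. In these the second derivatives are expressed by a connection
    that is projectively equivalent to that of the system. *)
Lemma integrable_cubic_flat : completely_integrable F w0 -> equivalent_to_flat F w0.
Proof.
have FE' : \forall w \near w0, forall i j,
    F i j w = hess w (fun a b => \sum_c xi w.2 c * thomas a b c (ro w.1)) i j.
  by apply: filterS FE => w Fw i j; rewrite Fw hess_thomas.
move=> /(integrable_curvature thomas_sym ana_thomas FE').
have N3 : (2 < n + 1)%N by rewrite addn1.
move=> /(projective_coordinates N3 ana_thomas thomas_sym thomas_trace)[Phi [ups [Pa dP ddP]]].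
have [Psi [Qa PsiPhi PhiPsi]] := local_inverse Pa (fun A b => dP A b).
pose phi z := jo (Phi (ro z)); pose psi z := jo (Psi (ro z)).
have phiE A : comp phi A = fun v => Phi v 0 A by apply/funext => v; rewrite /comp /phi !ro_jo.
have psiE A : comp psi A = fun v => Psi v 0 A by apply/funext => v; rewrite /comp /psi !ro_jo.
exists phi; split.
  split; first by apply/analytic_map_comp => A; rewrite phiE.
  exists psi; split.
  - by apply/analytic_map_comp => A; rewrite psiE /phi ro_jo.
  - apply/near_J0; apply: filterS PsiPhi => v; rewrite /psi /phi !ro_jo.
    by move=> ->.
  - apply/near_J0; rewrite {1}/phi ro_jo; apply: filterS PhiPsi => v.
    by rewrite /psi /phi !ro_jo => ->.
have Pa' A : ana (comp phi A) (ro w0.1) by rewrite phiE.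
have dP' A b : pd b (comp phi A) (ro w0.1) = (A == b)%:R by rewrite phiE.
have Tn := near_total_jacobian_unit Pa' dP'; have Tnn := near_near Tn.
have Pn : \forall w \near w0, forall A, ana (comp phi A) (ro w.1).
  apply: (@near_J1_base n w0 (fun v => forall A, ana (comp phi A) v)).
  by apply: near_forall => A; exact: ana_near.
pose J v := \matrix_(a, A) pd a (comp phi A) v.
have Ja a A : ana (fun v => J v a A) (ro w0.1).
  by under eq_fun do rewrite mxE; apply: ana_pd.
have J0 : J (ro w0.1) = 1%:M by apply/matrixP => a A; rewrite !mxE dP' eq_sym.
have Jn : \forall w \near w0, J (ro w.1) \in unitmx.
  apply: (@near_J1_base n w0 (fun v => J v \in unitmx)).
  have detJ : ana (fun v => \det (J v)) (ro w0.1) by apply: ana_det.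
  have detJ0 : \det (J (ro w0.1)) != 0 by rewrite J0 det1 oner_neq0.
  by apply: filterS (near_ana_neq0 detJ detJ0) => v; rewrite unitmxE unitfE.
have {}ddP := @near_J1_base n w0 _ ddP.
near=> w.
have Tw : total_jacobian phi w \in unitmx by near: w.
split=> // r _.
have Tu : \forall t \near w, total_jacobian phi t \in unitmx by near: w.
have Pw : forall A, ana (comp phi A) (ro w.1) by near: w.
have Pw' A b : ana (pd b (comp phi A)) (ro w.1) by apply: ana_pd.
have Jw : J (ro w.1) \in unitmx by near: w.
have py0 := pullback_neq0 Tw Jw.
have ddPw : forall A a b, pd a (pd b (fun z => Phi z 0 A)) (ro w.1) =
        \sum_c (thomas a b c (ro w.1) + (a == c)%:R * ups b (ro w.1)
          + (b == c)%:R * ups a (ro w.1)) * pd c (fun z => Phi z 0 A) (ro w.1) by near: w.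
pose Del a b c := thomas a b c (ro w.1) + (a == c)%:R * ups b (ro w.1)
          + (b == c)%:R * ups a (ro w.1).
have DelE a b A : pd a (pd b (comp phi A)) (ro w.1) =
    \sum_c Del a b c * pd c (comp phi A) (ro w.1) by rewrite phiE ddPw.
have Fw : forall i j,
    F i j w = hess w (fun a b => \sum_c xi w.2 c * thomas a b c (ro w.1)) i j by near: w.
have FD i j : F i j w = hess w (fun a b => \sum_c xi w.2 c * Del a b c) i j.
  by rewrite Fw; apply/esym/(@hess_projective _ _ _ (fun a => ups a (ro w.1))).
rewrite (prolong2_eq0_connection r Pw' Tu DelE py0); split=> [rE|-> i j].
  by apply/matrixP => i j; rewrite mxE FD rE.
by rewrite mxE FD.
Unshelve. all: by end_near.
Qed.

End CubicIsFlat.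

(** * The coefficients of a cubic system *)

Section Coefficients.
Variable n : nat.
Local Notation J0 := ('rV[K]_n * K)%type.
Local Notation J1 := ('rV[K]_n * K * 'rV[K]_n)%type.
Local Notation ro := (@row_of_J0 K n).
Local Notation jo := (@J0_of_row K n).
Local Notation y := (iy n).
Variables (F : 'I_n -> 'I_n -> J1 -> K) (w0 : J1).

Definition cubic_system : Prop :=
  exists (G : 'I_n -> 'I_n -> J0 -> K) (H : 'I_n -> 'I_n -> 'I_n -> J0 -> K)
         (L : 'I_n -> 'I_n -> J0 -> K) (M : 'I_n -> J0 -> K),
    [/\ [/\ forall j1 j2 : 'I_n, analytic_J0 (G j1 j2) w0.1,
            forall j1 j2 k1 : 'I_n, analytic_J0 (H j1 j2 k1) w0.1,
            forall j1 k1 : 'I_n, analytic_J0 (L j1 k1) w0.1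
          & forall k1 : 'I_n, analytic_J0 (M k1) w0.1],
        forall j1 j2 : 'I_n, \forall z \near w0.1, G j1 j2 z = G j2 j1 z,
        forall j1 j2 k1 : 'I_n,
          \forall z \near w0.1, H j1 j2 k1 z = H j2 j1 k1 z
      & forall j1 j2 : 'I_n, \forall w \near w0,
          F j1 j2 w =
            G j1 j2 w.1
            + \sum_(k1 < n) w.2 0 k1 *
                (H j1 j2 k1 w.1
                 + 2^-1 * w.2 0 j1 * L j2 k1 w.1
                 + 2^-1 * w.2 0 j2 * L j1 k1 w.1
                 + w.2 0 j1 * w.2 0 j2 * M k1 w.1)].

Lemma connection_cubic (Gam : 'I_(n + 1) -> 'I_(n + 1) -> 'I_(n + 1) -> 'rV[K]_(n + 1) -> K) :
    (forall a b c, ana (Gam a b c) (ro w0.1)) ->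
    (\forall v \near ro w0.1, forall a b c, Gam a b c v = Gam b a c v) ->
    (\forall w \near w0, forall i j, F i j w =
       hess w (fun a b => \sum_c xi w.2 c * Gam a b c (ro w.1)) i j) ->
  cubic_system.
Proof.
move=> Ga Gs FE.
have an f : ana f (ro w0.1) -> analytic_J0 (fun z => f (ro z)) w0.1.
  move=> fa; rewrite /analytic_J0 (_ : _ \o jo = f); first exact: ana_analytic.
  by apply/funext => v; rewrite /= ro_jo.
exists (fun i j z => - Gam (ix i) (ix j) y (ro z)).
exists (fun i j k z => Gam (ix i) (ix j) (ix k) (ro z)
  - (k == i)%:R * Gam (ix j) y y (ro z) - (k == j)%:R * Gam (ix i) y y (ro z)).
exists (fun j k z => 2 * Gam (ix j) y (ix k) (ro z) - (k == j)%:R * Gam y y y (ro z)).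
exists (fun k z => Gam y y (ix k) (ro z)).
split; first split.
- by move=> i j; apply: (an (fun v => - Gam (ix i) (ix j) y v)); apply: anaN.
- move=> i j k; apply: (an (fun v => Gam (ix i) (ix j) (ix k) v
    - (k == i)%:R * Gam (ix j) y y v - (k == j)%:R * Gam (ix i) y y v)).
  by apply: anaB; [apply: anaB => //|]; apply: anaZ.
- move=> j k; apply: (an (fun v => 2 * Gam (ix j) y (ix k) v - (k == j)%:R * Gam y y y v)).
  by apply: anaB; apply: anaZ.
- by move=> k; apply: (an (Gam y y (ix k))).
- by move=> i j; apply/near_J0; apply: filterS Gs => v Gv; rewrite ro_jo Gv.
- by move=> i j k; apply/near_J0; apply: filterS Gs => v Gv; rewrite ro_jo Gv addrAC.
move=> i j; have {}Gs := near_J1_base Gs; near=> w.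
have Gw : forall a b c, Gam a b c (ro w.1) = Gam b a c (ro w.1) by near: w.
have -> : F i j w = hess w (fun a b => \sum_c xi w.2 c * Gam a b c (ro w.1)) i j.
  by move: i j; near: w.
exact: (@hess_connection _ w i j (fun a b c => Gam a b c (ro w.1))).
Unshelve. all: by end_near.
Qed.

(** The coefficients fix a connection only up to a projective change and the
    choice made here is that the components not determined by them vanish.
    Averaging makes the connection symmetric at every point, while [G] and [H]
    are symmetric only near the base point. *)
Definition cubic_connection (G : 'I_n -> 'I_n -> J0 -> K) (H : 'I_n -> 'I_n -> 'I_n -> J0 -> K)
    (L : 'I_n -> 'I_n -> J0 -> K) (M : 'I_n -> J0 -> K)
    (a b c : 'I_(n + 1)) (v : 'rV[K]_(n + 1)) : K :=
  match fintype.split a, fintype.split b, fintype.split c with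
  | inl i, inl j, inr _ => - 2^-1 * (G i j (jo v) + G j i (jo v))
  | inl i, inl j, inl k => 2^-1 * (H i j k (jo v) + H j i k (jo v))
  | inl i, inr _, inl k | inr _, inl i, inl k => 2^-1 * L i k (jo v)
  | inr _, inr _, inl k => M k (jo v)
  | _, _, inr _ => 0
  end.

Lemma cubic_system_connection : cubic_system ->
  exists Gam : 'I_(n + 1) -> 'I_(n + 1) -> 'I_(n + 1) -> 'rV[K]_(n + 1) -> K,
  [/\ forall a b c, ana (Gam a b c) (ro w0.1),
      forall a b c, Gam a b c = Gam b a c &
      \forall w \near w0, forall i j, F i j w =
        hess w (fun a b => \sum_c xi w.2 c * Gam a b c (ro w.1)) i j].
Proof.
move=> [G [H [L [M [[Ga Ha La Ma] Gs Hs FE]]]]].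
have an f : analytic_J0 f w0.1 -> ana (fun v => f (jo v)) (ro w0.1) by exact: analytic_ana.
exists (cubic_connection G H L M).
have sym a b c : cubic_connection G H L M a b c = cubic_connection G H L M b a c.
  apply/funext => v; rewrite /cubic_connection.
  by case: (fintype.split a) (fintype.split b) (fintype.split c) => [i|i] [j|j] [k|k] //; rewrite addrC.
split=> // [a b c|].
  rewrite /cubic_connection.
  case: (fintype.split a) (fintype.split b) (fintype.split c) => [i|i] [j|j] [k|k];
    try (by apply: ana_cst); try (by apply: an);
    by apply: anaZ; try (apply: anaD); apply: an.
have sx (i : 'I_n) : fintype.split (ix i) = inl i by exact: (@unsplitK n 1 (inl i)).

have sy : fintype.split y = inr ord0 by exact: (@unsplitK n 1 (inr ord0)).
have Gn : \forall w \near w0, forall x : 'I_n * 'I_n,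
    G x.1 x.2 (jo (ro w.1)) = G x.2 x.1 (jo (ro w.1)).
  by apply: near_forall => x; apply: (@near_J1_base n w0
    (fun v => G x.1 x.2 (jo v) = G x.2 x.1 (jo v))
    ((near_J0 w0.1 (fun z => G x.1 x.2 z = G x.2 x.1 z)).1 (Gs _ _))).
have Hn : \forall w \near w0, forall x : 'I_n * 'I_n * 'I_n,
    H x.1.1 x.1.2 x.2 (jo (ro w.1)) = H x.1.2 x.1.1 x.2 (jo (ro w.1)).
  by apply: near_forall => x; apply: (@near_J1_base n w0
    (fun v => H x.1.1 x.1.2 x.2 (jo v) = H x.1.2 x.1.1 x.2 (jo v))
    ((near_J0 w0.1 (fun z => H x.1.1 x.1.2 x.2 z = H x.1.2 x.1.1 x.2 z)).1 (Hs _ _ _))).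
have Fn : \forall w \near w0, forall x : 'I_n * 'I_n, F x.1 x.2 w =
    G x.1 x.2 w.1 + \sum_(k1 < n) w.2 0 k1 *
      (H x.1 x.2 k1 w.1 + 2^-1 * w.2 0 x.1 * L x.2 k1 w.1
       + 2^-1 * w.2 0 x.2 * L x.1 k1 w.1 + w.2 0 x.1 * w.2 0 x.2 * M k1 w.1).
  by apply: near_forall => x; apply: FE.
near=> w => i j.
have Gw : forall x : 'I_n * 'I_n, G x.1 x.2 (jo (ro w.1)) = G x.2 x.1 (jo (ro w.1)) by near: w.
have Hw : forall x : 'I_n * 'I_n * 'I_n,
    H x.1.1 x.1.2 x.2 (jo (ro w.1)) = H x.1.2 x.1.1 x.2 (jo (ro w.1)) by near: w.
rewrite (@hess_connection _ w i j (fun a b c => cubic_connection G H L M a b c (ro w.1))); last first.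
  by move=> a b c; rewrite sym.
have -> : F i j w = G i j w.1 + \sum_(k1 < n) w.2 0 k1 *
      (H i j k1 w.1 + 2^-1 * w.2 0 i * L j k1 w.1
       + 2^-1 * w.2 0 j * L i k1 w.1 + w.2 0 i * w.2 0 j * M k1 w.1).
  have : forall x : 'I_n * 'I_n, F x.1 x.2 w =
    G x.1 x.2 w.1 + \sum_(k1 < n) w.2 0 k1 *
      (H x.1 x.2 k1 w.1 + 2^-1 * w.2 0 x.1 * L x.2 k1 w.1
       + 2^-1 * w.2 0 x.2 * L x.1 k1 w.1 + w.2 0 x.1 * w.2 0 x.2 * M k1 w.1) by near: w.
  by move/(_ (i, j)).
rewrite /cubic_connection !sx sy jo_ro.
have := Gw (j, i); rewrite /= jo_ro => ->.
have half (t : K) : 2^-1 * (t + t) = t by field.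
rewrite mulNr opprK half; congr (_ + _); apply: eq_bigr => k _; rewrite !sx.
have := Hw (j, i, k); rewrite /= jo_ro => ->; rewrite half !mulr0 !subr0.
by rewrite ![2 * (_ * _)]mulrA !mulfV ?pnatr_eq0 // !mul1r.
Unshelve. all: by end_near.
Qed.

End Coefficients.

Lemma flat_iff_cubic n (F : 'I_n -> 'I_n -> 'rV[K]_n * K * 'rV[K]_n -> K) w0 : (2 <= n)%N ->
    (forall i j, \forall w \near w0, F i j w = F j i w) -> completely_integrable F w0 ->
  equivalent_to_flat F w0 <-> cubic_system F w0.
Proof.
move=> n2 Fs Fint; split=> [[phi [[Pa _] flat]]|/cubic_system_connection[Gam [Ga Gs FE]]].
  have [Gam [Ga Gs FE]] := flat_is_cubic (ltnW n2) ((analytic_map_comp _ _).1 Pa) Fs flat.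
  exact: connection_cubic Ga Gs FE.
exact: integrable_cubic_flat n2 Gs Ga FE Fint.
Qed.

End Analytic.

Theorem theorem1p1 (R : realType) (K : numFieldType)
    (hK : K = (R : numFieldType) \/ K = (R[i] : numFieldType))
    (n : nat) (hn : (2 <= n)%N)
    (w0 : 'rV[K]_n * K * 'rV[K]_n)
    (F : 'I_n -> 'I_n -> 'rV[K]_n * K * 'rV[K]_n -> K)
    (F_analytic : forall j1 j2 : 'I_n, analytic_J1 (F j1 j2) w0)
    (F_sym : forall j1 j2 : 'I_n, \forall w \near w0, F j1 j2 w = F j2 j1 w)
    (F_int : completely_integrable F w0) :
  equivalent_to_flat F w0 <->
  exists (G : 'I_n -> 'I_n -> 'rV[K]_n * K -> K)
         (H : 'I_n -> 'I_n -> 'I_n -> 'rV[K]_n * K -> K)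
         (L : 'I_n -> 'I_n -> 'rV[K]_n * K -> K)
         (M : 'I_n -> 'rV[K]_n * K -> K),
    [/\ [/\ forall j1 j2 : 'I_n, analytic_J0 (G j1 j2) w0.1,
            forall j1 j2 k1 : 'I_n, analytic_J0 (H j1 j2 k1) w0.1,
            forall j1 k1 : 'I_n, analytic_J0 (L j1 k1) w0.1
          & forall k1 : 'I_n, analytic_J0 (M k1) w0.1],
        forall j1 j2 : 'I_n, \forall z \near w0.1, G j1 j2 z = G j2 j1 z,
        forall j1 j2 k1 : 'I_n,
          \forall z \near w0.1, H j1 j2 k1 z = H j2 j1 k1 z
      & forall j1 j2 : 'I_n, \forall w \near w0,
          F j1 j2 w =
            G j1 j2 w.1
            + \sum_(k1 < n) w.2 0 k1 *
                (H j1 j2 k1 w.1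
                 + 2^-1 * w.2 0 j1 * L j2 k1 w.1
                 + 2^-1 * w.2 0 j2 * L j1 k1 w.1
                 + w.2 0 j1 * w.2 0 j2 * M k1 w.1)].
Proof.
have [V] := realnorm_exists hK.
exact: (flat_iff_cubic V hn F_sym F_int).
Qed.
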